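(* Let $\mathcal H$ be a de Branges space, $D\subseteq\mathbb C^+\cup\mathbb R$, and $\mathfrak m\in\operatorname{Adm}_D\mathcal H$. Then $\mathfrak m^\flat$ is continuous on $\mathbb C^+\cup\mathbb R$ and $\log\mathfrak m^\flat$ is subharmonic on $\mathbb C^+$. Moreover, $$\mathfrak d_{\mathfrak m^\flat}=\max\{\mathfrak d_{\mathfrak m},\mathfrak d_{\mathcal H}\}\quad\text{and}\quad\operatorname{mt}_{\mathcal H}\mathfrak m^\flat=\operatorname{mt}_{\mathcal H}\mathcal R_{\mathfrak m}(\mathcal H).$$
   Context: $\mathbb C^+$ is the open upper half-plane and $F^\#(z):=\overline{F(\bar z)}$. A de Branges space is a (nonzero) Hilbert space $\mathcal H$ of entire functions such that: (dB1) for each $w\in\mathbb C$, $F\mapsto F(w)$ is a continuous linear functional on $\mathcal H$; (dB2) if $F\in\mathcal H$ then $F^\#\in\mathcal H$ and $\|F^\#\|=\|F\|$; (dB3) if $w\in\mathbb C\setminus\mathbb R$, $F\in\mathcal H$, $F(w)=0$, then $\frac{z-\bar w}{z-w}F(z)\in\mathcal H$ and $\|\frac{z-\bar w}{z-w}F(z)\|=\|F\|$. Equivalently, $\mathcal H=\mathcal H(E)$ isometrically for some Hermite–Biehler function $E$ (entire, $|E(\bar z)|<|E(z)|$ for $z\in\mathbb C^+$), where $\mathcal H(E)=\{F\text{ entire}: F/E,\ F^\#/E\in H^2(\mathbb C^+)\}$ with norm $(\int_{\mathbb R}|F(t)/E(t)|^2dt)^{1/2}$. Standing assumption: for every $x\in\mathbb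 R$ there is $F\in\mathcal H$ with $F(x)\ne0$. Let $D\subseteq\mathbb C^+\cup\mathbb R$ be unbounded (bounded sets are excluded throughout) and $\mathfrak m:D\to[0,\infty)$. Define $$R_{\mathfrak m}(\mathcal H):=\{F\in\mathcal H:\ \exists\,C>0:\ |F(z)|,|F^\#(z)|\le C\,\mathfrak m(z)\ \forall z\in D\},\qquad\mathcal R_{\mathfrak m}(\mathcal H):=\operatorname{clos}_{\mathcal H}R_{\mathfrak m}(\mathcal H),$$ $$B_{\mathfrak m}(\mathcal H):=\{F\in\mathcal H:\ \|F\|_{\mathcal H}\le1,\ |F(z)|,|F^\#(z)|\le\mathfrak m(z)\ \forall z\in D\}.$$ The zero divisor of $\mathfrak m$ is $\mathfrak d_{\mathfrak m}(w):=\inf\{n\in\mathbb N_0:\ \text{there is a neighbourhood } U \text{ of } w \text{ with } \inf_{z\in U\cap D,\ |z-w|^n\neq 0}\frac{\mathfrak m(z)}{|z-w|^n}>0\}$, $w\in\mathbb C$ (with $0^0=1$, $\inf\emptyset=\infty$). $\operatorname{Adm}_D\mathcal H$ is the set of admissible majorants on $D$: those $\mathfrak m:D\to[0,\infty)$ with $\{w:\mathfrak d_{\mathfrak m}(w)>0\}\subseteq\mathbb R$ and $R_{\mathfrak m}(\mathcal H)\neq\{0\}$. $\mathfrak d_{\mathcal H}(w)$ is the minimum over $F\in\mathcal H$ of the multiplicity of $w$ as a zero of $F$. The function $\mathfrak m^\flat:\mathbb C^+\cup\mathbb R\to[0,\infty)$ is defined by $\mathfrak m^\flat(z):=\sup\{|F(z)|:\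 F\in B_{\mathfrak m}(\mathcal H)\}$. Relative mean type: for a function $f$ defined on $\mathbb C^+$, $\operatorname{mt}_{\mathcal H}f:=\limsup_{y\to+\infty}\frac1y\log\frac{|f(iy)|}{|E(iy)|}$, where $\mathcal H=\mathcal H(E)$; for a subspace $\mathcal L\subseteq\mathcal H$, $\operatorname{mt}_{\mathcal H}\mathcal L:=\sup_{F\in\mathcal L}\operatorname{mt}_{\mathcal H}F$. *)

(* Defs.v *)
From HB Require Import structures.
From mathcomp Require Import all_boot all_order all_algebra.
From mathcomp Require Import all_classical all_reals all_analysis.
From mathcomp Require Import complex.

Set Implicit Arguments.
Unset Strict Implicit.
Unset Printing Implicit Defensive.

Import Order.TTheory GRing.Theory Num.Theory.
Import numFieldNormedType.Exports.

Local Open Scope classical_set_scope.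
Local Open Scope complex_scope.
Local Open Scope ring_scope.

(* The ascription to numClosedFieldType is what lets the norm topology and the
   module structure of R[i] over itself be inferred; they are not found on the
   bare type R[i]. *)
Definition Cx (R : realType) : numClosedFieldType := R[i].

(* The norm of Cx R takes its values in Cx R; this is the same modulus, as an
   element of R. *)
Definition cabs (R : realType) (z : Cx R) : R := Normc.normc z.

Definition UHP (R : realType) : set (Cx R) := [set z | 0 < complex.Im z].
Definition realline (R : realType) : set (Cx R) := [set z | complex.Im z = 0].
Definition closedUHP (R : realType) : set (Cx R) := @UHP R `|` @realline R.

Definition holomorphic_on (R : realType) (U : set (Cx R)) (f : Cx R -> Cx R) :=
  forall z, U z -> derivable f z 1.

Definition entire (R : realType) (f : Cx R -> Cx R) := holomorphic_on setT f.

Definition sharp (R : realType) (f : Cx R -> Cx R) : Cx R -> Cx R :=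
  fun z => (f z^*)^*.

(* u takes values in [-oo, +oo[ on U, is upper semicontinuous there, and
   satisfies the sub-mean value inequality on every closed disc contained in U;
   the function constantly -oo is not excluded. *)
Definition subharmonic_on (R : realType) (U : set (Cx R))
    (u : Cx R -> \bar R) :=
  [/\ forall z, U z -> (u z < +oo)%E,
      forall z (a : R), U z -> (u z < a%:E)%E ->
        \forall z' \near z, (u z' < a%:E)%E
    & forall (a : Cx R) (r : R), 0 < r ->
        (forall z, cabs (z - a) <= r -> U z) ->
        (u a <= ((2 * pi)^-1)%:E *
          \int[@lebesgue_measure R]_(t in `[0%R, (2 * pi)%R])
            u (a + (r%:C : Cx R) * (cos t +i* sin t))%R)%E ].

Definition hardy2 (R : realType) (f : Cx R -> Cx R) :=
  holomorphic_on (@UHP R) f /\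
  exists M : R, forall y : R, 0 < y ->
    (\int[@lebesgue_measure R]_(x in setT)
       (cabs (f (x +i* y)) ^+ 2)%R%:E <= M%:E)%E.

Definition hermite_biehler (R : realType) (E : Cx R -> Cx R) :=
  entire E /\ forall z, UHP z -> cabs (E z^*) < cabs (E z).

Definition HE (R : realType) (E : Cx R -> Cx R) : set (Cx R -> Cx R) :=
  [set F | [/\ entire F, hardy2 (fun z => F z / E z)
             & hardy2 (fun z => sharp F z / E z)]].

Definition HE_norm (R : realType) (E F : Cx R -> Cx R) : \bar R :=
  sqrte (\int[@lebesgue_measure R]_(t in setT)
           (cabs (F t%:C / E t%:C) ^+ 2)%R%:E)%E.

(* A Hilbert space of entire functions is presented as a complex Banach space H
   whose norm comes from an inner product, together with an injective linear
   map ev sending an element of H to the entire function it stands for. *)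
Record is_deBranges (R : realType) (H : completeNormedModType (Cx R))
    (ev : {linear H -> (Cx R -> Cx R)}) : Prop := {
  dB_hilbert : exists ip : {dot H for (@Num.conj (Cx R))},
    forall F : H, `|F| ^+ 2 = ip F F;
  dB_neq0 : exists F : H, F <> 0;
  dB_inj : injective ev;
  dB_entire : forall F : H, entire (ev F);
  dB1 : forall w : Cx R, continuous (fun F : H => ev F w);
  dB2 : forall F : H, exists2 G : H, ev G = sharp (ev F) & `|G| = `|F|;
  (* G is entire, so its value at w is determined by the others *)
  dB3 : forall (w : Cx R) (F : H), ~ realline w -> ev F w = 0 ->
    exists2 G : H,
      forall z, z <> w -> ev G z = (z - w^*) / (z - w) * ev F z
    & `|G| = `|F| }.

Definition is_HE (R : realType) (H : completeNormedModType (Cx R))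
    (ev : {linear H -> (Cx R -> Cx R)}) (E : Cx R -> Cx R) :=
  range ev = HE E /\
  forall F : H, (complex.Re `|F|)%:E = HE_norm E (ev F).

(* Majorants m : D -> [0, +oo[ are represented by total functions; every
   definition below reads m on D only. *)
Section Majorants.
Variables (R : realType) (H : completeNormedModType (Cx R)).
Variable ev : {linear H -> (Cx R -> Cx R)}.
Implicit Types (D : set (Cx R)) (m : Cx R -> R).

Definition Rm D m : set H :=
  [set F | exists2 C : R, 0 < C &
    forall z, D z ->
      cabs (ev F z) <= C * m z /\ cabs (sharp (ev F) z) <= C * m z].

Definition clRm D m : set H := closure (Rm D m).

Definition Bm D m : set H :=
  [set F | `|F| <= 1 /\
    forall z, D z -> cabs (ev F z) <= m z /\ cabs (sharp (ev F) z) <= m z].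

(* The set contains 0 and is bounded, by continuity of point evaluation on the
   unit ball, so the real-valued sup is the actual supremum. *)
Definition mflat D m : Cx R -> R :=
  fun z => sup [set cabs (ev F z) | F in Bm D m].

(* The value of a zero divisor is an extended natural number, embedded in
   \bar R; ereal_inf set0 = +oo, as in the convention inf {} = +oo. *)
Definition zdiv D m (w : Cx R) : \bar R :=
  ereal_inf [set (n%:R : R)%:E | n in [set n : nat |
    exists2 U, nbhs w U &
      (0 < ereal_inf [set (m z / cabs (z - w) ^+ n)%R%:E |
             z in [set z | [/\ U z, D z & (cabs (z - w) ^+ n)%R <> 0%R]]])%E ]].

(* Order of vanishing of an entire function at w; +oo for F = 0. *)
Definition zmult (F : Cx R -> Cx R) (w : Cx R) : \bar R :=
  ereal_inf [set (n%:R : R)%:E | n in [set n : nat | derive1n n F w <> 0]].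

Definition zdivH (w : Cx R) : \bar R :=
  ereal_inf [set zmult (ev F) w | F in [set: H]].

Definition admissible D m :=
  [/\ forall z, D z -> 0 <= m z,
      [set w | (0 < zdiv D m w)%E] `<=` @realline R
    & Rm D m <> [set 0]].

(* f stands for the modulus of the function whose mean type is taken. *)
Definition mt (E : Cx R -> Cx R) (f : Cx R -> R) : \bar R :=
  limf_esup (fun y : R =>
    ((y^-1)%:E * lne (f (0 +i* y) / cabs (E (0 +i* y)))%R%:E)%E) +oo.

Definition mt_sub (E : Cx R -> Cx R) (L : set H) : \bar R :=
  ereal_sup [set mt E (fun z => cabs (ev F z)) | F in L].

End Majorants.

(* Main.v *)
Require Import Defs.
From HB Require Import structures.
From mathcomp Require Import all_boot all_order all_algebra.
From mathcomp Require Import all_classical all_reals all_analysis.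
From mathcomp Require Import complex.
From mathcomp Require Import ring lra.
From mathcomp Require Import measurable_realfun.
Set Implicit Arguments.
Unset Strict Implicit.
Unset Printing Implicit Defensive.
Import Order.TTheory GRing.Theory Num.Theory.
Import numFieldNormedType.Exports.
Local Open Scope classical_set_scope.
Local Open Scope complex_scope.
Local Open Scope ring_scope.

(** The functions entering [m^flat] lie in the unit ball of the space, and the
    proof uses two tools.

    The first is uniform boundedness. Point evaluations are continuous, so a
    family of (differences of weighted) point evaluations that is bounded on
    each function is bounded by a multiple of the norm
    ([ev_uniform_boundedness]). Difference quotients at [w] are such a family,
    which makes [m^flat] Lipschitz at every point ([ev_lipschitz],
    [mflat_continuous]). The evaluations [F (i y) / (E (i y) exp (t y))],
    [y >= 1], on the closure of [R_m] are such a family for every [t] above the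
    mean type of that subspace, which bounds the mean type of [m^flat] by it
    ([mt_mflat_le]).

    The second is the mean value inequality for holomorphic functions, with the
    maximum principle that follows from it. Applied to the product of the
    functions [F (a + omega ^ j z)] over the [n]-th roots of unity, it bounds
    [log |F (a)|] by averages of [log |F|], hence of the continuous function
    [log m^flat], over [n] equidistant points of a circle; as [n] grows these
    tend to the mean, and subharmonicity follows ([mflat_submean]). The maximum
    principle also gives the Phragmen-Lindelof principle behind the other
    inequality of mean types: if [m^flat (i y) = O (|E (i y)| exp (t y))], then
    every [G] in [R_m] satisfies
    [|G (i y) / E (i y)| <= K ||G|| exp (t (y - 1))] for [y >= 1], with [K]
    independent of [G], because [G / E] is bounded by [K ||G||] on
    [Im z >= 1]. Such an estimate survives limits in the norm ([mt_clRm_le]).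

    For the zero divisors, no point is a common zero of the space
    ([nonvanishing]), so [d_H = 0], and [m^flat <= m] on [D] gives one
    inequality. For the other one, at a real point [w] with
    [m >= c |z - w| ^ n] near [w], some function of [R_m] must vanish at [w] of
    order at most [n]: otherwise [F / (z - w)] would belong to [R_m] for every
    [F] in [R_m], and the division could be repeated forever
    ([Rm_low_order]). The point here is that [F / (z - w)] belongs to the space
    ([real_division]); it is obtained as a limit of averages, over a small
    circle around [w], of quotients by [z - zeta] with nonreal [zeta]. In the
    upper half-plane the same role is played by Blaschke factors, which do not
    change the norm; iterating the division there shows that [m^flat] is
    positive ([nonreal_common_zero], [mflat_gt0]).

    The complex analysis is built from Goursat's theorem for rectangles. In
    logarithmic coordinates it says that circular means do not depend on the
    radius, which is the mean value property; Cauchy's estimate for the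
    derivative and the maximum principle follow from it. *)


(** * The complex plane with a real-valued modulus *)

Arguments cabs : simpl never.

Section ComplexBasics.
Variable R : realType.
Local Notation C := (Cx R).
Implicit Types (z w : C) (r s : R).

Lemma norm_cabs z : `|z| = (cabs z)%:C :> C.
Proof. by case: z. Qed.

Lemma cabsE z : cabs z = Num.sqrt (complex.Re z ^+ 2 + complex.Im z ^+ 2).
Proof. by case: z. Qed.

Lemma cabs_sqr z : cabs z ^+ 2 = complex.Re z ^+ 2 + complex.Im z ^+ 2.
Proof. by rewrite cabsE sqr_sqrtr// addr_ge0// sqr_ge0. Qed.

Lemma cabs_ge0 z : 0 <= cabs z.
Proof. by rewrite cabsE sqrtr_ge0. Qed.

Lemma cabs0 : cabs (0 : C) = 0. Proof. exact: Normc.normc0. Qed.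
Lemma cabs1 : cabs (1 : C) = 1. Proof. exact: Normc.normc1. Qed.
Lemma cabsM z w : cabs (z * w) = cabs z * cabs w.
Proof. exact: Normc.normcM. Qed.
Lemma cabsV z : cabs z^-1 = (cabs z)^-1.
Proof. exact: Normc.normcV. Qed.
Lemma cabs_div z w : cabs (z / w) = cabs z / cabs w.
Proof. by rewrite cabsM cabsV. Qed.
Lemma cabsX z n : cabs (z ^+ n) = cabs z ^+ n.
Proof. by elim: n => [|n ih]; rewrite ?expr0 ?cabs1// !exprS cabsM ih. Qed.

Lemma cabs_prod (I : Type) (s : seq I) (f : I -> C) :
  cabs (\prod_(i <- s) f i) = \prod_(i <- s) cabs (f i).
Proof.
by elim: s => [|a s ih]; rewrite ?big_nil ?cabs1// !big_cons cabsM ih.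
Qed.

Lemma cabs_eq0 z : (cabs z == 0) = (z == 0).
Proof.
by apply/eqP/eqP => [/Normc.eq0_normc//|->]; rewrite cabs0.
Qed.

Lemma cabs_gt0 z : (0 < cabs z) = (z != 0).
Proof. by rewrite lt_def cabs_ge0 andbT cabs_eq0. Qed.

Lemma ler_cabsD z w : cabs (z + w) <= cabs z + cabs w.
Proof.
rewrite -lecR -!norm_cabs.
have -> : (cabs z + cabs w)%:C = `|z| + `|w| :> C by rewrite !norm_cabs rmorphD.
exact: ler_normD.
Qed.

Lemma cabsN z : cabs (- z) = cabs z.
Proof. by apply: complexI; rewrite -!norm_cabs normrN. Qed.

Lemma cabsB z w : cabs (z - w) = cabs (w - z).
Proof. by rewrite -cabsN opprB. Qed.

Lemma ler_cabsB z w : cabs (z - w) <= cabs z + cabs w.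
Proof. by rewrite -(cabsN w) ler_cabsD. Qed.

Lemma ler_dist_cabs z w : `|cabs z - cabs w| <= cabs (z - w).
Proof.
rewrite ler_norml; apply/andP; split.
  rewrite lerNl opprB lerBlDr cabsB; have := ler_cabsD (w - z) z.
  by rewrite subrK.
by rewrite lerBlDr; have := ler_cabsD (z - w) w; rewrite subrK.
Qed.

Lemma cabs_real r : cabs (r%:C : C) = `|r|.
Proof. by rewrite cabsE/= expr0n/= addr0 sqrtr_sqr. Qed.

Lemma normr_Re_le z : `|complex.Re z| <= cabs z.
Proof.
rewrite -sqrtr_sqr cabsE ler_wsqrtr// lerDl sqr_ge0//.
Qed.

Lemma normr_Im_le z : `|complex.Im z| <= cabs z.
Proof.
rewrite -sqrtr_sqr cabsE ler_wsqrtr// lerDr sqr_ge0//.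
Qed.

Lemma cabs_le_ReIm z : cabs z <= `|complex.Re z| + `|complex.Im z|.
Proof.
case: z => a b.
have -> : (a +i* b : C) = a%:C + (0 +i* b) by simpc.
apply: (le_trans (ler_cabsD _ _)); rewrite cabs_real lerD//= ?addr0 ?add0r//.
by rewrite cabsE/= expr0n/= add0r sqrtr_sqr.
Qed.

Lemma cReD z w : complex.Re (z + w) = complex.Re z + complex.Re w.
Proof. by case: z; case: w. Qed.
Lemma cImD z w : complex.Im (z + w) = complex.Im z + complex.Im w.
Proof. by case: z; case: w. Qed.
Lemma cReN z : complex.Re (- z) = - complex.Re z.
Proof. by case: z. Qed.
Lemma cImN z : complex.Im (- z) = - complex.Im z.
Proof. by case: z. Qed.
Lemma cReM z w : complex.Re (z * w) =
  complex.Re z * complex.Re w - complex.Im z * complex.Im w.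
Proof. by case: z; case: w. Qed.
Lemma cImM z w : complex.Im (z * w) =
  complex.Re z * complex.Im w + complex.Im z * complex.Re w.
Proof. by case: z; case: w. Qed.

Lemma conjE z : z^* = complex.Re z +i* (- complex.Im z) :> C.
Proof. by case: z. Qed.

Lemma cabs_conj z : cabs z^* = cabs z.
Proof. by rewrite conjE !cabsE/= sqrrN. Qed.

Lemma Cext z w : complex.Re z = complex.Re w -> complex.Im z = complex.Im w ->
  z = w.
Proof. by case: z => a b; case: w => c d /= -> ->. Qed.

Lemma nbhs_cabsP z (A : set C) :
  nbhs z A <-> exists2 e : R, 0 < e & forall w, cabs (w - z) < e -> A w.
Proof.
split=> [/nbhs_ballP[e/= e0 he]|[e e0 he]].
  have [er e0'] : e = (complex.Re e)%:C /\ 0 < complex.Re e.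
    by case: e e0 {he} => a b; rewrite ltcE/= => /andP[/eqP -> ?].
  exists (complex.Re e) => // w wz; apply: he.
  by rewrite /ball/= er distrC norm_cabs ltcR.
apply/nbhs_ballP; exists (e%:C) => /=; first by rewrite ltcR.
by move=> w; rewrite /ball/= distrC norm_cabs ltcR => /he.
Qed.

Lemma cvg_cabsP (T : Type) (F : set_system T) (FF : Filter F) (f : T -> C) l :
  f @ F --> l <-> forall e : R, 0 < e -> \forall x \near F, cabs (f x - l) < e.
Proof.
split=> [fl e e0|h A /nbhs_cabsP[e e0 he]].
  by apply: (fl [set w | cabs (w - l) < e]); apply/nbhs_cabsP; exists e.
by apply: filterS (h _ e0) => x /he.
Qed.

Lemma near_cabs z r : 0 < r -> \forall w \near z, cabs (w - z) < r.
Proof. by move=> r0; apply/nbhs_cabsP; exists r. Qed.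

(** Radii and errors are real here, whereas the norm used by [derivable] takes
    its values in the complex field. *)
Definition cdiff (f : C -> C) z c := forall e : R, 0 < e ->
  exists2 d, 0 < d & forall w, cabs (w - z) < d ->
    cabs (f w - f z - c * (w - z)) <= e * cabs (w - z).

Lemma derivable_cdiffP (f : C -> C) z :
  derivable f z 1 <-> exists c, cdiff f z c.
Proof.
split=> [/cvg_ex[/= c fc]|[c fc]].
  exists c => e e0.
  move/cvg_cabsP : fc => /(_ _ e0) [d/= d0 hd].
  have [dr d0'] : d = (complex.Re d)%:C /\ 0 < complex.Re d.
    by case: d d0 {hd} => a b; rewrite ltcE/= => /andP[/eqP -> ?].
  exists (complex.Re d) => // w wz.
  have [->|wz0] := eqVneq w z; first by rewrite !subrr mulr0 subrr !cabs0 mulr0.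
  have := hd (w - z); rewrite /ball/= sub0r normrN norm_cabs dr ltcR wz.
  rewrite subr_eq0 wz0 => /(_ isT isT).
  rewrite /GRing.scale/= mulr1 subrK => h.
  have -> : f w - f z - c * (w - z) = ((w - z)^-1 * (f w - f z) - c) * (w - z).
    by rewrite mulrBl mulrAC mulVf ?mul1r// subr_eq0.
  by rewrite cabsM ler_wpM2r ?cabs_ge0// ltW.
apply/cvg_ex; exists c; apply/cvg_cabsP => e e0.
have e20 : 0 < e / 2 by rewrite divr_gt0.
have [d d0 hd] := fc _ e20.
exists d%:C => /=; first by rewrite ltcR.
move=> h /=; rewrite sub0r normrN norm_cabs ltcR => hd' h0.
have := hd (h + z); rewrite addrK => /(_ hd').
rewrite /GRing.scale/= mulr1 => k.
have -> : h^-1 * (f (h + z) - f z) - c = h^-1 * (f (h + z) - f z - c * h).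
  by field.
rewrite cabsM cabsV.
rewrite ltr_pdivrMl ?cabs_gt0//.
apply: (le_lt_trans k); rewrite mulrC ltr_pM2l ?cabs_gt0//.
by rewrite ltr_pdivrMr// ltr_pMr// ltr1n.
Qed.

Lemma cont_cabsP (f : C -> C) z : {for z, continuous f} <->
  forall e : R, 0 < e -> exists2 d, 0 < d & forall w, cabs (w - z) < d ->
    cabs (f w - f z) < e.
Proof.
split=> [h e e0|h].
  by apply/nbhs_cabsP; exact: ((cvg_cabsP (nbhs_filter z) f (f z)).1 h e e0).
apply: ((cvg_cabsP (nbhs_filter z) f (f z)).2 _) => e /h hd.
by apply/nbhs_cabsP.
Qed.

Lemma hol_cont (f : C -> C) z : derivable f z 1 -> {for z, continuous f}.
Proof. by move=> /derivable1_diffP/differentiable_continuous. Qed.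

Lemma hol_cst (c : C) z : derivable (fun=> c) z 1.
Proof. exact: derivable_cst. Qed.
Lemma hol_id z : derivable (fun x : C => x) z 1.
Proof. exact: derivable_id. Qed.
Lemma holD (f g : C -> C) z : derivable f z 1 -> derivable g z 1 ->
  derivable (fun x => f x + g x) z 1.
Proof. exact: derivableD. Qed.
Lemma holN (f : C -> C) z : derivable f z 1 -> derivable (fun x => - f x) z 1.
Proof. exact: derivableN. Qed.
Lemma holB (f g : C -> C) z : derivable f z 1 -> derivable g z 1 ->
  derivable (fun x => f x - g x) z 1.
Proof. exact: derivableB. Qed.
Lemma holM (f g : C -> C) z : derivable f z 1 -> derivable g z 1 ->
  derivable (fun x => f x * g x) z 1.
Proof. exact: derivableM. Qed.
Lemma holV (f : C -> C) z : f z != 0 -> derivable f z 1 ->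
  derivable (fun x => (f x)^-1) z 1.
Proof. exact: derivableV. Qed.
Lemma hol_div (f g : C -> C) z : derivable f z 1 -> derivable g z 1 ->
  g z != 0 -> derivable (fun x => f x / g x) z 1.
Proof.
move=> hf hg g0.
exact: (@holM f (fun x => (g x)^-1) z hf (@holV g z g0 hg)).
Qed.
Lemma holX (f : C -> C) z n : derivable f z 1 ->
  derivable (fun x => f x ^+ n) z 1.
Proof.
move=> hf; elim: n => [|n ih]; first exact: hol_cst.
under eq_fun do rewrite exprS.
exact: (@holM f (fun x => f x ^+ n) z hf ih).
Qed.
Lemma hol_comp (g f : C -> C) z : derivable f z 1 -> derivable g (f z) 1 ->
  derivable (fun x => g (f x)) z 1.
Proof.
move=> /derivable1_diffP hf /derivable1_diffP hg.
apply/derivable1_diffP; exact: (@differentiable_comp _ _ _ _ f g z hf hg).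
Qed.
Lemma hol_prod (I : Type) (s : seq I) (f : I -> C -> C) z :
  (forall i, derivable (f i) z 1) -> derivable (fun x => \prod_(i <- s) f i x) z 1.
Proof.
move=> hf; elim: s => [|a s ih].
  by under eq_fun do rewrite big_nil; exact: hol_cst.
under eq_fun do rewrite big_cons.
exact: (@holM (f a) (fun x => \prod_(i <- s) f i x) z (hf a) ih).
Qed.

Lemma hol_near (f g : C -> C) z : (\forall w \near z, f w = g w) ->
  derivable f z 1 -> derivable g z 1.
Proof.
move=> /nbhs_cabsP[d d0 hd] /derivable_cdiffP[c fc].
apply/derivable_cdiffP; exists c => e e0.
have [d' d'0 hd'] := fc _ e0.
exists (Num.min d d'); first by rewrite lt_min d0.
move=> w; rewrite lt_min => /andP[w1 w2].
by rewrite -!hd ?subrr ?cabs0//; exact: hd'.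
Qed.

Lemma cabs_lip_cont (g : C -> R) :
  (forall z w, `|g w - g z| <= cabs (w - z)) -> continuous g.
Proof.
move=> gl z A /= /nbhs_ballP[e/= e0 he].
apply/nbhs_cabsP; exists e => // w wz; apply: he.
by rewrite /ball/= distrC (le_lt_trans (gl _ _)).
Qed.

Lemma Re_cont : continuous (fun z : C => complex.Re z).
Proof.
apply: cabs_lip_cont => z w.
by rewrite -cReN -cReD; exact: normr_Re_le.
Qed.

Lemma Im_cont : continuous (fun z : C => complex.Im z).
Proof.
apply: cabs_lip_cont => z w.
by rewrite -cImN -cImD; exact: normr_Im_le.
Qed.

Lemma cabs_cont : continuous (fun z : C => cabs z).
Proof. by apply: cabs_lip_cont => z w; exact: ler_dist_cabs. Qed.

Lemma cvg_complex (T : Type) (F : set_system T) (FF : Filter F)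
    (f g : T -> R) (a b : R) : f @ F --> a -> g @ F --> b ->
  (fun t => f t +i* g t : C) @ F --> (a +i* b : C).
Proof.
move=> /cvgrPdist_lt fa /cvgrPdist_lt gb; apply/cvg_cabsP => e e0.
have e20 : 0 < e / 2 by rewrite divr_gt0.
near=> t.
apply: (le_lt_trans (cabs_le_ReIm _)); rewrite /= [ltRHS]splitr ltrD//.
  by rewrite distrC; near: t; exact: fa.
by rewrite distrC; near: t; exact: gb.
Unshelve. all: by end_near. Qed.

Lemma compact_cabs (A : set C) r : closed A -> (forall z, A z -> cabs z <= r) ->
  compact A.
Proof.
move=> cA hA.
pose Q : set (R * R) := `[- r, r] `*` `[- r, r].
pose f (p : R * R) : C := p.1 +i* p.2.
have cQ : compact Q by apply: compact_setX; exact: segment_compact.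
have cf : {within Q, continuous f}.
  apply: continuous_subspaceT => p; apply: cvg_complex.
    exact: cvg_fst.
  exact: cvg_snd.
apply: (subclosed_compact cA (continuous_compact cf cQ)) => z Az.
exists (complex.Re z, complex.Im z); last by rewrite /f; case: z {Az}.
split=> /=; rewrite in_itv/= -ler_norml; apply: le_trans (hA _ Az).
  exact: normr_Re_le.
exact: normr_Im_le.
Qed.

Lemma closed_cabs_le z r : closed [set w : C | cabs (w - z) <= r].
Proof.
apply: (closed_comp (f := fun w : C => cabs (w - z)) (D := [set s | s <= r])).
  move=> w _; apply: (@continuous_comp _ _ _ (fun w => w - z) (@cabs R)).
    exact: (@hol_cont (fun w => w - z) w (holB (@hol_id w) (@hol_cst z w))).
  exact: cabs_cont.
exact: closed_le.
Qed.

Lemma compact_disc z r : compact [set w : C | cabs (w - z) <= r].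
Proof.
apply: (@compact_cabs _ (r + cabs z)); first exact: closed_cabs_le.
by move=> w /= h; rewrite -(subrK z w) (le_trans (ler_cabsD _ _))// lerD2r.
Qed.

End ComplexBasics.

(** * Integrals of complex-valued functions of a real variable *)

Section ComplexIntegral.
Variable R : realType.
Local Notation C := (Cx R).
Local Notation mu := (@lebesgue_measure R).

Lemma realC_eq0 (r : R) : ((r%:C : C) == 0) = (r == 0).
Proof.
by apply/eqP/eqP => [h|->//]; exact: (congr1 (fun z : C => complex.Re z) h).
Qed.

Definition cint (f : R -> C) (a b : R) : C :=
  (\int[mu]_(t in `[a, b]) complex.Re (f t)) +i*
  (\int[mu]_(t in `[a, b]) complex.Im (f t)).

Lemma itv_meas (a b : R) : measurable (`[a, b] : set (measurableTypeR R)).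
Proof. exact: measurable_itv. Qed.

Lemma cont_integrable (f : R -> R) a b : {within `[a, b], continuous f} ->
  mu.-integrable `[a, b] (EFin \o f).
Proof. by move=> cf; apply: continuous_compact_integrable => //; exact: segment_compact. Qed.

Lemma Re_integrable (f : R -> C) a b : {within `[a, b], continuous f} ->
  mu.-integrable `[a, b] (EFin \o (fun t => complex.Re (f t))).
Proof.
move=> cf; apply: cont_integrable => x.
by apply: continuous_comp; [exact: cf|exact: Re_cont].
Qed.

Lemma Im_integrable (f : R -> C) a b : {within `[a, b], continuous f} ->
  mu.-integrable `[a, b] (EFin \o (fun t => complex.Im (f t))).
Proof.
move=> cf; apply: cont_integrable => x.
by apply: continuous_comp; [exact: cf|exact: Im_cont].
Qed.

Lemma eq_cint (f g : R -> C) a b : (forall t, a <= t <= b -> f t = g t) ->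
  cint f a b = cint g a b.
Proof.
move=> fg; congr (_ +i* _); apply: eq_Rintegral => x;
  by rewrite inE/= in_itv/= => /fg ->.
Qed.

Lemma Rintegral_cat (f : R -> R) a b c : a <= b -> b <= c ->
  {within `[a, c], continuous f} ->
  \int[mu]_(t in `[a, b]) f t + \int[mu]_(t in `[b, c]) f t =
  \int[mu]_(t in `[a, c]) f t.
Proof.
move=> ab bc cf.
have fi := cont_integrable cf.
have := @Rintegral_itvB R f (BLeft a) (BRight c) b fi.
rewrite !bnd_simp => /(_ ab bc).
rewrite Rintegral_itv_obnd_cbnd => [h|].
  by rewrite -h addrC subrK.
apply: integrableS fi; [exact: measurable_itv|exact: measurable_itv|].
by apply: subset_itvr; rewrite bnd_simp.
Qed.

Lemma cint_cat (f : R -> C) a b c : a <= b -> b <= c ->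
  {within `[a, c], continuous f} -> cint f a b + cint f b c = cint f a c.
Proof.
move=> ab bc cf; rewrite /cint.
have cR : {within `[a, c], continuous (fun t => complex.Re (f t))}.
  by move=> x; apply: continuous_comp; [exact: cf|exact: Re_cont].
have cI : {within `[a, c], continuous (fun t => complex.Im (f t))}.
  by move=> x; apply: continuous_comp; [exact: cf|exact: Im_cont].
by rewrite -(Rintegral_cat ab bc cR) -(Rintegral_cat ab bc cI).
Qed.

Lemma cintD (f g : R -> C) a b :
  {within `[a, b], continuous f} -> {within `[a, b], continuous g} ->
  cint (fun t => f t + g t) a b = cint f a b + cint g a b.
Proof.
move=> cf cg; rewrite /cint; apply: Cext => /=.
  rewrite -RintegralD//; [|exact: Re_integrable|exact: Re_integrable].
  by apply: eq_Rintegral => x _; rewrite cReD.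
rewrite -RintegralD//; [|exact: Im_integrable|exact: Im_integrable].
by apply: eq_Rintegral => x _; rewrite cImD.
Qed.

Lemma cintZ (f : R -> C) a b (k : C) :
  {within `[a, b], continuous f} ->
  cint (fun t => k * f t) a b = k * cint f a b.
Proof.
move=> cf; have iR := Re_integrable cf; have iI := Im_integrable cf.
have iZ (r : R) g : mu.-integrable `[a, b] (EFin \o g) ->
    mu.-integrable `[a, b] (EFin \o (fun t => r * g t)).
  by move=> /(integrableZl (itv_meas a b) r).
apply: Cext; rewrite ?cReM ?cImM /cint/=.
  rewrite -(@RintegralZl _ _ _ mu _ _ (complex.Re k) (itv_meas a b) iR).
  rewrite -(@RintegralZl _ _ _ mu _ _ (complex.Im k) (itv_meas a b) iI).
  rewrite -(RintegralB (itv_meas a b) (iZ _ _ iR) (iZ _ _ iI)).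
  by apply: eq_Rintegral => x _; rewrite cReM.
rewrite -(@RintegralZl _ _ _ mu _ _ (complex.Re k) (itv_meas a b) iI).
rewrite -(@RintegralZl _ _ _ mu _ _ (complex.Im k) (itv_meas a b) iR).
rewrite -(RintegralD (itv_meas a b) (iZ _ _ iI) (iZ _ _ iR)).
by apply: eq_Rintegral => x _; rewrite cImM.
Qed.

Lemma cont_mulc (f : R -> C) (A : set R) (k : C) : {within A, continuous f} ->
  {within A, continuous (fun t => k * f t)}.
Proof.
move=> cf x; apply: (continuous_comp (cf x)).
exact: (@hol_cont _ (fun z => k * z) _ (holM (@hol_cst _ _ _) (@hol_id _ _))).
Qed.

Lemma cintB (f g : R -> C) a b :
  {within `[a, b], continuous f} -> {within `[a, b], continuous g} ->
  cint (fun t => f t - g t) a b = cint f a b - cint g a b.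
Proof.
move=> cf cg.
have cg' := cont_mulc (k := -1) cg.
rewrite -mulN1r -(cintZ _ cg) -(cintD cf cg').
by apply: eq_cint => t _; rewrite mulN1r.
Qed.

Lemma cint_cst (k : C) a b : a <= b -> cint (fun=> k) a b = k * (b - a)%:C.
Proof.
move=> ab; rewrite /cint.
have mab : mu `[a, b]%classic = (b - a)%:E.
  by rewrite lebesgue_measure_itv/= lte_fin; case: ltgtP ab => // -> _; rewrite subrr.
have fin : (fine (mu `[a, b]%classic)) = b - a by rewrite mab.
by rewrite !Rintegral_cst//= fin; case: k => x y; simpc.
Qed.

Lemma cont_cabs (f : R -> C) (A : set R) : {within A, continuous f} ->
  {within A, continuous (fun t => cabs (f t))}.
Proof. by move=> cf x; apply: (continuous_comp (cf x)); exact: cabs_cont. Qed.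

(** Rotating the integral onto the positive real axis reduces the inequality to
    the one for real parts. *)
Lemma cint_norm (f : R -> C) a b : {within `[a, b], continuous f} ->
  cabs (cint f a b) <= \int[mu]_(t in `[a, b]) cabs (f t).
Proof.
move=> cf.
have [->|I0] := eqVneq (cint f a b) 0.
  by rewrite cabs0; apply: Rintegral_ge0 => x _; exact: cabs_ge0.
set I := cint f a b in I0 *.
pose u : C := I^* / (cabs I)%:C.
have uI : u * I = (cabs I)%:C.
  rewrite /u mulrAC mulrC.
  have -> : (I^* * I : C) = (cabs I ^+ 2)%:C.
    rewrite cabs_sqr conjE; case: I {I0 u} => x y /=.
    by apply: Cext => /=; ring.
  have h : (cabs I)%:C != 0 :> C by rewrite realC_eq0 cabs_eq0.
  by rewrite rmorphXn/= expr2 mulrA mulVf// mul1r.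
have au : cabs u = 1.
  rewrite /u cabs_div cabs_conj cabs_real ger0_norm ?cabs_ge0// divff//.
  by rewrite cabs_eq0.
have -> : cabs I = complex.Re (u * I) by rewrite uI.
rewrite /I -cintZ//=; apply: le_Rintegral => //.
- by apply: (@Re_integrable (fun t => u * f t)); exact: cont_mulc.
- by apply: cont_integrable; exact: cont_cabs.
move=> x _; apply: (le_trans (ler_norm _)); apply: (le_trans (normr_Re_le _)).
by rewrite cabsM au mul1r.
Qed.

Lemma cint_bound (f : R -> C) a b (M : R) : a <= b ->
  {within `[a, b], continuous f} ->
  (forall t, a <= t <= b -> cabs (f t) <= M) ->
  cabs (cint f a b) <= M * (b - a).
Proof.
move=> ab cf fM; apply: (le_trans (cint_norm cf)).
have mab : mu `[a, b]%classic = (b - a)%:E.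
  by rewrite lebesgue_measure_itv/= lte_fin; case: ltgtP ab => // -> _; rewrite subrr.
have -> : M * (b - a) = \int[mu]_(t in `[a, b]) M.
  by rewrite Rintegral_cst//=; congr (_ * _); rewrite mab.
apply: le_Rintegral => //.
- by apply: cont_integrable; exact: cont_cabs.
- by apply: cont_integrable; apply: continuous_subspaceT => x; exact: cvg_cst.
Qed.

Lemma Rintegral_id (a b : R) : a <= b ->
  \int[mu]_(t in `[a, b]) t = (b ^+ 2 - a ^+ 2) / 2.
Proof.
rewrite le_eqVlt => /predU1P[->|ab].
  by rewrite set_itv1 Rintegral_set1 subrr mul0r.
have d (x : R) : is_derive x 1 (fun x : R => x ^+ 2 / 2) x.
  have -> : (fun x : R => x ^+ 2 / 2) = 2^-1 \*: (@GRing.exp R ^~ 2%N).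
    by apply/funext => y /=; rewrite /GRing.scale/= mulrC.
  by apply: is_derive_eq; rewrite /GRing.scale/=; field.
have dd x : derivable (fun x : R => x ^+ 2 / 2) x 1 by [].
have cc (x : R) : {for x, continuous (fun x : R => x ^+ 2 / 2)}.
  by apply: differentiable_continuous; exact/derivable1_diffP/dd.
rewrite /Rintegral (@continuous_FTC2 _ id (fun x => x ^+ 2 / 2) a b ab)/=.
- by rewrite mulrBl.
- by apply: continuous_subspaceT => x; exact: cvg_id.
- split=> [x _|//|//]; [exact: dd| |].
  + by apply: cvg_at_right_filter; exact: cc.
  + by apply: cvg_at_left_filter; exact: cc.
- by move=> x _; rewrite derive1E derive_val.
Qed.

Lemma realC_cont : continuous (fun t : R => t%:C : C).
Proof. by move=> t; apply: cvg_complex; [exact: cvg_id|exact: cvg_cst]. Qed.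

Lemma cint_affine (p q : C) a b : a <= b ->
  cint (fun t => p + q * t%:C) a b =
  p * (b - a)%:C + q * ((b ^+ 2 - a ^+ 2) / 2)%:C.
Proof.
move=> ab; have cr : {within `[a, b], continuous (fun t : R => t%:C : C)}.
  by apply: continuous_subspaceT; exact: realC_cont.
have cp : {within `[a, b], continuous (fun _ : R => p)}.
  by apply: continuous_subspaceT => x; exact: cvg_cst.
rewrite (cintD cp (cont_mulc (k := q) cr)) (cint_cst p ab) (cintZ q cr).
congr (_ + _ * _).
rewrite /cint/= Rintegral_id//; congr (_ +i* _).
by rewrite Rintegral_cst//= ?mul0r//.
Qed.

End ComplexIntegral.
Arguments cint : simpl never.

(** * Goursat's theorem for rectangles *)

Section Goursat.
Variable R : realType.
Local Notation C := (Cx R).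

Lemma half_pow_lt (K e : R) : 0 < e -> exists N, forall n, (N <= n)%N ->
  K / 2 ^+ n < e.
Proof.
move=> e0; have K1 : 0 < `|K| + 1 by rewrite ltr_wpDl.
pose N := (Num.truncn ((`|K| + 1) / e)).+1.
have hN : (`|K| + 1) / e < N%:R by exact: truncnS_gt.
exists N => n Nn; rewrite ltr_pdivrMr ?exprn_gt0//.
apply: (le_lt_trans (ler_norm K)); apply: (@lt_trans _ _ (`|K| + 1)).
  by rewrite ltrDl.
rewrite mulrC -ltr_pdivrMr//; apply: (lt_le_trans hN).
apply: (@le_trans _ _ n%:R); first by rewrite ler_nat.
by rewrite -natrX ler_nat ltnW// ltn_expl.
Qed.

(** If [P] failed for the rectangle it would fail for one of its quarters, for
    a quarter of that, and so on; these nested cells have a common point, at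
    which [P] is assumed to hold for all small cells. *)
Lemma dyadic_rect_ind (l m : R) (P : nat -> R * R -> Prop) (p0 : R * R) :
  0 <= l -> 0 <= m ->
  (forall n p, (forall s t : bool, P n.+1
     (p.1 + s%:R * (l / 2 ^+ n.+1), p.2 + t%:R * (m / 2 ^+ n.+1))) -> P n p) ->
  (forall x y : R, exists N, forall n p, (N <= n)%N ->
     p.1 <= x <= p.1 + l / 2 ^+ n -> p.2 <= y <= p.2 + m / 2 ^+ n -> P n p) ->
  P 0%N p0.
Proof.
move=> l0 m0 step loc; apply: contrapT => nP0.
have [f hf] : exists f : nat * (R * R) -> bool * bool, forall q, ~ P q.1 q.2 ->
    ~ P q.1.+1 (q.2.1 + (f q).1%:R * (l / 2 ^+ q.1.+1),
                q.2.2 + (f q).2%:R * (m / 2 ^+ q.1.+1)).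
  suff /choice[f hf] : forall q : nat * (R * R), exists st : bool * bool,
      ~ P q.1 q.2 -> ~ P q.1.+1 (q.2.1 + st.1%:R * (l / 2 ^+ q.1.+1),
                                 q.2.2 + st.2%:R * (m / 2 ^+ q.1.+1)).
    by exists f.
  move=> [n p] /=.
  have [Pnp|nPnp] := pselect (P n p); first by exists (true, true).
  apply: contrapT => h; apply: nPnp; apply: step => s t.
  by apply: contrapT => h'; apply: h; exists (s, t).
pose u := fix u n : R * R := if n is k.+1 then
  ((u k).1 + (f (k, u k)).1%:R * (l / 2 ^+ k.+1),
   (u k).2 + (f (k, u k)).2%:R * (m / 2 ^+ k.+1)) else p0.
have nPu n : ~ P n (u n).
  by elim: n => [//|n ih]; exact: (hf (n, u n)).
have nested (v : nat -> R) (k : R) (b : nat -> bool) : 0 <= k ->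
    (forall n, v n.+1 = v n + (b n)%:R * (k / 2 ^+ n.+1)) ->
    exists x, forall n, v n <= x <= v n + k / 2 ^+ n.
  move=> k0 vS.
  have k2 n : 0 <= k / 2 ^+ n by rewrite divr_ge0// exprn_ge0.
  have kS n : k / 2 ^+ n = k / 2 ^+ n.+1 + k / 2 ^+ n.+1.
    by rewrite exprS; field; rewrite expf_neq0.
  have inc n d : v n <= v (n + d)%N.
    elim: d => [|d ih]; first by rewrite addn0.
    by rewrite addnS vS (le_trans ih)// lerDl mulr_ge0.
  have dec n d : v (n + d)%N + k / 2 ^+ (n + d) <= v n + k / 2 ^+ n.
    elim: d => [|d ih]; first by rewrite addn0.
    rewrite addnS vS; apply: le_trans ih.
    rewrite (kS (n + d)%N) -addrA lerD2l lerD2r.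
    by case: (b _); rewrite ?mul1r// mul0r.
  have ub i j : v i <= v j + k / 2 ^+ j.
    have [ij|/ltnW ji] := leqP i j.
      by rewrite (le_trans (inc i (j - i)%N))// subnKC// lerDl.
    by rewrite (le_trans _ (dec j (i - j)%N))// subnKC// lerDl.
  exists (sup (range v)) => n; apply/andP; split.
    apply: ub_le_sup; last by exists n.
    by exists (v 0%N + k / 2 ^+ 0) => _ [i _ <-].
  by apply: ge_sup; [exists (v 0%N); exists 0%N|move=> _ [i _ <-]].
have [x hx] := nested (fun n => (u n).1) l (fun n => (f (n, u n)).1) l0 (fun=> erefl).
have [y hy] := nested (fun n => (u n).2) m (fun n => (f (n, u n)).2) m0 (fun=> erefl).
have [N hN] := loc x y.
exact: (nPu N (hN N (u N) (leqnn N) (hx N) (hy N))).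
Qed.

Definition rect (a b c d : R) : set C :=
  [set z | a <= complex.Re z <= b /\ c <= complex.Im z <= d].

(** The sides are traversed counterclockwise. *)
Definition boundary_int (h : C -> C) (a b c d : R) : C :=
  (cint (fun x => h (x +i* c)) a b - cint (fun x => h (x +i* d)) a b) +
  'i * (cint (fun y => h (b +i* y)) c d - cint (fun y => h (a +i* y)) c d).

Arguments boundary_int : simpl never.

Lemma hline_cont (h : C -> C) (a b y : R) :
  (forall x, a <= x <= b -> {for (x +i* y : C), continuous h}) ->
  {within `[a, b], continuous (fun x => h (x +i* y))}.
Proof.
move=> ch; apply: continuous_in_subspaceT => x; rewrite inE/= in_itv/= => /ch hx.
have hc : {for x, continuous (fun x => x +i* y : C)}.
  by apply: cvg_complex; [exact: cvg_id|exact: cvg_cst].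
exact: (@continuous_comp _ _ _ (fun x => x +i* y : C) h x hc hx).
Qed.

Lemma vline_cont (h : C -> C) (c d x : R) :
  (forall y, c <= y <= d -> {for (x +i* y : C), continuous h}) ->
  {within `[c, d], continuous (fun y => h (x +i* y))}.
Proof.
move=> ch; apply: continuous_in_subspaceT => y; rewrite inE/= in_itv/= => /ch hx.
have hc : {for y, continuous (fun y => x +i* y : C)}.
  by apply: cvg_complex; [exact: cvg_cst|exact: cvg_id].
exact: (@continuous_comp _ _ _ (fun y => x +i* y : C) h y hc hx).
Qed.

Definition rect_cont (h : C -> C) a b c d :=
  forall z, rect a b c d z -> {for z, continuous h}.

Lemma boundary_int_hsplit h a b c d e : rect_cont h a b c d -> a <= e <= b -> c <= d ->
  boundary_int h a b c d = boundary_int h a e c d + boundary_int h e b c d.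
Proof.
move=> ch /andP[ae eb] cd; have ab := le_trans ae eb.
have lin y : c <= y <= d -> {within `[a, b], continuous (fun x => h (x +i* y))}.
  by move=> y0; apply: hline_cont => x x0; apply: ch.
rewrite /boundary_int -(cint_cat ae eb (lin c _)) ?lexx// -(cint_cat ae eb (lin d _)) ?lexx ?andbT//.
ring.
Qed.

Lemma boundary_int_vsplit h a b c d e : rect_cont h a b c d -> a <= b -> c <= e <= d ->
  boundary_int h a b c d = boundary_int h a b c e + boundary_int h a b e d.
Proof.
move=> ch ab /andP[ce ed]; have cd := le_trans ce ed.
have lin x : a <= x <= b -> {within `[c, d], continuous (fun y => h (x +i* y))}.
  by move=> x0; apply: vline_cont => y y0; apply: ch.
rewrite /boundary_int -(cint_cat ce ed (lin a _)) ?lexx// -(cint_cat ce ed (lin b _)) ?lexx ?andbT//.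
ring.
Qed.

Lemma cartesianE (x y : R) : x +i* y = x%:C + 'i * y%:C :> C.
Proof. by apply: Cext => /=; ring. Qed.

Lemma boundary_int_affine (p q : C) a b c d : a <= b -> c <= d ->
  boundary_int (fun z => p + q * z) a b c d = 0.
Proof.
move=> ab cd; rewrite /boundary_int.
have hl y : cint (fun x => p + q * (x +i* y)) a b =
    (p + q * ('i * y%:C)) * (b - a)%:C + q * ((b ^+ 2 - a ^+ 2) / 2)%:C.
  rewrite -cint_affine//; apply: eq_cint => x _; rewrite cartesianE; ring.
have vl x : cint (fun y => p + q * (x +i* y)) c d =
    (p + q * x%:C) * (d - c)%:C + (q * 'i) * ((d ^+ 2 - c ^+ 2) / 2)%:C.
  rewrite -cint_affine//; apply: eq_cint => y _; rewrite cartesianE; ring.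
rewrite !hl !vl !rmorphB; ring.
Qed.

(** Affine functions have boundary integral zero, so only the deviation of [h]
    from an affine function counts. *)
Lemma boundary_int_bound (h : C -> C) (p q : C) (K a b c d : R) :
  rect_cont h a b c d -> a <= b -> c <= d ->
  (forall z, rect a b c d z -> cabs (h z - (p + q * z)) <= K) ->
  cabs (boundary_int h a b c d) <= K * (2 * ((b - a) + (d - c))).
Proof.
move=> ch ab cd hK.
pose g z := h z - (p + q * z).
pose l z := p + q * z.
have cl z : {for z, continuous l}.
  exact: (@hol_cont _ l z (holD (@hol_cst _ _ _) (holM (@hol_cst _ _ _) (@hol_id _ _)))).
have hlin y : c <= y <= d -> {within `[a, b], continuous (fun x => h (x +i* y))}.
  by move=> y0; apply: hline_cont => x x0; apply: ch.
have vlin x : a <= x <= b -> {within `[c, d], continuous (fun y => h (x +i* y))}.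
  by move=> x0; apply: vline_cont => y y0; apply: ch.
have llin y : {within `[a, b], continuous (fun x => l (x +i* y))}.
  by apply: hline_cont => x x0; apply: cl.
have lvin x : {within `[c, d], continuous (fun y => l (x +i* y))}.
  by apply: vline_cont => y y0; apply: cl.
have cg : rect_cont g a b c d.
  by move=> z /ch hz; exact: (cvgB hz (cl z)).
have glin y : c <= y <= d -> {within `[a, b], continuous (fun x => g (x +i* y))}.
  by move=> y0; apply: hline_cont => x x0; apply: cg.
have gvin x : a <= x <= b -> {within `[c, d], continuous (fun y => g (x +i* y))}.
  by move=> x0; apply: vline_cont => y y0; apply: cg.
have eg : boundary_int h a b c d = boundary_int g a b c d.
  rewrite -[LHS]subr0 -(boundary_int_affine p q ab cd) /boundary_int -/l.
  rewrite (cintB (hlin c _) (llin c)) ?lexx// (cintB (hlin d _) (llin d)) ?lexx ?andbT//.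
  rewrite (cintB (vlin a _) (lvin a)) ?lexx// (cintB (vlin b _) (lvin b)) ?lexx ?andbT//.
  rewrite /l; ring.
have cc : c <= c <= d by rewrite lexx.
have dd : c <= d <= d by rewrite lexx andbT.
have aa : a <= a <= b by rewrite lexx.
have bb : a <= b <= b by rewrite lexx andbT.
have i1 : cabs ('i : C) = 1 by rewrite cabsE/= expr0n expr1n/= add0r sqrtr1.
have := cint_bound (M := K) ab (glin c cc) (fun t t0 => hK (t +i* c) (conj t0 cc)).
have := cint_bound (M := K) ab (glin d dd) (fun t t0 => hK (t +i* d) (conj t0 dd)).
have := cint_bound (M := K) cd (gvin a aa) (fun t t0 => hK (a +i* t) (conj aa t0)).
have := cint_bound (M := K) cd (gvin b bb) (fun t t0 => hK (b +i* t) (conj bb t0)).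
rewrite eg /boundary_int => h1 h2 h3 h4.
apply: (le_trans (ler_cabsD _ _)); rewrite cabsM i1 mul1r.
apply: (le_trans (lerD (ler_cabsB _ _) (ler_cabsB _ _))).
apply: (le_trans (lerD (lerD h4 h3) (lerD h1 h2))).
by rewrite le_eqVlt; apply/orP; left; apply/eqP; ring.
Qed.

(** On a small cell around a point a differentiable function is affine up to an
    error that is small compared with the diameter of the cell, so the boundary
    integral is small compared with the square of the semiperimeter. For the
    four quarters of a cell these squares add up to that of the cell, so the
    estimate passes to the whole rectangle. *)
Lemma goursat (h : C -> C) a b c d : a <= b -> c <= d ->
  (forall z, rect a b c d z -> derivable h z 1) -> boundary_int h a b c d = 0.
Proof.
move=> ab cd dh.
have ch : rect_cont h a b c d by move=> z /dh /hol_cont.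
pose l := b - a; pose m := d - c.
have l0 : 0 <= l by rewrite subr_ge0.
have m0 : 0 <= m by rewrite subr_ge0.
suff H (e : R) : 0 < e -> cabs (boundary_int h a b c d) <= e * (2 * (l + m) ^+ 2).
  apply/eqP; rewrite -cabs_eq0 eq_le cabs_ge0 andbT.
  apply/ler_addgt0Pl => e e0; rewrite addr0.
  have K0 : 0 < 2 * (l + m) ^+ 2 + 1 by rewrite ltr_wpDl// mulr_ge0// sqr_ge0.
  apply: (le_trans (H (e / (2 * (l + m) ^+ 2 + 1)) (divr_gt0 e0 K0))).
  by rewrite mulrAC ler_pdivrMr// ler_pM2l// lerDl.
move=> e0.
pose P n (p : R * R) := rect a b c d (p.1 +i* p.2) ->
  rect a b c d ((p.1 + l / 2 ^+ n) +i* (p.2 + m / 2 ^+ n)) ->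
  cabs (boundary_int h p.1 (p.1 + l / 2 ^+ n) p.2 (p.2 + m / 2 ^+ n)) <=
    e * (2 * ((l + m) / 2 ^+ n) ^+ 2).
suff : P 0%N (a, c).
  rewrite /P expr0 !divr1 /= !subrKC; apply.
    by rewrite /rect/= !lexx.
  by rewrite /rect/= !lexx ab cd.
apply: (@dyadic_rect_ind l m P (a, c) l0 m0) => [n p hp|x y].
  rewrite /P /rect/= => -[/andP[ap _] /andP[cp _]] [/andP[_ pb] /andP[_ pd]].
  pose l' := l / 2 ^+ n.+1; pose m' := m / 2 ^+ n.+1.
  have l'0 : 0 <= l' by rewrite divr_ge0// exprn_ge0.
  have m'0 : 0 <= m' by rewrite divr_ge0// exprn_ge0.
  have el : l / 2 ^+ n = l' + l' by rewrite /l' exprS; field; rewrite expf_neq0.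
  have em : m / 2 ^+ n = m' + m' by rewrite /m' exprS; field; rewrite expf_neq0.
  have elm : (l + m) / 2 ^+ n = (l' + l') + (m' + m') by rewrite mulrDl el em.
  have elm' : (l + m) / 2 ^+ n.+1 = l' + m' by rewrite mulrDl.
  have hq s t := hp s t; rewrite /P -/l' -/m' elm' in hq.
  rewrite elm; rewrite el in pb *; rewrite em in pd *.
  move: l' m' l'0 m'0 hq pb pd {hp el em elm elm'} => l' m' l'0 m'0 hq pb pd.
  have inr x y : p.1 <= x <= p.1 + (l' + l') -> p.2 <= y <= p.2 + (m' + m') ->
      rect a b c d (x +i* y).
    move=> /andP[u1 u2] /andP[u3 u4]; split => /=; apply/andP; split.
    - exact: le_trans ap u1.
    - exact: le_trans u2 pb.
    - exact: le_trans cp u3.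
    - exact: le_trans u4 pd.
  have l2 : l' <= l' + l' by rewrite lerDl.
  have m2 : m' <= m' + m' by rewrite lerDl.
  have x0 : p.1 <= p.1 <= p.1 + (l' + l') by rewrite lexx lerDl addr_ge0.
  have x1 : p.1 <= p.1 + l' <= p.1 + (l' + l') by rewrite lerDl l'0 lerD2l.
  have x2 : p.1 <= p.1 + (l' + l') <= p.1 + (l' + l') by rewrite lexx lerDl addr_ge0.
  have y0 : p.2 <= p.2 <= p.2 + (m' + m') by rewrite lexx lerDl addr_ge0.
  have y1 : p.2 <= p.2 + m' <= p.2 + (m' + m') by rewrite lerDl m'0 lerD2l.
  have y2 : p.2 <= p.2 + (m' + m') <= p.2 + (m' + m') by rewrite lexx lerDl addr_ge0.
  have chp : rect_cont h p.1 (p.1 + (l' + l')) p.2 (p.2 + (m' + m')).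
    by move=> [x y] [/= xx yy]; apply: ch; exact: inr.
  have xle : p.1 <= p.1 + (l' + l') by case/andP: x2.
  have yle : p.2 <= p.2 + (m' + m') by case/andP: y2.
  have [x1l x1r] := andP x1; have [y1l y1r] := andP y1.
  have chl : rect_cont h p.1 (p.1 + l') p.2 (p.2 + (m' + m')).
    move=> z [/andP[z1 z2] z3]; apply: chp; split => //.
    by rewrite z1 (le_trans z2 x1r).
  have chr : rect_cont h (p.1 + l') (p.1 + (l' + l')) p.2 (p.2 + (m' + m')).
    move=> z [/andP[z1 z2] z3]; apply: chp; split => //.
    by rewrite z2 (le_trans x1l z1).
  rewrite (boundary_int_hsplit chp x1 yle) (boundary_int_vsplit chl x1l y1) (boundary_int_vsplit chr x1r y1).
  have q00 := hq false false; have q01 := hq false true.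
  have q10 := hq true false; have q11 := hq true true.
  rewrite /= ?mul0r ?mul1r ?addr0 in q00 q01 q10 q11.
  have ex := addrA p.1 l' l'; have ey := addrA p.2 m' m'.
  rewrite -?ex -?ey in q00 q01 q10 q11.
  have k00 := q00 (inr _ _ x0 y0) (inr _ _ x1 y1).
  have k01 := q01 (inr _ _ x0 y1) (inr _ _ x1 y2).
  have k10 := q10 (inr _ _ x1 y0) (inr _ _ x2 y1).
  have k11 := q11 (inr _ _ x1 y1) (inr _ _ x2 y2).
  apply: (le_trans (ler_cabsD _ _)).
  apply: (le_trans (lerD (ler_cabsD _ _) (ler_cabsD _ _))).
  apply: (le_trans (lerD (lerD k00 k01) (lerD k10 k11))).
  rewrite le_eqVlt; apply/orP; left; apply/eqP; ring.
have [xy|nxy] := pselect (rect a b c d (x +i* y)); last first.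
  exists 0%N => n p _ /andP[p1 p2] /andP[p3 p4].
  rewrite /P /rect/= => -[/andP[ap _] /andP[cp _]] [/andP[_ pb] /andP[_ pd]].
  by case: nxy; split => /=; apply/andP; split; lra.
have /derivable_cdiffP[k hk] := dh _ xy.
have [r r0 hr] := hk e e0.
have [N hN] := half_pow_lt (l + m) r0.
exists N => n p Nn /andP[p1 p2] /andP[p3 p4].
rewrite /P /rect/= => -[/andP[ap _] /andP[cp _]] [/andP[_ pb] /andP[_ pd]].
have := hN n Nn; rewrite mulrDl.
set l' := l / 2 ^+ n in p2 pb *; set m' := m / 2 ^+ n in p4 pd * => lmr.
have := @boundary_int_bound h (h (x +i* y) - k * (x +i* y)) k (e * (l' + m'))
  p.1 (p.1 + l') p.2 (p.2 + m').
have -> : p.1 + l' - p.1 = l' by ring.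
have -> : p.2 + m' - p.2 = m' by ring.
have -> : e * (l' + m') * (2 * (l' + m')) = e * (2 * (l' + m') ^+ 2) by ring.
apply; [|lra|lra|].
  move=> z [/andP[z1 z2] /andP[z3 z4]]; apply: ch; split; apply/andP; split; lra.
move=> z [/andP[z1 z2] /andP[z3 z4]].
have -> : h z - (h (x +i* y) - k * (x +i* y) + k * z) =
  h z - h (x +i* y) - k * (z - (x +i* y)) by ring.
have zxy : cabs (z - (x +i* y)) <= l' + m'.
  apply: (le_trans (cabs_le_ReIm _)); rewrite lerD//.
    by rewrite cReD cReN/= ler_norml; apply/andP; split; lra.
  by rewrite cImD cImN/= ler_norml; apply/andP; split; lra.
apply: (le_trans (hr z (le_lt_trans zxy lmr))).
by rewrite ler_pM2l.
Qed.

End Goursat.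
Arguments boundary_int : simpl never.

(** * Riemann sums of periodic functions *)

Section RiemannSums.
Variable R : realType.
Local Notation C := (Cx R).

Lemma heine (g : R -> C) (a b e : R) : continuous g -> 0 < e ->
  exists2 d : R, 0 < d & forall x y : R, a <= x <= b -> `|y - x| < d ->
    cabs (g y - g x) < e.
Proof.
move=> cg e0.
have /compact_near_coveringP := @segment_compact R a b.
move=> /(_ R (0 : R)^'+ (fun d x => forall y, `|y - x| < d -> cabs (g y - g x) < e)).
move=> /(_ _)[].
  move=> x _.
  have e20 : 0 < e / 2 by rewrite divr_gt0.
  have /nbhs_ballP[r/= r0 hr] := (cvg_cabsP (nbhs_filter x) g (g x)).1 (cg x) _ e20.
  have r20 : 0 < r / 2 by rewrite divr_gt0.
  exists (ball x (r / 2), [set d | d < r / 2]) => /=.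
    by split; [exact: nbhsx_ballx|exact: nbhs_right_lt].
  move=> [x' d]/= [xx' dr] y yx'.
  have hx' : cabs (g x' - g x) < e / 2.
    by apply: hr; rewrite /ball/= (lt_trans xx')// ltr_pdivrMr// ltr_pMr// ltr1n.
  have hy : cabs (g y - g x) < e / 2.
    apply: hr; rewrite /ball/= [r]splitr.
    rewrite -(subrK x' x) -addrA (le_lt_trans (ler_normD _ _))// ltrD//.
    by rewrite distrC (lt_trans yx').
  have -> : g y - g x' = (g y - g x) - (g x' - g x) by ring.
  by rewrite (le_lt_trans (ler_cabsB _ _))// [e]splitr ltrD.
move=> d /= d0 hd; exists (d / 2); first by rewrite divr_gt0.
have d20 : 0 < d / 2 by rewrite divr_gt0.
have d2d : `|0 - d / 2| < d.
  by rewrite sub0r normrN gtr0_norm// ltr_pdivrMr// ltr_pMr// ltr1n.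
move=> x y xab yx; have xin : x \in `[a, b] by rewrite in_itv.
exact: (hd (d / 2) d2d d20 x xin y yx).
Qed.

Lemma cont_within (g : R -> C) (a b : R) : continuous g ->
  {within `[a, b], continuous g}.
Proof. exact: continuous_subspaceT. Qed.

Lemma cint_step (g : R -> C) (a d e : R) (k : C) : continuous g -> 0 <= d ->
  (forall t, a <= t <= a + d -> cabs (g t - k) <= e) ->
  cabs (cint g a (a + d) - d%:C * k) <= e * d.
Proof.
move=> cg d0 gk; have ad : a <= a + d by rewrite lerDl.
have ck : continuous (fun _ : R => k) by move=> x; exact: cvg_cst.
have -> : (d%:C * k : C) = cint (fun=> k) a (a + d).
  by rewrite cint_cst// mulrC addrAC subrr add0r.
rewrite -(cintB (@cont_within _ _ _ cg) (@cont_within _ _ _ ck)).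
have cgk : continuous (fun t => g t - k) by move=> t; exact: (cvgB (cg t) (ck t)).
have -> : e * d = e * (a + d - a) by ring.
exact: (cint_bound ad (@cont_within _ a (a + d) cgk) gk).
Qed.

Definition nodes (n : nat) (t : R) (j : nat) : R := t + j%:R * (2 * pi / n%:R).

Definition rsum (g : R -> C) (n : nat) (t : R) : C :=
  \sum_(j < n) g (nodes n t j).

Lemma rsum_shift g n t : (forall s, g (s + 2 * pi) = g s) ->
  rsum g n (t + 2 * pi / n%:R) = rsum g n t.
Proof.
case: n => [|n] pg; first by rewrite /rsum !big_ord0.
rewrite /rsum big_ord_recr big_ord_recl /= addrC; congr (_ + _).
  rewrite /nodes mul0r addr0 -(pg t); congr g.
  by rewrite -[n.+1%:R]natr1; field; rewrite natr1 pnatr_eq0.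
apply: eq_bigr => i _; rewrite /nodes /bump/= add1n; congr g.
by rewrite -[i.+1%:R]natr1; ring.
Qed.

(** Moving the first node by one step only permutes the nodes modulo the period,
    so it may be taken in the first subinterval, where uniform continuity
    applies; this is why [N] does not depend on [t]. *)
Lemma rsum_cvg (g : R -> C) (e : R) : continuous g ->
  (forall s, g (s + 2 * pi) = g s) -> 0 < e ->
  exists N : nat, forall (n : nat) (t : R), (N < n)%N -> 0 <= t ->
    cabs (cint g 0 (2 * pi) - (2 * pi / n%:R)%:C * rsum g n t) <= e.
Proof.
move=> cg pg e0.
have p0 : 0 < 2 * pi :> R by rewrite mulr_gt0// pi_gt0.
have e'0 : 0 < e / (2 * pi) by rewrite divr_gt0.
have [d d0 hd] := @heine g 0 (2 * pi) _ cg e'0.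
pose N := Num.truncn (2 * pi / d).
exists N => n t Nn t0.
have n0 : 0 < n%:R :> R by rewrite ltr0n (leq_trans _ Nn).
pose q : R := 2 * pi / n%:R.
have q0 : 0 < q by rewrite divr_gt0.
have qd : q < d.
  rewrite /q ltr_pdivrMr// [d * _]mulrC -ltr_pdivrMr//.
  by apply: (lt_le_trans (truncnS_gt _)); rewrite ler_nat.
have nq : n%:R * q = 2 * pi by rewrite /q mulrCA divff ?mulr1// gt_eqF.
wlog tq : t t0 / t <= q.
  move=> hw; pose k := Num.truncn (t / q).
  have sk s : rsum g n (s + k%:R * q) = rsum g n s.
    elim: k s => [|k ih] s; first by rewrite mul0r addr0.
    by rewrite -natr1 mulrDl mul1r addrA rsum_shift// ih.
  have tq0 : 0 <= t / q by rewrite divr_ge0// ltW.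
  rewrite -(subrK (k%:R * q) t) sk; apply: hw.
    by rewrite subr_ge0 -ler_pdivlMr// truncn_le.
  rewrite lerBlDr -[X in _ <= X + _]mul1r -mulrDl -ler_pdivrMr// addrC natr1.
  by rewrite ltW// truncnS_gt.
have H k : (k <= n)%N -> cabs (cint g 0 (k%:R * q) -
    q%:C * \sum_(j < k) g (nodes n t j)) <= (e / (2 * pi)) * (k%:R * q).
  elim: k => [_|k ih kn].
    rewrite big_ord0 mulr0 subr0 mul0r mulr0.
    have /cint_bound := lexx (0 : R).
    move=> /(_ g (cabs (g 0)) (@cont_within _ _ _ cg)).
    rewrite subrr mulr0; apply => s; rewrite -eq_le => /eqP <- //.
  rewrite -natr1 mulrDl mul1r big_ord_recr/=.
  have kq0 : 0 <= k%:R * q by rewrite mulr_ge0// ltW.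
  rewrite -(cint_cat kq0 (_ : k%:R * q <= k%:R * q + q) (@cont_within _ _ _ cg)).
    2: by rewrite lerDl ltW.
  set A := cint g 0 _; set B := cint g _ _; set S := \sum_(j < k) _.
  have -> : A + B - q%:C * (S + g (nodes n t k)) =
    (A - q%:C * S) + (B - q%:C * g (nodes n t k)) by ring.
  apply: (le_trans (ler_cabsD _ _)); rewrite mulrDr lerD ?ih 1?ltnW//.
  apply: cint_step => [//||s /andP[s1 s2]]; first exact: ltW.
  rewrite cabsB ltW//; apply: hd.
    rewrite (le_trans kq0)//= (le_trans s2)//.
    by rewrite -nq -[X in _ + X]mul1r -mulrDl natr1 ler_pM2r// ler_nat.
  rewrite /nodes -/q (le_lt_trans _ qd)// ler_norml; apply/andP; split; lra.
have := H n (leqnn n); rewrite nq divfK// gt_eqF//.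
Qed.

End RiemannSums.

(** * The complex exponential *)

Section ComplexExp.
Variable R : realType.
Local Notation C := (Cx R).
Implicit Types z w : C.

Definition cexp z : C := (expR (complex.Re z) * cos (complex.Im z)) +i*
  (expR (complex.Re z) * sin (complex.Im z)).
Arguments cexp : simpl never.

Lemma cexpD z w : cexp (z + w) = cexp z * cexp w.
Proof.
by apply: Cext; rewrite /cexp ?cReM ?cImM/= cReD cImD expRD ?cosD ?sinD; ring.
Qed.

Lemma cexp0 : cexp 0 = 1.
Proof. by apply: Cext; rewrite /cexp/= expR0 ?cos0 ?sin0 ?mulr0 ?mulr1. Qed.

Lemma cabs_cexp z : cabs (cexp z) = expR (complex.Re z).
Proof.
rewrite cabsE /cexp/= !exprMn -mulrDr cos2Dsin2 mulr1 sqrtr_sqr ger0_norm//.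
Qed.

Lemma cexp2pi (x : R) : cexp (x +i* (2 * pi)) = cexp (x +i* 0).
Proof. by rewrite /cexp/= cos0 sin0 mulr_natl cos2pi sin2pi. Qed.

Lemma derive_eps (f : R -> R) (x l : R) : is_derive x 1 f l ->
  forall e, 0 < e -> exists2 d : R, 0 < d & forall h : R, `|h| < d ->
    `|f (x + h) - f x - l * h| <= e * `|h|.
Proof.
move=> [/cvg_ex[/= l' dl] fl] e e0.
have {fl} ll : l' = l by rewrite -fl; apply/esym/cvg_lim.
rewrite ll in dl.
move/cvgrPdist_lt : dl => /(_ _ e0)[d/= d0 hd].
exists d => // h hd'.
have [->|h0] := eqVneq h 0; first by rewrite addr0 subrr mulr0 subrr normr0 mulr0.
have := hd h; rewrite /ball_/= sub0r normrN => /(_ hd' h0).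
rewrite /GRing.scale/= mulr1 distrC => k.
have -> : f (x + h) - f x - l * h = (h^-1 * (f (h + x) - f x) - l) * h.
  by rewrite [h + x]addrC; field.
by rewrite normrM ler_wpM2r// ltW.
Qed.

(** Differentiability at [0] is read off from the derivatives of the real
    exponential, sine and cosine; the functional equation moves it to [z]. *)
Lemma cexp_hol z : derivable cexp z 1.
Proof.
have H0 : cdiff cexp 0 1.
  move=> e e0.
  pose k : R := Num.min 1 (e / 8).
  have k0 : 0 < k by rewrite lt_min ltr01 divr_gt0.
  have k1 : k <= 1 by rewrite ge_min lexx.
  have ke : k <= e / 8 by rewrite ge_min lexx orbT.
  move: k k0 k1 ke => k k0 k1 ke.
  have [d1 d10 h1] := derive_eps (is_derive_expR 0) k0.
  have [d2 d20 h2] := derive_eps (is_derive_sin 0) k0.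
  have [d3 d30 h3] := derive_eps (is_derive_cos 0) k0.
  exists (Num.min k (Num.min d1 (Num.min d2 d3))).
    by rewrite !lt_min k0 d10 d20 d30.
  move=> h; rewrite subr0 !lt_min => /and4P[hk hd1 hd2 hd3].
  set M := cabs h.
  have M0 : 0 <= M := cabs_ge0 h.
  have hx : `|complex.Re h| <= M by exact: normr_Re_le.
  have hy : `|complex.Im h| <= M by exact: normr_Im_le.
  have := h1 _ (le_lt_trans hx hd1); have := h2 _ (le_lt_trans hy hd2).
  have := h3 _ (le_lt_trans hy hd3).
  rewrite !add0r expR0 sin0 cos0 ?oppr0 ?mul0r !mul1r ?subr0 ?addr0 => c3 c2 c1.
  rewrite cexp0.
  apply: (le_trans (cabs_le_ReIm _)).
  rewrite ?mul1r !cReD !cImD !cReN !cImN /= ?oppr0 ?subr0 ?addr0.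
  set x := complex.Re h in hx c1 *; set y := complex.Im h in hy c2 c3 *.
  have k00 := ltW k0.
  have c1' : `|expR x - 1 - x| <= k * M by rewrite (le_trans c1)// ler_wpM2l.
  have c2' : `|sin y - y| <= k * M by rewrite (le_trans c2)// ler_wpM2l.
  have c3' : `|cos y - 1| <= k * M by rewrite (le_trans c3)// ler_wpM2l.
  have cy : `|cos y| <= 1 by exact: cos_max.
  have e1 : `|expR x - 1| <= 2 * k.
    have -> : expR x - 1 = (expR x - 1 - x) + x by ring.
    rewrite (le_trans (ler_normD _ _))// mulr_natl mulr2n lerD//.
      rewrite (le_trans c1')// ler_piMr// ltW// (lt_le_trans hk)//.
    by rewrite (le_trans hx)// ltW.
  have x1 : `|1 + x| <= 2.
    rewrite (le_trans (ler_normD _ _))// normr1 -[2]/(1 + 1) lerD2l.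
    by rewrite (le_trans hx)// ltW// (lt_le_trans hk).
  have sy : `|sin y| <= 2 * M.
    have -> : sin y = (sin y - y) + y by ring.
    rewrite (le_trans (ler_normD _ _))// mulr_natl mulr2n lerD//.
    by rewrite (le_trans c2')// ler_piMl.
  have -> : expR x * cos y - 1 - x = (expR x - 1 - x) * cos y + (1 + x) * (cos y - 1).
    by ring.
  have -> : expR x * sin y - y = (expR x - 1) * sin y + (sin y - y) by ring.
  have t1 : `|(expR x - 1 - x) * cos y + (1 + x) * (cos y - 1)| <= 3 * k * M.
    rewrite (le_trans (ler_normD _ _))// !normrM.
    have -> : 3 * k * M = k * M * 1 + 2 * (k * M) by ring.
    by rewrite lerD// ler_pM.
  have t2 : `|(expR x - 1) * sin y + (sin y - y)| <= 5 * k * M.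
    rewrite (le_trans (ler_normD _ _))// !normrM.
    have -> : 5 * k * M = 2 * k * (2 * M) + k * M by ring.
    by rewrite lerD// ler_pM.
  apply: (le_trans (lerD t1 t2)).
  have -> : 3 * k * M + 5 * k * M = (8 * k) * M by ring.
  by rewrite ler_wpM2r// mulrC -ler_pdivlMr.
apply/derivable_cdiffP; exists (cexp z) => e e0.
have ez0 : 0 < e / expR (complex.Re z) by rewrite divr_gt0// expR_gt0.
have [d d0 hd] := H0 _ ez0.
exists d => // w wz.
have -> : cexp w = cexp z * cexp (w - z) by rewrite -cexpD addrC subrK.
have := hd (w - z); rewrite subr0 cexp0 mul1r => /(_ wz) h.
have -> : cexp z * cexp (w - z) - cexp z - cexp z * (w - z) =
  cexp z * (cexp (w - z) - 1 - (w - z)) by ring.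
rewrite cabsM cabs_cexp mulrC -ler_pdivlMr ?expR_gt0//.
by rewrite (le_trans h)// mulrAC.
Qed.

(** The parametrisation of circles that occurs in the definition of
    subharmonicity. *)
Definition circ (a : C) (r t : R) : C := a + (r%:C : C) * (cos t +i* sin t).

Lemma circE a r t : 0 < r -> circ a r t = a + cexp (ln r +i* t).
Proof.
by move=> r0; congr (_ + _); apply: Cext; rewrite /cexp/= lnK//; ring.
Qed.

Lemma cabs_circ a r t : 0 <= r -> cabs (circ a r t - a) = r.
Proof.
move=> r0; rewrite addrC addKr cabsM cabs_real ger0_norm//.
by rewrite cabsE/= cos2Dsin2 sqrtr1 mulr1.
Qed.

Lemma circ_cont a r : continuous (circ a r).
Proof.
move=> t; apply: (@cvgD _ _ _ _ _ _ _ a); first exact: cvg_cst.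
apply: (@continuous_comp _ _ _ (fun t => cos t +i* sin t : C) (fun z => (r%:C : C) * z)).
  by apply: cvg_complex; [exact: continuous_cos|exact: continuous_sin].
exact: (@hol_cont _ (fun z => (r%:C : C) * z) _ (holM (@hol_cst _ _ _) (@hol_id _ _))).
Qed.

Lemma circ_periodic a r t : circ a r (t + 2 * pi) = circ a r t.
Proof. by rewrite /circ mulr_natl cosD2pi sinD2pi. Qed.

End ComplexExp.
Arguments cexp : simpl never.
Arguments circ : simpl never.

(** * Mean values, Cauchy's estimate and the maximum principle *)

Section MeanValue.
Variable R : realType.
Local Notation C := (Cx R).
Implicit Types (z w a : C).

Lemma circ_comp_cont (f : C -> C) a (r : R) : 0 <= r ->
  (forall z, cabs (z - a) = r -> {for z, continuous f}) ->
  continuous (fun t => f (circ a r t)).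
Proof.
move=> r0 cf t; have h := cf _ (cabs_circ a t r0).
exact: (@continuous_comp _ _ _ (circ a r) f t (@circ_cont R a r t) h).
Qed.

(** With [w = log (z - a)] the circles centred at [a] become vertical segments
    and [f (a + exp w)] has period [2 pi i], so the horizontal sides of the
    boundary integral cancel in Goursat's theorem. *)
Lemma circle_integral_radius (f : C -> C) a (r s : R) : 0 < s -> s <= r ->
  (forall z, s <= cabs (z - a) <= r -> derivable f z 1) ->
  cint (fun t => f (circ a s t)) 0 (2 * pi) =
  cint (fun t => f (circ a r t)) 0 (2 * pi).
Proof.
move=> s0 sr df; have r0 := lt_le_trans s0 sr.
pose h w := f (a + cexp w).
have lsr : ln s <= ln r by rewrite ler_ln.
have p0 : 0 <= 2 * pi :> R by rewrite mulr_ge0// pi_ge0.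
have := @goursat R h (ln s) (ln r) 0 (2 * pi) lsr p0.
have H z : rect (ln s) (ln r) 0 (2 * pi) z -> derivable h z 1.
  move=> [/andP[z1 z2] _].
  apply: (@hol_comp R f (fun w => a + cexp w) z).
    exact: (holD (@hol_cst _ _ _) (@cexp_hol _ _)).
  apply: df; rewrite addrC addKr cabs_cexp.
  apply/andP; split; first by rewrite -[leLHS](lnK s0) ler_expR.
  by rewrite -[leRHS](lnK r0) ler_expR.
move=> /(_ H); rewrite /boundary_int.
have -> : cint (fun x => h (x +i* 0)) (ln s) (ln r) =
          cint (fun x => h (x +i* (2 * pi))) (ln s) (ln r).
  by apply: eq_cint => t _; rewrite /h cexp2pi.
rewrite subrr add0r => /eqP; rewrite mulf_eq0 => /orP[/eqP/(congr1 (fun z : C => complex.Im z))/= /eqP|].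
  by rewrite oner_eq0.
rewrite subr_eq0 => /eqP e.
have eqc q (q0 : 0 < q) : cint (fun t => f (circ a q t)) 0 (2 * pi) =
    cint (fun t => h (ln q +i* t)) 0 (2 * pi).
  by apply: eq_cint => t _; rewrite /h -circE.
exact: (etrans (eqc s s0) (etrans (esym e) (esym (eqc r r0)))).
Qed.

(** The circular means do not depend on the radius and tend to [f (a)] as it
    shrinks. Continuity at the centre suffices there, so that the statement
    applies to difference quotients. *)
Lemma mean_value (f : C -> C) a (r : R) : 0 < r ->
  (forall z, 0 < cabs (z - a) <= r -> derivable f z 1) ->
  {for a, continuous f} ->
  cint (fun t => f (circ a r t)) 0 (2 * pi) = f a * (2 * pi)%:C.
Proof.
move=> r0 df cf.
have p0 : 0 < 2 * pi :> R by rewrite mulr_gt0// pi_gt0.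
apply/eqP; rewrite -subr_eq0 -cabs_eq0 eq_le cabs_ge0 andbT.
apply/ler_addgt0Pl => e e0; rewrite addr0.
have e'0 : 0 < e / (2 * pi) by rewrite divr_gt0.
have [d d0 hd] := (cont_cabsP _ _).1 cf _ e'0.
pose s : R := Num.min (d / 2) r.
have s0 : 0 < s by rewrite lt_min r0 divr_gt0.
have sr : s <= r by rewrite ge_min lexx orbT.
have sd : s < d.
  by rewrite gt_min ltr_pdivrMr// ltr_pMr// ltr1n.
rewrite -(circle_integral_radius s0 sr); last first.
  by move=> z /andP[z1 z2]; apply: df; rewrite z2 (lt_le_trans s0).
have cfs : continuous (fun t => f (circ a s t)).
  apply: circ_comp_cont; first exact: ltW.
  by move=> z zs; apply: hol_cont; apply: df; rewrite zs s0.
have ck : continuous (fun _ : R => f a) by move=> x; exact: cvg_cst.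
have -> : f a * (2 * pi)%:C = cint (fun=> f a) 0 (2 * pi).
  by rewrite cint_cst ?subr0// ltW.
rewrite -(cintB (@cont_within _ _ _ _ cfs) (@cont_within _ _ _ _ ck)).
have cfk : continuous (fun t => f (circ a s t) - f a).
  by move=> t; exact: (cvgB (cfs t) (ck t)).
have -> : e = e / (2 * pi) * (2 * pi - 0) by rewrite subr0 divfK// gt_eqF.
apply: (cint_bound (ltW p0) (@cont_within _ _ _ _ cfk)) => t _.
by apply/ltW/hd; rewrite cabs_circ// ltW.
Qed.

Lemma mean_value_bound (f : C -> C) a (r M : R) : 0 < r ->
  (forall z, 0 < cabs (z - a) <= r -> derivable f z 1) ->
  {for a, continuous f} ->
  (forall t, 0 <= t <= 2 * pi -> cabs (f (circ a r t)) <= M) -> cabs (f a) <= M.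
Proof.
move=> r0 df cf fM.
have p0 : 0 < 2 * pi :> R by rewrite mulr_gt0// pi_gt0.
have cfr : continuous (fun t => f (circ a r t)).
  apply: circ_comp_cont; first exact: ltW.
  by move=> z zs; apply: hol_cont; apply: df; rewrite zs r0 lexx.
have := cint_bound (ltW p0) (@cont_within _ _ _ _ cfr) fM.
rewrite mean_value// cabsM cabs_real gtr0_norm// subr0.
by rewrite ler_pM2r.
Qed.

(** The difference quotient of [f] at [a] is continuous at [a] with value the
    derivative, so the mean value inequality applies to it. *)
Lemma cauchy_estimate (f : C -> C) a c (r M : R) : 0 < r ->
  (forall z, cabs (z - a) <= r -> derivable f z 1) -> cdiff f a c ->
  (forall z, cabs (z - a) <= r -> cabs (f z) <= M) -> cabs c <= 2 * M / r.
Proof.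
move=> r0 df fc fM.
pose g z := if z == a then c else (f z - f a) / (z - a).
have -> : c = g a by rewrite /g eqxx.
apply: (mean_value_bound r0).
- move=> z /andP[za zr].
  have za' : z - a != 0 by rewrite -cabs_gt0.
  apply: (@hol_near _ (fun z => (f z - f a) / (z - a))).
    apply/nbhs_cabsP; exists (cabs (z - a)) => // w wz.
    rewrite /g ifN//; apply: contraTN wz => /eqP ->.
    by rewrite cabsB ltxx.
  exact: (@hol_div _ (fun z => f z - f a) (fun z => z - a) z
    (holB (df z zr) (@hol_cst _ _ _)) (holB (@hol_id _ _) (@hol_cst _ _ _)) za').
- apply/cont_cabsP => e e0.
  have e20 : 0 < e / 2 by rewrite divr_gt0.
  have [d d0 hd] := fc _ e20; exists d => // w wa.
  rewrite /g eqxx; case: eqVneq => [_|wa0]; first by rewrite subrr cabs0.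
  have wa1 : w - a != 0 by rewrite subr_eq0.
  have -> : (f w - f a) / (w - a) - c = (f w - f a - c * (w - a)) / (w - a) by field.
  rewrite cabs_div ltr_pdivrMr ?cabs_gt0//.
  apply: (le_lt_trans (hd w wa)); rewrite ltr_pM2r ?cabs_gt0//.
  by rewrite ltr_pdivrMr// ltr_pMr// ltr1n.
- move=> t _; have cr := cabs_circ a t (ltW r0).
  rewrite /g ifN; last by rewrite -subr_eq0 -cabs_eq0 cr gt_eqF.
  rewrite cabs_div cr ler_pM2r ?invr_gt0//.
  rewrite (le_trans (ler_cabsB _ _))// mulr_natl mulr2n lerD//; apply: fM.
    by rewrite cr.
  by rewrite subrr cabs0 ltW.
Qed.

(** If [|g|] exceeded [B] then, for small [eta], the function
    [|g(z)| exp (eta |z|^2)] would have a maximum at a point [z1] of [O]. The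
    modulus of the holomorphic function [g(z) exp (2 eta conj z1 (z - z1))]
    would then have a strict local maximum at [z1], which contradicts the mean
    value inequality. *)
Lemma max_principle (Om O : set C) (g : C -> C) (B : R) :
  closed Om -> (forall z, O z -> nbhs z Om) ->
  (forall z, Om z -> derivable g z 1) ->
  0 <= B ->
  (forall z, Om z -> ~ O z -> cabs (g z) <= B) ->
  (forall e : R, 0 < e -> exists r : R, forall z, Om z -> r <= cabs z ->
     cabs (g z) <= B + e) ->
  forall z, Om z -> cabs (g z) <= B.
Proof.
move=> cOm OOm dg B0 bdry decay z0 Om0; rewrite leNgt; apply/negP => gB.
pose G := cabs (g z0).
pose e := (G - B) / 2.
have e0 : 0 < e by rewrite divr_gt0// subr_gt0.
have [r1 hr1] := decay e e0.
pose r := Num.max r1 (cabs z0 + 1).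
have r1r : r1 <= r by rewrite le_max lexx.
have z0r : cabs z0 < r by rewrite lt_max ltrDl ltr01 orbT.
have r0 : 0 < r by rewrite (le_lt_trans _ z0r)// cabs_ge0.
pose Be := B + e.
have Be0 : 0 < Be by rewrite ltr_wpDl.
have GBe : Be < G by rewrite /Be /e /G; move: gB; rewrite -/G; lra.
have G0 : 0 < G by rewrite (lt_trans Be0).
pose q := ln (G / Be).
have q0 : 0 < q by rewrite ln_gt0// ltr_pdivlMr// mul1r.
pose eta := q / 2 / r ^+ 2.
have eta0 : 0 < eta by rewrite !divr_gt0// exprn_gt0.
have small (z : C) : cabs z <= r -> Be * expR (eta * cabs z ^+ 2) < G.
  move=> zr; rewrite mulrC -ltr_pdivlMr//.
  rewrite -[ltRHS]lnK ?posrE ?divr_gt0// ltr_expR -/q.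
  apply: (@le_lt_trans _ _ (q / 2)); last by rewrite ltr_pdivrMr// ltr_pMr// ltr1n.
  rewrite /eta mulrAC ler_pdivrMr ?exprn_gt0// ler_pM2l ?divr_gt0//.
  by rewrite ler_sqr ?nnegrE ?cabs_ge0// ltW.
pose K := Om `&` [set z | cabs (z - 0) <= r].
have cK : compact K.
  apply: (@compact_cabs _ _ r); first by apply: closedI => //; exact: closed_cabs_le.
  by move=> z [_ /=]; rewrite subr0.
pose phi z := cabs (g z) * expR (eta * cabs z ^+ 2).
have cphi : {within K, continuous phi}.
  apply: continuous_in_subspaceT => z; rewrite inE => -[Omz _].
  have c1 : {for z, continuous (fun w => cabs (g w))}.
    by apply: continuous_comp; [exact: (hol_cont (dg _ Omz))|exact: cabs_cont].
  have c2 : {for z, continuous (fun w : C => eta * cabs w ^+ 2)}.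
    apply: (@continuous_comp _ _ _ (@cabs R) (fun x : R => eta * x ^+ 2)).
      exact: cabs_cont.
    by apply: cvgM; [exact: cvg_cst|exact: exprn_continuous].
  have c3 : {for z, continuous (fun w : C => expR (eta * cabs w ^+ 2))}.
    by apply: continuous_comp; [exact: c2|exact: continuous_expR].
  exact: (cvgM c1 c3).
have K0 : K z0 by split => //=; rewrite subr0 ltW.
have [z1] := compact_EVT_max (ex_intro _ z0 K0) cK cphi.
rewrite inE => -[Om1 /=]; rewrite subr0 => z1r max1.
have Gphi : G <= phi z1.
  have := max1 z0; rewrite inE => /(_ K0); apply: le_trans.
  by rewrite /phi -/G ler_peMr ?(ltW G0)// -[leLHS]expR0 ler_expR mulr_ge0 ?(ltW eta0)// sqr_ge0.
have nBe : Be < cabs (g z1).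
  rewrite ltNge; apply/negP => h; have := small z1 z1r; apply/negP; rewrite -leNgt.
  by apply: (le_trans Gphi); rewrite ler_wpM2r// expR_ge0.
have O1 : O z1.
  apply: contrapT => nO; have := bdry z1 Om1 nO; apply/negP; rewrite -ltNge.
  by rewrite (le_lt_trans _ nBe)// lerDl ltW.
have z1r' : cabs z1 < r.
  rewrite lt_neqAle z1r andbT; apply/eqP => z1e.
  have := hr1 z1 Om1; rewrite z1e => /(_ r1r); apply/negP.
  by rewrite -ltNge.
have /nbhs_cabsP[d d0 hd] := OOm z1 O1.
pose s := Num.min (d / 2) ((r - cabs z1) / 2).
have s0 : 0 < s by rewrite lt_min !divr_gt0// subr_gt0.
have sd : s < d by rewrite gt_min ltr_pdivrMr// ltr_pMr// ltr1n.
have sr : cabs z1 + s <= r.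
  rewrite addrC -lerBrDr ge_min; apply/orP; right.
  by rewrite ler_pdivrMr// ler_peMr ?ler1n// subr_ge0.
pose u w := cexp ((2 * eta)%:C * z1^* * (w - z1)).
pose v w := g w * u w.
have du z : derivable u z 1.
  apply: (@hol_comp _ (@cexp R) (fun w => (2 * eta)%:C * z1^* * (w - z1))); last exact: cexp_hol.
  exact: (holM (@hol_cst _ _ _) (holB (@hol_id _ _) (@hol_cst _ _ _))).
have dv z : cabs (z - z1) <= s -> derivable v z 1.
  move=> zs; apply: holM; last exact: du.
  by apply: dg; apply: hd; rewrite (le_lt_trans zs).
have v1 : v z1 = g z1 by rewrite /v /u subrr mulr0 cexp0 mulr1.
have g10 : 0 < cabs (g z1) by rewrite (lt_trans Be0).
have : cabs (v z1) <= cabs (g z1) * expR (- (eta * s ^+ 2)).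
  apply: (mean_value_bound s0).
  - by move=> z /andP[_ /dv].
  - by apply: hol_cont; apply: dv; rewrite subrr cabs0 ltW.
  move=> t _; set w := circ z1 s t.
  have ws : cabs (w - z1) = s by rewrite cabs_circ// ltW.
  have Kw : K w.
    split; first by apply: hd; rewrite ws.
    rewrite /= subr0 -(subrK z1 w) (le_trans (ler_cabsD _ _))// ws addrC//.
  have := max1 w; rewrite inE => /(_ Kw); rewrite /phi => h.
  rewrite /v cabsM /u cabs_cexp.
  have -> : complex.Re ((2 * eta)%:C * z1^* * (w - z1)) =
      eta * cabs w ^+ 2 - eta * cabs z1 ^+ 2 - eta * s ^+ 2.
    rewrite -ws !cabs_sqr conjE; case: (w) => wx wy; case: (z1) => zx zy.
    by rewrite !cReM !cImM/=; ring.
  rewrite !expRD mulrA ler_pM2r ?expR_gt0// mulrA.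
  by rewrite [X in _ * X]expRN ler_pdivrMr ?expR_gt0.
rewrite v1; apply/negP; rewrite -ltNge -[ltRHS]mulr1 ltr_pM2l//.
by rewrite -[ltRHS]expR0 ltr_expR oppr_lt0 mulr_gt0// exprn_gt0.
Qed.

Lemma max_principle_disc (f : C -> C) a (r B : R) : 0 < r ->
  (forall z, cabs (z - a) <= r -> derivable f z 1) ->
  (forall z, cabs (z - a) = r -> cabs (f z) <= B) ->
  forall z, cabs (z - a) <= r -> cabs (f z) <= B.
Proof.
move=> r0 df fB.
have B0 : 0 <= B.
  apply: (le_trans (cabs_ge0 (f (circ a r 0)))); apply: fB.
  by rewrite cabs_circ// ltW.
apply: (@max_principle [set z | cabs (z - a) <= r] [set z | cabs (z - a) < r]) => //.
- exact: closed_cabs_le.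
- move=> z /= zr; apply/nbhs_cabsP; exists (r - cabs (z - a)); first by rewrite subr_gt0.
  move=> w wz /=; have -> : w - a = (w - z) + (z - a) by ring.
  by rewrite (le_trans (ler_cabsD _ _))// -lerBrDr ltW.
- move=> z /= zr /negP; rewrite -leNgt => rz; apply: fB.
  by apply/eqP; rewrite eq_le zr.
move=> e e0; exists (r + cabs a + 1) => z /= zr; rewrite leNgt => /negP[].
rewrite -(subrK a z) (le_lt_trans (ler_cabsD _ _))//.
by rewrite (le_lt_trans (lerD zr (lexx _)))// ltrDl.
Qed.

End MeanValue.

(** * Hardy space functions away from the real line *)

Section HardyBound.
Variable R : realType.
Local Notation C := (Cx R).
Local Notation mu := (@lebesgue_measure R).

(** A form of the mean value property that only involves finite sums, and can
    therefore be used in a vector space. *)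
Lemma node_average (f : C -> C) (a : C) (r e : R) : 0 < r ->
  (forall z, cabs (z - a) <= r -> derivable f z 1) -> 0 < e ->
  exists N : nat, forall n, (N < n)%N ->
    cabs (f a - (n%:R)^-1 * rsum (fun t => f (circ a r t)) n 0) <= e.
Proof.
move=> r0 df e0.
have p0 : 0 < 2 * pi :> R by rewrite mulr_gt0// pi_gt0.
have cfr : continuous (fun t => f (circ a r t)).
  apply: circ_comp_cont; first exact: ltW.
  by move=> z zs; apply: hol_cont; apply: df; rewrite zs.
have pfr s : f (circ a r (s + 2 * pi)) = f (circ a r s) by rewrite circ_periodic.
have [N hN] := rsum_cvg cfr pfr (mulr_gt0 e0 p0).
exists N => n Nn; have := hN n 0 Nn (lexx 0).
rewrite mean_value//; last 2 first.
- by move=> z /andP[_ /df].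
- by apply: hol_cont; apply: df; rewrite subrr cabs0 ltW.
have n0 : (n%:R : C) != 0 by rewrite pnatr_eq0 -lt0n (leq_trans _ Nn).
have -> : (2 * pi / n%:R)%:C = (2 * pi)%:C * (n%:R)^-1 :> C.
  by rewrite rmorphM/= fmorphV/= rmorph_nat.
set S := rsum _ _ _.
have -> : f a * (2 * pi)%:C - (2 * pi)%:C * n%:R^-1 * S =
  (f a - n%:R^-1 * S) * (2 * pi)%:C by ring.
by rewrite cabsM cabs_real gtr0_norm// ler_pM2r.
Qed.

Section Primitive.
Variables (phi : C -> C) (X0 Y0 : R).
Hypothesis Y0_gt0 : 0 < Y0.
Hypothesis dphi : forall z, UHP z -> derivable phi z 1.

(** A primitive of [phi]: the integral along the path from [X0 + i Y0] that is
    first vertical and then horizontal. *)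
Definition prim (x y : R) : C :=
  cint (fun t => phi (t +i* y)) X0 x + 'i * cint (fun s => phi (X0 +i* s)) Y0 y.

Let hc (a b y : R) : Y0 <= y -> {within `[a, b], continuous (fun t => phi (t +i* y))}.
Proof.
move=> Yy; apply: hline_cont => x _; apply: hol_cont; apply: dphi.
exact: lt_le_trans Yy.
Qed.

Let vc (a b x : R) : Y0 <= a -> {within `[a, b], continuous (fun t => phi (x +i* t))}.
Proof.
move=> Ya; apply: vline_cont => y /andP[ay _]; apply: hol_cont; apply: dphi.
by apply: (lt_le_trans Y0_gt0); exact: le_trans Ya ay.
Qed.

Lemma prim_h x x' y : X0 <= x -> x <= x' -> Y0 <= y ->
  prim x' y - prim x y = cint (fun t => phi (t +i* y)) x x'.
Proof.
move=> Xx xx' Yy; rewrite /prim -(cint_cat Xx xx' (@hc _ _ _ Yy)); ring.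
Qed.

(** By Goursat's theorem the path may as well run horizontally first. *)
Lemma prim_v x y y' : X0 <= x -> Y0 <= y -> y <= y' ->
  prim x y' - prim x y = 'i * cint (fun t => phi (x +i* t)) y y'.
Proof.
move=> Xx Yy yy'; rewrite /prim -(cint_cat Yy yy' (@vc _ _ _ (lexx Y0))).
have := @goursat R phi X0 x y y' Xx yy'.
have H z : rect X0 x y y' z -> derivable phi z 1.
  move=> [_ /andP[yz _]]; apply: dphi.
  by apply: (lt_le_trans Y0_gt0); exact: le_trans Yy yz.
move=> /(_ H); rewrite /boundary_int; set A := cint _ _ _; set B := cint _ _ _.
set V := cint (fun y => phi (x +i* y)) _ _; set W := cint _ y y' => h.
have -> : 'i * V = (A - B + 'i * (V - W)) - A + B + 'i * W by ring.
rewrite h; ring.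
Qed.

Lemma prim_cdiff z : X0 < complex.Re z -> Y0 < complex.Im z ->
  cdiff (fun w => prim (complex.Re w) (complex.Im w)) z (phi z).
Proof.
case: z => x y; set z : C := x +i* y => /= zX zY e e0.
have Uz : UHP z by exact: lt_trans zY.
have e20 : 0 < e / 2 by rewrite divr_gt0.
have [d1 d10 hd1] := (cont_cabsP _ _).1 (hol_cont (dphi Uz)) _ e20.
pose d := Num.min (d1 / 2) (Num.min (x - X0) (y - Y0)).
have d0 : 0 < d by rewrite !lt_min !subr_gt0 zX zY divr_gt0.
exists d => // -[x' y'] wz.
have hx : `|x' - x| < d by rewrite (le_lt_trans _ wz)// (le_trans _ (normr_Re_le _)).
have hy : `|y' - y| < d by rewrite (le_lt_trans _ wz)// (le_trans _ (normr_Im_le _)).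
have [dd [dX dY]] : d <= d1 / 2 /\ d <= x - X0 /\ d <= y - Y0.
  by rewrite /d !ge_min !lexx !orbT.
have near u v : `|u - x| < d -> `|v - y| < d -> cabs (phi (u +i* v) - phi (x +i* y)) <= e / 2.
  move=> ux vy; apply/ltW/hd1; apply: (le_lt_trans (cabs_le_ReIm _)).
  rewrite cReD cReN cImD cImN /= [d1]splitr.
  by apply: (lt_le_trans (ltrD ux vy)); rewrite lerD.
set k := phi (x +i* y).
have hstep u v w : `|u - x| < d -> `|v - x| < d -> `|w - y| < d ->
    cabs (prim v w - prim u w - k * (v - u)%:C) <= e / 2 * `|v - u|.
  wlog uv : u v / u <= v.
    move=> hw ux vx wy; have [uv|/ltW vu] := leP u v; first exact: hw.
    rewrite -cabsN distrC.
    have -> : - (prim v w - prim u w - k * (v - u)%:C) = prim u w - prim v w - k * (u - v)%:C.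
      by rewrite !rmorphB/=; ring.
    exact: hw.
  move=> ux vx wy.
  have Xu : X0 <= u by move: ux; rewrite ltr_norml; lra.
  have Yw : Y0 <= w by move: wy; rewrite ltr_norml; lra.
  have ck : {within `[u, v], continuous (fun _ : R => k)}.
    by apply: continuous_subspaceT => t; exact: cvg_cst.
  rewrite prim_h// -cint_cst// -(cintB (@hc _ _ _ Yw) ck) (ger0_norm (_ : 0 <= v - u)) ?subr_ge0//.
  have cfk : {within `[u, v], continuous (fun t => phi (t +i* w) - k)}.
    by move=> t; exact: (cvgB (@hc u v w Yw t) (ck t)).
  apply: (cint_bound uv cfk) => t /andP[ut tv]; apply: near => //.
  by move: ux vx; rewrite !ltr_norml; lra.
have vstep u v w : `|u - y| < d -> `|v - y| < d -> `|w - x| < d ->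
    cabs (prim w v - prim w u - k * ('i * (v - u)%:C)) <= e / 2 * `|v - u|.
  wlog uv : u v / u <= v.
    move=> hw ux vx wy; have [uv|/ltW vu] := leP u v; first exact: hw.
    rewrite -cabsN distrC.
    have -> : - (prim w v - prim w u - k * ('i * (v - u)%:C)) =
        prim w u - prim w v - k * ('i * (u - v)%:C).
      by rewrite !rmorphB/=; ring.
    exact: hw.
  move=> uy vy wx.
  have Xw : X0 <= w by move: wx; rewrite ltr_norml; lra.
  have Yu : Y0 <= u by move: uy; rewrite ltr_norml; lra.
  have ck : {within `[u, v], continuous (fun _ : R => k)}.
    by apply: continuous_subspaceT => t; exact: cvg_cst.
  rewrite prim_v// mulrCA -cint_cst// -mulrBr -(cintB (@vc _ _ _ Yu) ck).
  rewrite cabsM (_ : cabs ('i : C) = 1) ?mul1r; last first.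
    by rewrite cabsE/= expr0n expr1n/= add0r sqrtr1.
  rewrite (ger0_norm (_ : 0 <= v - u)) ?subr_ge0//.
  have cfk : {within `[u, v], continuous (fun t => phi (w +i* t) - k)}.
    by move=> t; exact: (cvgB (@vc u v w Yu t) (ck t)).
  apply: (cint_bound uv cfk) => t /andP[ut tv]; apply: near => //.
  by move: uy vy; rewrite !ltr_norml; lra.
have x0 : `|x - x| < d by rewrite subrr normr0.
have y0 : `|y - y| < d by rewrite subrr normr0.
have s1 := hstep x x' y' x0 hx hy.
have s2 := vstep y y' x y0 hy x0.
rewrite /=.
have -> : (x' +i* y' - (x +i* y) : C) = (x' - x)%:C + 'i * (y' - y)%:C.
  by apply: Cext => /=; ring.
have -> : prim x' y' - prim x y - k * ((x' - x)%:C + 'i * (y' - y)%:C) =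
  (prim x' y' - prim x y' - k * (x' - x)%:C) +
  (prim x y' - prim x y - k * ('i * (y' - y)%:C)) by ring.
apply: (le_trans (ler_cabsD _ _)); apply: (le_trans (lerD s1 s2)).
rewrite -mulrDr mulrAC ler_pdivrMr// -mulrA ler_pM2l// mulrC mulr_natl mulr2n lerD//.
  apply: (le_trans _ (normr_Re_le _)).
  by rewrite cReD cReM/= mul0r !mulr0 !subr0 addr0.
apply: (le_trans _ (normr_Im_le _)).
by rewrite cImD cImM/= mul0r mul1r !add0r.
Qed.

End Primitive.

(** The horizontal differences of [phi] are the derivatives of the horizontal
    differences of a primitive; the latter are integrals of [phi] over
    horizontal segments, so Cauchy's estimate applies on discs of radius
    [1 / 2]. *)
Lemma horizontal_oscillation (phi : C -> C) (M : R) :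
  (forall z, UHP z -> derivable phi z 1) ->
  (forall a b y, a <= b -> 0 < y -> cabs (cint (fun t => phi (t +i* y)) a b) <= M) ->
  forall (z : C) (s : R), 1 <= complex.Im z -> 0 <= s ->
    cabs (phi (z + s%:C) - phi z) <= 4 * M.
Proof.
move=> dphi phiM z s z1 s0.
pose X0 := complex.Re z - 1.
pose G w := prim phi X0 (1/4) (complex.Re w) (complex.Im w).
pose A w := G (w + s%:C) - G w.
have q0 : 0 < 1/4 :> R by lra.
have AE w : cabs (w - z) <= 1/2 -> [/\ X0 < complex.Re w & 1/4 < complex.Im w].
  move=> wz; have := le_trans (normr_Re_le _) wz; have := le_trans (normr_Im_le _) wz.
  rewrite cReD cReN cImD cImN /X0 !ler_norml => /andP[? ?] /andP[? ?]; split; lra.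
have cA w : cabs (w - z) <= 1/2 -> cdiff A w (phi (w + s%:C) - phi w).
  move=> wz e e0; have [wX wY] := AE w wz.
  have e20 : 0 < e / 2 by rewrite divr_gt0.
  have [d1 d10 h1] := @prim_cdiff phi X0 (1/4) q0 dphi w wX wY _ e20.
  have wX' : X0 < complex.Re (w + s%:C) by rewrite cReD/= ltr_wpDr.
  have wY' : 1/4 < complex.Im (w + s%:C) by rewrite cImD/= addr0.
  have [d2 d20 h2] := @prim_cdiff phi X0 (1/4) q0 dphi (w + s%:C) wX' wY' _ e20.
  exists (Num.min d1 d2); first by rewrite lt_min d10.
  move=> v; rewrite lt_min => /andP[v1 v2].
  have E : v + s%:C - (w + s%:C) = v - w by ring.
  have := h2 (v + s%:C); rewrite E => /(_ v2) k2; have k1 := h1 v v1.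
  have -> : A v - A w - (phi (w + s%:C) - phi w) * (v - w) =
     (G (v + s%:C) - G (w + s%:C) - phi (w + s%:C) * (v - w)) -
     (G v - G w - phi w * (v - w)) by rewrite /A; ring.
  apply: (le_trans (ler_cabsB _ _)); apply: (le_trans (lerD k2 k1)).
  by rewrite -mulrDl -splitr.
have -> : 4 * M = 2 * M / (1 / 2) by field.
have r0 : 0 < 1/2 :> R by lra.
apply: (cauchy_estimate r0 _ (cA z _)).
- by move=> w wz; apply/derivable_cdiffP; exists (phi (w + s%:C) - phi w); exact: cA.
- by rewrite subrr cabs0 ltW.
move=> w wz; have [wX wY] := AE w wz.
rewrite /A /G cReD cImD/= addr0 (prim_h q0 dphi (ltW wX) _ (ltW wY)) ?lerDl//.
by apply: phiM; [rewrite lerDl|exact: lt_trans wY].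
Qed.

(** The square of [f] is integrable over horizontal lines with a common bound,
    so it has bounded oscillation along them, and on every unit segment it is
    at most [M + 1] somewhere. *)
Lemma hardy2_bounded (f : C -> C) : hardy2 f ->
  exists B : R, forall z, 1 <= complex.Im z -> cabs (f z) <= B.
Proof.
move=> [hf [M fM]].
have cfy y : 0 < y -> continuous (fun x : R => cabs (f (x +i* y)) ^+ 2).
  move=> y0 x.
  apply: (@continuous_comp _ _ _ (fun x : R => cabs (f (x +i* y))) (fun t : R => t ^+ 2)).
    apply: (@continuous_comp _ _ _ (fun x : R => f (x +i* y)) (@cabs R)).
      apply: (@continuous_comp _ _ _ (fun x : R => x +i* y : C) f).
        by apply: cvg_complex; [exact: cvg_id|exact: cvg_cst].
      exact: (hol_cont (hf (x +i* y) y0)).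
    exact: cabs_cont.
  exact: exprn_continuous.
have segM a b y : a <= b -> 0 < y ->
    \int[mu]_(t in `[a, b]) (cabs (f (t +i* y)) ^+ 2) <= M.
  move=> ab y0.
  have ci : {within `[a, b], continuous (fun x : R => cabs (f (x +i* y)) ^+ 2)}.
    by apply: continuous_subspaceT; exact: cfy.
  rewrite /Rintegral -lee_fin fineK; last first.
    by apply: integrable_fin_num => //; exact: cont_integrable.
  apply: le_trans (fM y y0).
  apply: ge0_subset_integral => //.
  - apply/measurable_EFinP; apply: continuous_measurable_fun; exact: cfy.
  - by move=> x _; rewrite lee_fin sqr_ge0.
pose phi z := f z ^+ 2.
have dphi z : UHP z -> derivable phi z 1 by move=> /hf; exact: holX.
have phiM a b y : a <= b -> 0 < y -> cabs (cint (fun t => phi (t +i* y)) a b) <= M.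
  move=> ab y0.
  have cp : {within `[a, b], continuous (fun t => phi (t +i* y))}.
    by apply: hline_cont => x _; apply: hol_cont; exact: dphi.
  apply: (le_trans (cint_norm cp)).
  apply: le_trans (segM a b y ab y0).
  by rewrite le_eqVlt; apply/orP; left; apply/eqP; apply: eq_Rintegral => x _; rewrite cabsX.
have M0 : 0 <= M.
  apply: le_trans (segM 0 0 1 (lexx _) ltr01).
  by apply: Rintegral_ge0 => x _; exact: sqr_ge0.
exists (5 * M + 2) => z z1.
have z0 : 0 < complex.Im z by exact: lt_le_trans z1.
(* otherwise the integral of |f|^2 over a unit segment would exceed M *)
have [s /andP[s0 s1] hs] : exists2 s : R, 0 <= s <= 1 & cabs (f (z + s%:C)) ^+ 2 <= M + 1.
  apply: contrapT => nh.
  pose a := complex.Re z; pose y := complex.Im z.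
  have := segM a (a + 1) y; rewrite lerDl ler01 => /(_ isT z0); apply/negP.
  rewrite -ltNge; apply: (@lt_le_trans _ _ (M + 1)); first by rewrite ltrDl.
  have a1 : a <= a + 1 by rewrite lerDl.
  have mab : mu `[a, a + 1]%classic = 1%:E.
    rewrite lebesgue_measure_itv/= lte_fin ltrDl ltr01 -EFinB.
    by congr (_%:E); ring.
  have -> : M + 1 = \int[mu]_(t in `[a, a + 1]) (M + 1).
    by rewrite Rintegral_cst//= mab mulr1.
  apply: le_Rintegral => //.
  - by apply: cont_integrable; apply: continuous_subspaceT => x; exact: cvg_cst.
  - by apply: cont_integrable; apply: continuous_subspaceT; exact: cfy.
  move=> x; rewrite /= in_itv/= => /andP[x1 x2]; rewrite leNgt; apply/negP => hx.
  apply: nh; exists (x - a); first by rewrite subr_ge0 x1 lerBlDl.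
  have -> : z + (x - a)%:C = x +i* y; last exact: ltW.
  by apply: Cext; rewrite /a /y ?cReD ?cImD/=; ring.
have := horizontal_oscillation dphi phiM z1 s0.
rewrite cabsB => osc.
have : cabs (phi z) <= 5 * M + 1.
  have -> : phi z = (phi z - phi (z + s%:C)) + phi (z + s%:C) by ring.
  apply: (le_trans (ler_cabsD _ _)).
  have -> : 5 * M + 1 = 4 * M + (M + 1) by ring.
  by rewrite lerD// /phi cabsX.
rewrite /phi cabsX => h.
have := cabs_ge0 (f z); set t := cabs (f z) in h * => t0.
rewrite leNgt; apply/negP => tb.
nra.
Qed.

End HardyBound.

(** * A Phragmen-Lindelof principle *)

Section PhragmenLindelof.
Variable R : realType.
Local Notation C := (Cx R).
Implicit Types z w : C.

Lemma closed_ReIm (f : C -> R) (a : R) : continuous f -> closed [set z | a <= f z].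
Proof.
move=> cf; apply: (closed_comp (f := f) (D := [set s | a <= s])).
  by move=> w _; exact: cf.
exact: closed_ge.
Qed.

Lemma open_cont_gt (f : C -> R) (a : R) z : continuous f -> a < f z ->
  \forall w \near z, a < f w.
Proof.
move=> cf az; apply: (cf z [set s | a < s]).
by apply: open_nbhs_nbhs; split => //; exact: open_gt.
Qed.

Lemma Re_leNcabs z : - cabs z <= complex.Re z <= cabs z.
Proof. by rewrite -ler_norml normr_Re_le. Qed.

(** The quadrant is the image under [zeta -> zeta ^ 2] of the sector
    [0 <= Im <= Re], on which [(1 - 2 i) zeta ^ 3] has a positive real part of
    cubic growth; in terms of [z] this beats any exponential of [|z|]. *)
Lemma PL_quadrant (Phi : C -> C) (K B tau : R) :
  (forall z, 0 <= complex.Re z -> 0 <= complex.Im z -> derivable Phi z 1) ->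
  0 <= tau -> 0 <= B ->
  (forall z, 0 <= complex.Re z -> 0 <= complex.Im z ->
     cabs (Phi z) <= K * expR (tau * cabs z)) ->
  (forall z, 0 <= complex.Re z -> 0 <= complex.Im z ->
     complex.Re z = 0 \/ complex.Im z = 0 -> cabs (Phi z) <= B) ->
  forall z, 0 <= complex.Re z -> 0 <= complex.Im z -> cabs (Phi z) <= B.
Proof.
move=> dP tau0 B0 gP bP.
pose Om : set C := [set z | 0 <= complex.Im z] `&` [set z | 0 <= complex.Re z - complex.Im z].
pose O : set C := [set z | 0 < complex.Im z] `&` [set z | 0 < complex.Re z - complex.Im z].
pose ka : C := 1 +i* (-2).
have cRI : continuous (fun z : C => complex.Re z - complex.Im z).
  by move=> z; exact: (cvgB (@Re_cont R z) (@Im_cont R z)).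
have sqRe z : complex.Re (z ^+ 2) = complex.Re z ^+ 2 - complex.Im z ^+ 2.
  by rewrite expr2 cReM; ring.
have sqIm z : complex.Im (z ^+ 2) = 2 * complex.Re z * complex.Im z.
  by rewrite expr2 cImM; ring.
have OmQ z : Om z -> 0 <= complex.Re (z ^+ 2) /\ 0 <= complex.Im (z ^+ 2).
  by rewrite sqRe sqIm; move=> [/= h1 h2]; split; nra.
have Rek z : Om z -> complex.Re z ^+ 3 <= complex.Re (ka * z ^+ 3).
  move=> [/= h1 h2].
  have -> : complex.Re (ka * z ^+ 3) = complex.Re z ^+ 3 +
     complex.Im z * (6 * complex.Re z ^+ 2 - 3 * complex.Re z * complex.Im z - 2 * complex.Im z ^+ 2).
    by case: z h1 h2 => x y _ _; rewrite !exprS expr0 mulr1 !cReM !cImM /ka/=; ring.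
  rewrite lerDl mulr_ge0//; nra.
have K0 : 0 <= K.
  by have := gP 0 (lexx 0) (lexx 0); rewrite cabs0 mulr0 expR0 mulr1; apply: le_trans; exact: cabs_ge0.
have main (d : R) : 0 < d -> forall z, Om z -> cabs (Phi (z ^+ 2) * cexp (- (d%:C * (ka * z ^+ 3)))) <= B.
  move=> d0; pose g z := Phi (z ^+ 2) * cexp (- (d%:C * (ka * z ^+ 3))).
  have damp z : Om z -> cabs (cexp (- (d%:C * (ka * z ^+ 3)))) <= expR (- (d * complex.Re z ^+ 3)).
    move=> /Rek h; rewrite cabs_cexp ler_expR cReN lerN2 cReM/= mul0r subr0.
    by rewrite ler_pM2l.
  have damp1 z : Om z -> cabs (cexp (- (d%:C * (ka * z ^+ 3)))) <= 1.
    move=> Omz; apply: (le_trans (damp z Omz)); rewrite -[leRHS]expR0 ler_expR oppr_le0.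
    by rewrite mulr_ge0 ?(ltW d0)// exprn_ge0//; case: Omz => /= ? ?; lra.
  apply: (@max_principle R Om O g).
  - by apply: closedI; apply: closed_ReIm; [exact: Im_cont|exact: cRI].
  - move=> z [/= h1 h2]; apply: filterI.
      by apply: filterS (open_cont_gt (@Im_cont R) h1) => w /= /ltW.
    by apply: filterS (open_cont_gt cRI h2) => w /= /ltW.
  - move=> z Omz; have [q1 q2] := OmQ z Omz.
    apply: holM.
      by apply: (@hol_comp _ Phi (fun z => z ^+ 2)); [apply: holX; exact: hol_id|exact: dP].
    apply: (@hol_comp _ (@cexp R) (fun z => - (d%:C * (ka * z ^+ 3)))); last exact: cexp_hol.
    apply: holN; apply: (holM (@hol_cst _ _ _)); apply: (holM (@hol_cst _ _ _)).
    by apply: holX; exact: hol_id.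
  - exact: B0.
  - move=> z Omz nO; have [q1 q2] := OmQ z Omz.
    rewrite /g cabsM -[leRHS]mulr1 ler_pM ?cabs_ge0 ?damp1//.
    apply: bP => //; rewrite sqRe sqIm.
    case: Omz => /= h1 h2.
    have [h1'|h1'] := ltP 0 (complex.Im z); last first.
      by right; rewrite (_ : complex.Im z = 0) ?mulr0//; lra.
    left; have -> : complex.Re z = complex.Im z; last by rewrite subrr.
    have [h2'|h2'] := ltP 0 (complex.Re z - complex.Im z); last by lra.
    by case: nO.
  move=> e e0.
  pose T := Num.max (Num.max 1 ((2 * tau + 1) / d)) (K / e).
  exists (2 * T) => z Omz zr; have [q1 q2] := OmQ z Omz.
  have [h1 h2] := Omz; rewrite /= in h1 h2.
  set x := complex.Re z in h2 *; set y := complex.Im z in h1 h2.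
  have x0 : 0 <= x by lra.
  have zx : cabs z <= 2 * x.
    by apply: (le_trans (cabs_le_ReIm z)); rewrite -/x -/y !ger0_norm//; lra.
  have Tx : T <= x by lra.
  have [[x1 xd] xK] : (1 <= x /\ (2 * tau + 1) / d <= x) /\ K / e <= x.
    by split; [split|]; apply: le_trans Tx; rewrite /T !le_max lexx ?orbT.
  rewrite /g cabsM.
  apply: (@le_trans _ _ (K * expR (tau * cabs (z ^+ 2)) * expR (- (d * x ^+ 3)))).
    by rewrite ler_pM ?cabs_ge0 ?gP ?damp.
  rewrite -mulrA -expRD.
  have E : tau * cabs (z ^+ 2) + - (d * x ^+ 3) <= - x.
    rewrite cabsX cabs_sqr -/x -/y.
    have d1 : 2 * tau + 1 <= x * d by move: xd; rewrite ler_pdivrMr.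
    have t1 : tau * (x ^+ 2 + y ^+ 2) <= tau * (2 * x ^+ 2).
      by rewrite ler_wpM2l//; nra.
    have x2 : x <= x ^+ 2 by rewrite expr2 ler_peMl.
    have t2 : (2 * tau + 1) * x ^+ 2 <= x * d * x ^+ 2 by rewrite ler_wpM2r// sqr_ge0.
    have -> : d * x ^+ 3 = x * d * x ^+ 2 by ring.
    nra.
  apply: (@le_trans _ _ (K * expR (- x))).
    by rewrite ler_wpM2l// ler_expR.
  apply: (@le_trans _ _ e); last by rewrite lerDr.
  rewrite expRN ler_pdivrMr ?expR_gt0// mulrC -ler_pdivrMr//.
  by apply: (le_trans xK); apply: le_trans (expR_ge1Dx x); rewrite lerDr.
move=> z z1 z2.
(* half-angle formulas for the square root of z in the sector *)
pose rho := cabs z; pose p := complex.Re z; pose q := complex.Im z.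
have /andP[_ prho] := Re_leNcabs z.
pose x := Num.sqrt ((rho + p) / 2); pose y := Num.sqrt ((rho - p) / 2).
have rp0 : 0 <= (rho + p) / 2 by rewrite divr_ge0// addr_ge0// /rho cabs_ge0.
have rm0 : 0 <= (rho - p) / 2 by rewrite divr_ge0// subr_ge0.
have x2 : x ^+ 2 = (rho + p) / 2 by rewrite sqr_sqrtr.
have y2 : y ^+ 2 = (rho - p) / 2 by rewrite sqr_sqrtr.
have x0 : 0 <= x by exact: sqrtr_ge0.
have y0 : 0 <= y by exact: sqrtr_ge0.
have yx : y <= x.
  by rewrite ler_wsqrtr// ler_pM2r ?invr_gt0// lerD2l (le_trans _ z1)// oppr_le0.
pose zeta : C := x +i* y.
have Omz : Om zeta by split => //=; rewrite subr_ge0.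
have ez : z = zeta ^+ 2.
  apply: Cext; rewrite ?sqRe ?sqIm /zeta/=.
    by rewrite x2 y2 -/p; field.
  have r2 : rho ^+ 2 = p ^+ 2 + q ^+ 2 by rewrite /rho cabs_sqr.
  apply/eqP; rewrite -(@eqrXn2 _ 2)//; last by rewrite !mulr_ge0.
  apply/eqP; rewrite -/q !exprMn x2 y2.
  have -> : q ^+ 2 = rho ^+ 2 - p ^+ 2 by rewrite r2; ring.
  by field.
rewrite leNgt; apply/negP => nB.
have Phi0 : 0 < cabs (Phi z) by exact: le_lt_trans nB.
pose c := complex.Re (ka * zeta ^+ 3).
have c0 : 0 <= c by apply: le_trans (Rek _ Omz); rewrite exprn_ge0.
pose l := (cabs (Phi z) - B) / cabs (Phi z).
have l0 : 0 < l by rewrite divr_gt0// subr_gt0.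
have c10 : 0 < c + 1 by rewrite ltr_wpDl.
have l20 : 0 < l / 2 by exact: divr_gt0.
have d0 : 0 < l / 2 / (c + 1) by exact: divr_gt0.
have := main _ d0 zeta Omz; rewrite -ez cabsM cabs_cexp cReN cReM/= mul0r subr0 -/c.
apply/negP; rewrite -ltNge.
have h1 : 1 - l < expR (- (l / 2 / (c + 1) * c)).
  apply: lt_le_trans (expR_ge1Dx _); rewrite ltrD2l ltrN2.
  rewrite mulrAC ltr_pdivrMr ?ltr_wpDl//.
  apply: (@le_lt_trans _ _ (l * c)).
    by rewrite mulrAC ler_pdivrMr// ler_peMr ?ler1n// mulr_ge0// ltW.
  by rewrite ltr_pM2l// ltrDl.
have -> : B = cabs (Phi z) * (1 - l).
  by rewrite /l; field; rewrite gt_eqF.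
by rewrite ltr_pM2l.
Qed.

(** The two quadrants give boundedness, with a constant that involves the bound
    on the imaginary axis. The maximum principle for [Phi ^ n / (z + i)], which
    vanishes at infinity, then removes that constant as [n] grows. *)
Lemma PL_halfplane (Phi : C -> C) (K B B' tau : R) :
  (forall z, 0 <= complex.Im z -> derivable Phi z 1) ->
  0 <= tau -> 0 <= B ->
  (forall z, 0 <= complex.Im z -> cabs (Phi z) <= K * expR (tau * cabs z)) ->
  (forall z, complex.Im z = 0 -> cabs (Phi z) <= B) ->
  (forall z, 0 <= complex.Im z -> complex.Re z = 0 -> cabs (Phi z) <= B') ->
  forall z, 0 <= complex.Im z -> cabs (Phi z) <= B.
Proof.
move=> dP tau0 B0 gP bP iP.
pose B1 := Num.max B B'.
have B10 : 0 <= B1 by rewrite le_max B0.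
have BB1 : B <= B1 by rewrite le_max lexx.
have B'B1 : B' <= B1 by rewrite le_max lexx orbT.
have i1 : cabs ('i : C) = 1 by rewrite cabsE/= expr0n expr1n/= add0r sqrtr1.
have ReI z : complex.Re ('i * z) = - complex.Im z by rewrite cReM/=; ring.
have ImI z : complex.Im ('i * z) = complex.Re z by rewrite cImM/=; ring.
have bounded z : 0 <= complex.Im z -> cabs (Phi z) <= B1.
  move=> z0; have [x0|/ltW x0] := leP 0 (complex.Re z).
    apply: (@PL_quadrant Phi K B1 tau _ tau0 B10 _ _ z x0 z0).
    - by move=> w _; exact: dP.
    - by move=> w _; exact: gP.
    - move=> w w1 w2 [w3|w3]; first exact: le_trans (iP w w2 w3) B'B1.
      exact: le_trans (bP w w3) BB1.
  pose Psi w := Phi ('i * w).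
  have -> : z = 'i * (- 'i * z).
    by apply: Cext; rewrite ?cReM ?cImM/= ?cReM ?cImM/=; ring.
  apply: (@PL_quadrant Psi K B1 tau _ tau0 B10).
  - move=> w w1 w2.
    apply: (@hol_comp _ Phi (fun w => 'i * w)).
      exact: (holM (@hol_cst _ _ _) (@hol_id _ _)).
    by apply: dP; rewrite ImI.
  - move=> w w1 w2; rewrite -[cabs w]mul1r -i1 -cabsM; apply: gP.
    by rewrite ImI.
  - move=> w w1 w2 [w3|w3].
      by apply: le_trans BB1; apply: bP; rewrite ImI.
    by apply: le_trans B'B1; apply: iP; rewrite ?ImI ?ReI ?w3 ?oppr0.
  - by rewrite mulNr cReN ReI opprK.
  - by rewrite mulNr cImN ImI oppr_ge0.
have main n z : 0 <= complex.Im z -> cabs (Phi z ^+ n.+1 / (z + 'i)) <= B ^+ n.+1.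
  apply: (@max_principle R [set z | 0 <= complex.Im z] [set z | 0 < complex.Im z]
    (fun z => Phi z ^+ n.+1 / (z + 'i))).
  - by apply: closed_ReIm; exact: Im_cont.
  - by move=> w /= w0; apply: filterS (open_cont_gt (@Im_cont R) w0) => v /= /ltW.
  - move=> w /= w0.
    apply: (@hol_div _ (fun z => Phi z ^+ n.+1) (fun z => z + 'i)).
    + by apply: holX; exact: dP.
    + exact: (holD (@hol_id _ _) (@hol_cst _ _ _)).
    + apply/eqP => /(congr1 (fun z : C => complex.Im z)); rewrite cImD/=; lra.
  - by rewrite exprn_ge0.
  - move=> w /= w0 /negP; rewrite -leNgt => w1.
    have w2 : complex.Im w = 0 by lra.
    rewrite cabs_div cabsX ler_pdivrMr; last first.
      apply: (lt_le_trans _ (le_trans (ler_norm _) (normr_Im_le _))).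
      by rewrite cImD/=; lra.
    apply: (@le_trans _ _ (B ^+ n.+1 * 1)).
      by rewrite mulr1 lerXn2r ?nnegrE ?cabs_ge0// bP.
    rewrite ler_wpM2l ?exprn_ge0//.
    apply: (le_trans _ (le_trans (ler_norm _) (normr_Im_le _))).
    by rewrite cImD/=; lra.
  - move=> e e0; exists (B1 ^+ n.+1 / e + 1) => w /= w0 wr.
    have wi : B1 ^+ n.+1 / e <= cabs (w + 'i).
      have := ler_cabsB (w + 'i) 'i; rewrite addrK i1; lra.
    have wi0 : 0 < cabs (w + 'i).
      apply: (lt_le_trans _ (le_trans (ler_norm _) (normr_Im_le _))).
      by rewrite cImD/=; lra.
    apply: (@le_trans _ _ e); last by rewrite lerDr exprn_ge0.
    rewrite cabs_div cabsX ler_pdivrMr//.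
    apply: (@le_trans _ _ (B1 ^+ n.+1)).
      by rewrite lerXn2r ?nnegrE ?cabs_ge0// bounded.
    by rewrite mulrC -ler_pdivrMr.
move=> z z0; rewrite leNgt; apply/negP => nB.
have P0 : 0 < cabs (Phi z) by exact: le_lt_trans nB.
pose q := B / cabs (Phi z).
have q1 : `|q| < 1 by rewrite ger0_norm ?divr_ge0 ?cabs_ge0// ltr_pdivrMr// mul1r.
have zi0 : 0 < cabs (z + 'i).
  apply: (lt_le_trans _ (le_trans (ler_norm _) (normr_Im_le _))).
  by rewrite cImD/=; lra.
have /cvgrPdist_lt := cvg_expr q1.
move=> /(_ (cabs (z + 'i))^-1); rewrite invr_gt0 => /(_ zi0)[N _ hN].
have := hN N.+1 (leqnSn N); rewrite sub0r normrN normrX.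
rewrite ger0_norm ?divr_ge0 ?cabs_ge0// => h.
have := main N z z0; apply/negP; rewrite -ltNge.
rewrite cabs_div cabsX; move: h; rewrite /q expr_div_n ltr_pdivrMr ?exprn_gt0//.
by rewrite mulrC.
Qed.

End PhragmenLindelof.

(** * Uniform boundedness *)

Section NormedSpace.
Variable R : realType.
Local Notation C := (Cx R).
Variable H : completeNormedModType C.
Implicit Types (F G : H) (L : set H).

Definition nrm F : R := complex.Re `|F|.

Lemma nrmE F : `|F| = (nrm F)%:C :> C.
Proof.
have := normr_ge0 F; rewrite /nrm; case: (`|F|) => a b.
by rewrite lecE/= => /andP[/eqP -> _].
Qed.

Lemma nrm_ge0 F : 0 <= nrm F.
Proof. by rewrite -lecR -nrmE normr_ge0. Qed.

Lemma nrmD F G : nrm (F + G) <= nrm F + nrm G.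
Proof. by rewrite -lecR rmorphD/= -!nrmE ler_normD. Qed.

Lemma nrmZ (k : C) F : nrm (k *: F) = cabs k * nrm F.
Proof. by apply: complexI; rewrite rmorphM/= -!nrmE normrZ norm_cabs. Qed.

Lemma nrmN F : nrm (- F) = nrm F.
Proof. by rewrite /nrm normrN. Qed.

Lemma nrm0 : nrm (0 : H) = 0.
Proof. by rewrite /nrm normr0. Qed.

Lemma nrm_eq0 F : nrm F = 0 -> F = 0.
Proof. by move=> h; apply/eqP; rewrite -normr_eq0 nrmE h. Qed.

Lemma nrm_gt0 F : F <> 0 -> 0 < nrm F.
Proof.
move=> F0; rewrite lt_def nrm_ge0 andbT; apply/negP => /eqP h.
exact: F0 (nrm_eq0 h).
Qed.

Lemma nrmB F G : nrm (F - G) = nrm (G - F).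
Proof. by rewrite -nrmN opprB. Qed.

Lemma nrmD3 F G K : nrm (F - K) <= nrm (F - G) + nrm (G - K).
Proof. by rewrite -[F - K](subrKA G) nrmD. Qed.

Lemma nbhs_nrmP F (A : set H) :
  nbhs F A <-> exists2 e : R, 0 < e & forall G, nrm (G - F) < e -> A G.
Proof.
split=> [/nbhs_ballP[e/= e0 he]|[e e0 he]].
  have [er e0'] : e = (complex.Re e)%:C /\ 0 < complex.Re e.
    by case: e e0 {he} => a b; rewrite ltcE/= => /andP[/eqP -> ?].
  exists (complex.Re e) => // G GF; apply: he.
  by rewrite -ball_normE /= distrC nrmE er ltcR.
apply/nbhs_ballP; exists (e%:C) => /=; first by rewrite ltcR.
by move=> G; rewrite -ball_normE /= distrC nrmE ltcR => /he.
Qed.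

Lemma closure_nrmP (A : set H) F : closure A F <->
  forall e : R, 0 < e -> exists2 G, A G & nrm (G - F) < e.
Proof.
split=> [clA e e0|h B /nbhs_nrmP[e e0 hB]].
  have /clA[G [AG BG]] : nbhs F [set G | nrm (G - F) < e].
    by apply/nbhs_nrmP; exists e.
  by exists G.
by have [G AG /hB BG] := h e e0; exists G.
Qed.

Lemma nrm_complete (u : nat -> H) :
  (forall e : R, 0 < e -> exists N : nat, forall m n, (N <= m)%N -> (N <= n)%N ->
     nrm (u m - u n) < e) ->
  exists l, forall e : R, 0 < e -> exists N : nat, forall n, (N <= n)%N ->
     nrm (u n - l) < e.
Proof.
move=> cu.
have /cauchy_cvg/cvg_ex[l ul] : cauchy (u @ \oo).
  apply/cauchy_ballP => e e0.
  have [er e0'] : e = (complex.Re e)%:C /\ 0 < complex.Re e.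
    by case: e e0 => a b; rewrite ltcE/= => /andP[/eqP -> ?].
  have [N hN] := cu _ e0'.
  near=> p; rewrite -ball_normE /= nrmE er ltcR.
  suff [p1 p2] : (exists2 m, (N <= m)%N & u m = p.1) /\ (exists2 n, (N <= n)%N & u n = p.2).
    by case: p1 => m Nm <-; case: p2 => n Nn <-; exact: hN.
  near: p.
  exists ([set F | exists2 m, (N <= m)%N & u m = F], [set F | exists2 m, (N <= m)%N & u m = F]) => /=.
    by split; exists N => // m /= Nm; exists m.
  by move=> [x y] [].
exists l => e e0.
have /ul[N _ hN] : nbhs l [set F | nrm (F - l) < e] by apply/nbhs_nrmP; exists e.
by exists N => n Nn; exact: (hN n Nn).
Unshelve. all: by end_near. Qed.

(** If the seminorms were unbounded on every ball of [L], nested balls could be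
    chosen on the [n]-th of which some seminorm exceeds [n], and their common
    point would contradict pointwise boundedness. The argument is carried out in
    the closed subspace [L] of the complete space [H], so that it applies to the
    closure of [R_m]. *)
Lemma uniform_boundedness L (I : Type) (T : I -> H -> R) :
  L 0 -> (forall F G, L F -> L G -> L (F + G)) -> (forall k F, L F -> L (k *: F)) ->
  closure L `<=` L ->
  (forall i F G, T i (F + G) <= T i F + T i G) ->
  (forall i k F, T i (k *: F) = cabs k * T i F) ->
  (forall i F a, a < T i F -> exists2 d : R, 0 < d &
     forall G, nrm (G - F) <= d -> a < T i G) ->
  (forall F, L F -> exists K : R, forall i, T i F <= K) ->
  exists2 K : R, 0 <= K & forall i F, L F -> T i F <= K * nrm F.
Proof.
move=> L0 LD LZ Lcl TD TZ Tlsc Tpt.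
have [F0 LF0 [r r0 [k hk]]] : exists2 F0, L F0 & exists2 r : R, 0 < r &
    exists k : R, forall F, L F -> nrm (F - F0) <= r -> forall i, T i F <= k.
  apply: contrapT => nB.
  have step (q : nat * (H * R)) : exists p : H * R, L q.2.1 -> 0 < q.2.2 ->
      [/\ L p.1, 0 < p.2, p.2 <= q.2.2 / 2, nrm (p.1 - q.2.1) <= q.2.2 / 2 &
       exists i, forall G, nrm (G - p.1) <= p.2 -> q.1%:R < T i G].
    case: q => n [F0 r] /=.
    have [LF0|nL] := pselect (L F0); last by exists (0, 0) => /nL.
    have [r0|nr0] := pselect (0 < r); last by exists (0, 0) => _ /nr0.
    have r20 : 0 < r / 2 by rewrite divr_gt0.
    have [F [LF Fr] [i hi]] : exists2 F, L F /\ nrm (F - F0) <= r / 2 &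
        exists i, n%:R < T i F.
      apply: contrapT => h; apply: nB; exists F0 => //; exists (r / 2) => //.
      exists n%:R => F LF Fr i; rewrite leNgt; apply/negP => hi.
      by apply: h; exists F => //; exists i.
    have [d d0 hd] := Tlsc i F n%:R hi.
    exists (F, Num.min d (r / 2)) => _ _ /=; split => //.
    - by rewrite lt_min d0.
    - by rewrite ge_min lexx orbT.
    - by exists i => G; rewrite le_min => /andP[/hd].
  have [f hf] := choice step.
  pose u := fix u n : H * R := if n is j.+1 then f (j, u j) else (0, 1).
  have uL n : L (u n).1 /\ 0 < (u n).2.
    elim: n => [|n [ih1 ih2]]; first by split.
    by have [] := hf (n, u n) ih1 ih2.
  have uS n : [/\ (u n.+1).2 <= (u n).2 / 2, nrm ((u n.+1).1 - (u n).1) <= (u n).2 / 2 &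
      exists i, forall G, nrm (G - (u n.+1).1) <= (u n.+1).2 -> n%:R < T i G].
    by have [h1 h2] := uL n; have [] := hf (n, u n) h1 h2.
  have nest n j G : nrm (G - (u (n + j)%N).1) <= (u (n + j)%N).2 ->
      nrm (G - (u n).1) <= (u n).2.
    elim: j G => [|j ih] G; first by rewrite addn0.
    rewrite addnS => hG; apply: ih; have [h1 h2 _] := uS (n + j)%N.
    apply: (le_trans (nrmD3 _ (u (n + j).+1).1 _)).
    rewrite [leRHS]splitr lerD//; exact: le_trans hG h1.
  have ur n : (u n).2 <= 1 / 2 ^+ n.
    elim: n => [|n ih]; first by rewrite expr0 divr1.
    have [h1 _ _] := uS n; apply: (le_trans h1).
    have -> : 1 / 2 ^+ n.+1 = 1 / 2 ^+ n / 2 :> R.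
      by rewrite exprS; field; rewrite expf_neq0.
    by rewrite ler_pM2r.
  have inball n m : (n <= m)%N -> nrm ((u m).1 - (u n).1) <= (u n).2.
    move=> nm; apply: (nest n (m - n)%N); rewrite subnKC// subrr nrm0 ltW//.
    by case: (uL m).
  have [l hl] : exists l, forall e : R, 0 < e -> exists N : nat, forall n, (N <= n)%N ->
     nrm ((u n).1 - l) < e.
    apply: (@nrm_complete (fun n => (u n).1)) => e e0.
    have [N hN] := @half_pow_lt R 2 e e0.
    exists N => m n Nm Nn; apply: (le_lt_trans (nrmD3 _ (u N).1 _)).
    rewrite [nrm ((u N).1 - _)]nrmB.
    apply: (le_lt_trans (lerD (inball _ _ Nm) (inball _ _ Nn))).
    apply: (le_lt_trans (lerD (ur N) (ur N))).
    by rewrite -mulrDl; apply: hN.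
  have Ll : L l.
    apply: Lcl; apply/closure_nrmP => e e0; have [N hN] := hl e e0.
    by exists (u N).1; [case: (uL N)|exact: hN].
  have lin n : nrm (l - (u n).1) <= (u n).2.
    apply/ler_addgt0Pr => e e0; have [N hN] := hl e e0.
    have hm := hN (maxn N n) (leq_maxl _ _).
    apply: (le_trans (nrmD3 _ (u (maxn N n)).1 _)).
    by rewrite addrC lerD ?inball ?leq_maxr// nrmB ltW.
  have [K hK] := Tpt l Ll.
  pose n := Num.truncn K; have [_ _ [i hi]] := uS n.+1.
  have := hi l (lin n.+2); apply/negP; rewrite -leNgt.
  by apply: (le_trans (hK i)); rewrite ltW// truncnS_gt.
have T0 (i : I) : 0 <= k + k.
  have := TD i F0 (- F0); rewrite subrr -(scale0r F0) TZ cabs0 mul0r => h.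
  apply: (le_trans h); rewrite -scaleN1r TZ cabsN cabs1 mul1r.
  by rewrite lerD// hk// subrr nrm0 ltW.
exists (`|k + k| / r) => [|i F LF]; first by rewrite divr_ge0// ltW.
have [->|/eqP F0'] := eqVneq F 0.
  by rewrite -(scale0r F0) TZ cabs0 mul0r scale0r nrm0 mulr0.
have nF := nrm_gt0 F0'.
pose t := r / nrm F; have t0 : 0 < t by exact: divr_gt0.
have ct : cabs (t%:C : C) = t by rewrite cabs_real gtr0_norm.
have h1 : T i (F0 + t%:C *: F) <= k.
  apply: hk; first by apply: LD => //; exact: LZ.
  by rewrite addrC addKr nrmZ ct /t divfK// gt_eqF.
have h2 : T i (- F0) <= k.
  by rewrite -scaleN1r TZ cabsN cabs1 mul1r hk// subrr nrm0 ltW.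
have := TD i (F0 + t%:C *: F) (- F0); rewrite addrC addKr TZ ct => h.
have {}h := le_trans h (lerD h1 h2).
rewrite ger0_norm ?(T0 i)//.
have -> : (k + k) / r * nrm F = (k + k) / t by rewrite /t; field; rewrite !gt_eqF.
by rewrite ler_pdivlMr// mulrC.
Qed.

End NormedSpace.

(** * Point evaluations and pointwise limits in a de Branges space *)

Section DeBranges.
Variable R : realType.
Local Notation C := (Cx R).
Variable H : completeNormedModType C.
Variable ev : {linear H -> (C -> C)}.
Hypothesis HdB : is_deBranges ev.
Implicit Types (F G : H).

Lemma evD F G z : ev (F + G) z = ev F z + ev G z.
Proof. by rewrite linearD. Qed.
Lemma evB F G z : ev (F - G) z = ev F z - ev G z.
Proof. by rewrite linearB. Qed.
Lemma evZ k F z : ev (k *: F) z = k * ev F z.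
Proof. by rewrite linearZ. Qed.
Lemma ev0 z : ev 0 z = 0.
Proof. by rewrite linear0. Qed.
Lemma ev_sum (I : Type) (s : seq I) (f : I -> H) z :
  ev (\sum_(i <- s) f i) z = \sum_(i <- s) ev (f i) z.
Proof.
elim: s => [|a s ih]; first by rewrite !big_nil ev0.
by rewrite !big_cons evD ih.
Qed.

Lemma ev_hol F z : derivable (ev F) z 1.
Proof. exact: (@dB_entire R H ev HdB F z I). Qed.

Lemma ev_cont_at w F (e : R) : 0 < e -> exists2 d : R, 0 < d &
  forall G, nrm (G - F) < d -> cabs (ev G w - ev F w) < e.
Proof.
move=> e0; have := @dB1 R H ev HdB w F.
move=> /(_ [set z | cabs (z - ev F w) < e]) h.
have /h/nbhs_nrmP : nbhs (ev F w) [set z | cabs (z - ev F w) < e].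
  by apply/nbhs_cabsP; exists e.
by [].
Qed.

(** The coefficients [b] and [c] make one statement serve for difference
    quotients and for weighted evaluations; [c i = 0] removes an index from the
    family. *)
Lemma ev_uniform_boundedness (L : set H) (I : Type) (p q b c : I -> C) :
  L 0 -> (forall F G, L F -> L G -> L (F + G)) -> (forall k F, L F -> L (k *: F)) ->
  closure L `<=` L ->
  (forall F, L F -> exists K : R, forall i, cabs (c i * (ev F (p i) - b i * ev F (q i))) <= K) ->
  exists2 K : R, 0 <= K & forall i F, L F ->
    cabs (c i * (ev F (p i) - b i * ev F (q i))) <= K * nrm F.
Proof.
move=> L0 LD LZ Lcl pt.
apply: (@uniform_boundedness R H L I
  (fun i F => cabs (c i * (ev F (p i) - b i * ev F (q i)))) L0 LD LZ Lcl _ _ _ pt).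
- move=> i F G; apply: le_trans (ler_cabsD _ _).
  by rewrite !evD le_eqVlt; apply/orP; left; apply/eqP; congr cabs; ring.
- move=> i k F; rewrite -cabsM !evZ; congr cabs; ring.
move=> i F a aF.
pose M := cabs (c i) * (1 + cabs (b i)) + 1.
have M0 : 0 < M by rewrite ltr_wpDl// mulr_ge0 ?cabs_ge0// addr_ge0// cabs_ge0.
have [t tE] : exists t, t = cabs (c i * (ev F (p i) - b i * ev F (q i))) by eexists.
rewrite -tE in aF.
have e0 : 0 < (t - a) / M by rewrite divr_gt0// subr_gt0.
have [d1 d10 h1] := ev_cont_at (p i) F e0.
have [d2 d20 h2] := ev_cont_at (q i) F e0.
pose d : R := Num.min d1 d2 / 2.
have dm0 : 0 < Num.min d1 d2 by rewrite lt_min d10.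
have [dd1 dd2] : d < d1 /\ d < d2.
  have : d < Num.min d1 d2 by rewrite ltr_pdivrMr// ltr_pMr// ltr1n.
  by rewrite lt_min => /andP.
exists d; first by rewrite divr_gt0.
move=> G Gd; have k1 := h1 G (le_lt_trans Gd dd1); have k2 := h2 G (le_lt_trans Gd dd2).
set s := cabs (c i * (ev G (p i) - b i * ev G (q i))).
suff : t - s < t - a by rewrite ltrD2l ltrN2.
apply: le_lt_trans (_ : cabs (c i) * (1 + cabs (b i)) * ((t - a) / M) < _).
  have -> : t - s <= cabs (c i) * (1 + cabs (b i)) * ((t - a) / M) = (t <= cabs (c i) * (1 + cabs (b i)) * ((t - a) / M) + s) by rewrite lerBlDr.
  rewrite [X in X <= _]tE; set X := c i * _; set Y := c i * _ in s *.
  have -> : X = (X - Y) + Y by rewrite subrK.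
  apply: (le_trans (ler_cabsD _ _)); rewrite lerD2r.
  have -> : X - Y = c i * ((ev F (p i) - ev G (p i)) - b i * (ev F (q i) - ev G (q i))).
    by rewrite /X /Y; ring.
  rewrite cabsM -mulrA ler_wpM2l ?cabs_ge0//.
  apply: (le_trans (ler_cabsB _ _)); rewrite mulrDl mul1r cabsM.
  apply: lerD; first by rewrite cabsB ltW.
  by apply: ler_wpM2l; [exact: cabs_ge0|rewrite cabsB ltW].
rewrite mulrA ltr_pdivrMr// mulrC ltr_pM2l ?subr_gt0//.
by rewrite /M ltrDl.
Qed.

Lemma ev_bounded z : exists2 K : R, 0 <= K & forall F, cabs (ev F z) <= K * nrm F.
Proof.
have [|K K0 hK] := @ev_uniform_boundedness setT unit (fun=> z) (fun=> z)
  (fun=> 0) (fun=> 1) I (fun _ _ _ _ => I) (fun _ _ _ => I) (fun _ _ => I).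
  by move=> F _; exists (cabs (1 * (ev F z - 0 * ev F z))) => _.
by exists K => // F; have := hK tt F I; rewrite mul0r subr0 mul1r.
Qed.

Lemma parallelogram F G :
  nrm (F + G) ^+ 2 + nrm (F - G) ^+ 2 = 2 * (nrm F ^+ 2 + nrm G ^+ 2).
Proof.
have [ip hip] := dB_hilbert HdB; apply: complexI.
rewrite rmorphM !rmorphD/= !rmorphXn/= -!nrmE !hip.
rewrite !(linearDl, linearDr, linearNl, linearNr) /=.
rewrite ?rmorph_nat ?rmorph1; ring.
Qed.

(** The elements of almost minimal norm in the (midpoint) convex hulls of the
    tails form a Cauchy sequence, by the parallelogram law, and convex hulls of
    tails keep the pointwise limits. *)
Lemma bounded_pointwise_limit (u : nat -> H) (B : R) (V : set C) (f : C -> C) :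
  (forall n, nrm (u n) <= B) ->
  (forall v, V v -> forall e : R, 0 < e -> exists N : nat, forall n, (N <= n)%N ->
     cabs (ev (u n) v - f v) <= e) ->
  exists Q, forall v, V v -> ev Q v = f v.
Proof.
move=> uB uf.
have B0 : 0 <= B := le_trans (nrm_ge0 _) (uB 0%N).
pose mid F G : H := 2^-1 *: (F + G).
pose hull n F := forall K : set H, (forall k, (n <= k)%N -> K (u k)) ->
  (forall a b, K a -> K b -> K (mid a b)) -> K F.
have hu n : hull n (u n) by move=> K hK _; exact: hK.
have hmid n F G : hull n F -> hull n G -> hull n (mid F G).
  by move=> hF hG K K1 K2; apply: (K2); [exact: (hF K K1 K2)|exact: (hG K K1 K2)].
have hS n m F : (n <= m)%N -> hull m F -> hull n F.
  by move=> nm hF K K1 K2; apply: hF => // k mk; apply: K1; exact: leq_trans mk.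
pose S n := [set nrm F | F in hull n].
have lbS n : lbound (S n) 0 by move=> _ [F _ <-]; exact: nrm_ge0.
have hasS n : has_inf (S n) by split; [exists (nrm (u n)); exists (u n)|exists 0; exact: lbS].
pose d n := inf (S n).
have d_le n F : hull n F -> d n <= nrm F.
  by move=> hF; apply: ge_inf; [exists 0; exact: lbS|exists F].
have d_mono n m : (n <= m)%N -> d n <= d m.
  move=> nm; apply: lb_le_inf; first by case: (hasS m).
  by move=> _ [F hF <-]; apply: d_le; exact: hS hF.
have dB n : d n <= B by exact: le_trans (d_le _ _ (hu n)) (uB n).
have d0 n : 0 <= d n by apply: lb_le_inf; [case: (hasS n)|exact: lbS].
pose D := sup (range d).
have supD : has_sup (range d).
  by split; [exists (d 0%N); exists 0%N|exists B => _ [n _ <-]].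
have dD n : d n <= D by apply: sup_upper_bound => //; exists n.
have D0 : 0 <= D := le_trans (d0 0%N) (dD 0%N).
have /choice[y hy] : forall n : nat, exists F, hull n F /\ nrm F < d n + (n%:R + 1)^-1.
  move=> n; have n0 : 0 < (n%:R + 1 : R)^-1 by rewrite invr_gt0 ltr_wpDl.
  have [_ [F hF <-] Fd] := inf_adherent n0 (hasS n).
  by exists F.
have [l hl] : exists l, forall e : R, 0 < e -> exists N : nat, forall n, (N <= n)%N ->
     nrm (y n - l) < e.
  apply: nrm_complete => e e0.
  pose del := Num.min 1 (e ^+ 2 / (16 * (D + 1) + 1)).
  have den0 : 0 < 16 * (D + 1) + 1 by nra.
  have del0 : 0 < del by rewrite lt_min ltr01 divr_gt0// exprn_gt0.
  have del1 : del <= 1 by rewrite ge_min lexx.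
  have dele : del * (16 * (D + 1) + 1) <= e ^+ 2.
    by rewrite -ler_pdivlMr// ge_min lexx orbT.
  have [_ [n1 _ <-] hn1] := sup_adherent del0 supD.
  pose n2 := Num.truncn (del^-1).
  have small n : (n2 <= n)%N -> (n%:R + 1)^-1 <= del.
    move=> h; rewrite invf_ple ?posrE ?ltr_wpDl// natr1.
    by apply/ltW/(lt_le_trans (truncnS_gt _)); rewrite ler_nat.
  exists (maxn n1 n2).
  suff main m n : (maxn n1 n2 <= m)%N -> (m <= n)%N -> nrm (y m - y n) < e.
    move=> m n hm hn; have [mn|/ltnW nm] := leqP m n; first exact: main.
    by rewrite nrmB; exact: main.
  move=> hm mn; have hn := leq_trans hm mn.
  have ynrm k : (maxn n1 n2 <= k)%N -> D - del < d k /\ nrm (y k) <= D + del.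
    rewrite geq_max => /andP[k1 k2]; split.
      by apply: (lt_le_trans hn1); exact: d_mono.
    by have [_ /ltW h] := hy k; apply: (le_trans h); rewrite lerD// small.
  have [m1 m2] := ynrm m hm; have [_ nn2] := ynrm n hn.
  have hmn : hull m (mid (y m) (y n)).
    by apply: hmid; [case: (hy m)|apply: hS mn _; case: (hy n)].
  have mm : 2 * d m <= nrm (y m + y n).
    have := d_le _ _ hmn; rewrite nrmZ cabsV.
    have -> : cabs (2 : C) = 2 by rewrite -(rmorph_nat (real_complex R)) cabs_real ger0_norm.
    by rewrite mulrC ler_pdivlMr// mulrC.
  have P := parallelogram (y m) (y n).
  rewrite ltNge; apply/negP => ge.
  have s1 : (2 * d m) ^+ 2 <= nrm (y m + y n) ^+ 2.
    by rewrite ler_sqr ?nnegrE ?nrm_ge0// mulr_ge0.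
  have s2 : e ^+ 2 <= nrm (y m - y n) ^+ 2.
    by rewrite ler_sqr ?nnegrE ?nrm_ge0// ltW.
  have s3 : nrm (y m) ^+ 2 <= (D + del) ^+ 2.
    by rewrite ler_sqr ?nnegrE ?nrm_ge0// addr_ge0// ltW.
  have s4 : nrm (y n) ^+ 2 <= (D + del) ^+ 2.
    by rewrite ler_sqr ?nnegrE ?nrm_ge0// addr_ge0// ltW.
  have s5 : D ^+ 2 - 2 * D * del <= d m ^+ 2.
    have [Dd|dD'] := leP del D; last by have := sqr_ge0 (d m); nra.
    apply: (@le_trans _ _ ((D - del) ^+ 2)); first by have := sqr_ge0 del; nra.
    by rewrite ler_sqr ?nnegrE ?subr_ge0// ltW.
  have s6 : del ^+ 2 <= del by nra.
  nra.
exists l => v Vv; apply/eqP; rewrite -subr_eq0 -cabs_eq0 eq_le cabs_ge0 andbT.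
apply/ler_addgt0Pl => e e0; rewrite addr0.
have e20 : 0 < e / 2 by rewrite divr_gt0.
have [N hN] := uf v Vv _ e20.
have [r r0 hr] := ev_cont_at v l e20.
have [N' hN'] := hl r r0.
pose n := maxn N N'.
have k1 := hr _ (hN' n (leq_maxr _ _)).
have k2 : cabs (ev (y n) v - f v) <= e / 2.
  have [hyn _] := hy n.
  apply: (hyn [set F | cabs (ev F v - f v) <= e / 2]) => [k nk|a b /= ha hb].
    by apply: hN; exact: leq_trans (leq_maxl _ _) nk.
  rewrite /mid evZ evD.
  have -> : 2^-1 * (ev a v + ev b v) - f v = 2^-1 * ((ev a v - f v) + (ev b v - f v)).
    by field.
  rewrite cabsM cabsV.
  have -> : cabs (2 : C) = 2 by rewrite -(rmorph_nat (real_complex R)) cabs_real ger0_norm.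
  rewrite mulrC ler_pdivrMr// (le_trans (ler_cabsD _ _))// mulr_natr mulr2n lerD//.
have -> : ev l v - f v = (ev (y n) v - f v) - (ev (y n) v - ev l v) by ring.
by rewrite (le_trans (ler_cabsB _ _))// [e]splitr lerD// ltW.
Qed.

End DeBranges.

(** * Division of zeros *)

Section Division.
Variable R : realType.
Local Notation C := (Cx R).
Variable H : completeNormedModType C.
Variable ev : {linear H -> (C -> C)}.
Hypothesis HdB : is_deBranges ev.
Implicit Types (F G : H) (z w : C).

Lemma cpow_lim0 (q a : R) : 0 <= q -> q < 1 -> (forall K : R, 0 <= K ->
  (forall k : nat, a <= K * q ^+ k) -> a <= 0).
Proof.
move=> q0 q1 K K0 h; rewrite leNgt; apply/negP => a0.
have nq : `|q| < 1 by rewrite ger0_norm.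
have K1 : 0 < K + 1 by rewrite ltr_wpDl.
have /cvgrPdist_lt /(_ _ (divr_gt0 a0 K1)) [N _ hN] := cvg_expr nq.
have := hN N (leqnn N); rewrite /= sub0r normrN ger0_norm ?exprn_ge0//.
rewrite ltr_pdivlMr// => h1.
have := h N; apply/negP; rewrite -ltNge; apply: le_lt_trans h1.
by rewrite mulrC ler_wpM2l ?exprn_ge0// lerDl.
Qed.

Lemma blaschke w F : complex.Im w != 0 -> ev F w = 0 -> exists2 G,
  forall z, z <> w -> ev G z = (z - w^*) / (z - w) * ev F z & nrm G = nrm F.
Proof.
move=> w0 Fw; have nw : ~ realline w by move=> h; rewrite h eqxx in w0.
by have [G h1 h2] := @dB3 R H ev HdB w F nw Fw; exists G => //; rewrite /nrm h2.
Qed.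

Lemma sharpE (f : C -> C) z : sharp f z = (f z^*)^*.
Proof. by []. Qed.

Lemma cabs_sharp (f : C -> C) z : cabs (sharp f z) = cabs (f z^*).
Proof. by rewrite sharpE cabs_conj. Qed.

Lemma conj_conj (z : C) : z^*^* = z.
Proof. by rewrite !conjE/= opprK; case: z. Qed.

Lemma dist_conj (z w : C) :
  cabs (z - w^*) ^+ 2 - cabs (z - w) ^+ 2 = 4 * complex.Im z * complex.Im w.
Proof.
rewrite !cabs_sqr conjE; case: z => x y; case: w => a b.
by rewrite !cReD !cImD/=; ring.
Qed.

(** If all functions of the family vanished at [w], dividing by the Blaschke
    factor of [w] could be iterated without changing the norm, and bounded point
    evaluation would force every function of the family to vanish on the
    half-plane of [w], hence, by symmetry, everywhere. *)
Lemma nonreal_common_zero (S : set H) w : complex.Im w != 0 ->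
  (forall F, S F -> exists2 G, S G & ev G = sharp (ev F)) ->
  (forall F, S F -> ev F w = 0 -> exists2 G, S G &
     (forall z, z <> w -> ev G z = (z - w^*) / (z - w) * ev F z) /\ nrm G = nrm F) ->
  (exists2 F, S F & F <> 0) -> exists2 F, S F & ev F w <> 0.
Proof.
move=> w0 Ssh Sbl [F0 SF0 F00]; apply: contrapT => nS.
have Sw F : S F -> ev F w = 0.
  by move=> SF; apply: contrapT => h; apply: nS; exists F.
have iter F (k : nat) : S F -> exists2 G, S G & nrm G = nrm F /\
    forall z, z <> w -> ev G z * (z - w) ^+ k = (z - w^*) ^+ k * ev F z.
  move=> SF; elim: k => [|k [G SG [nG eG]]].
    by exists F => //; split => // z _; rewrite !expr0 mulr1 mul1r.
  have [G' SG' [eG' nG']] := Sbl G SG (Sw G SG).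
  exists G' => //; split; first by rewrite nG'.
  move=> z zw; rewrite eG'//.
  have zw0 : z - w != 0 by rewrite subr_eq0; apply/eqP.
  have -> : (z - w^*) / (z - w) * ev G z * (z - w) ^+ k.+1 =
    (z - w^*) * (ev G z * (z - w) ^+ k) by rewrite exprS; field.
  by rewrite eG// exprS mulrA.
have half F z : S F -> 0 < complex.Im z * complex.Im w -> ev F z = 0.
  move=> SF zw; have [->|/eqP zw'] := eqVneq z w; first exact: Sw.
  have lt : cabs (z - w) < cabs (z - w^*).
    by rewrite -ltr_sqr ?nnegrE ?cabs_ge0// -subr_gt0 dist_conj; nra.
  have c0 : 0 < cabs (z - w^*) := le_lt_trans (cabs_ge0 _) lt.
  pose q := cabs (z - w) / cabs (z - w^*).
  have q0 : 0 <= q by rewrite divr_ge0 ?cabs_ge0.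
  have q1 : q < 1 by rewrite ltr_pdivrMr// mul1r.
  have [K K0 hK] := ev_bounded HdB z.
  apply/eqP; rewrite -cabs_eq0 eq_le cabs_ge0 andbT.
  apply: (cpow_lim0 q0 q1 (mulr_ge0 K0 (nrm_ge0 F))) => k.
  have [G SG [nG eG]] := iter F k SF.
  have := congr1 (@cabs R) (eG z zw'); rewrite !cabsM !cabsX => e.
  rewrite /q expr_div_n mulrA ler_pdivlMr ?exprn_gt0// mulrC -e.
  by rewrite ler_wpM2r ?exprn_ge0 ?cabs_ge0// -nG hK.
have off F z : S F -> complex.Im z != 0 -> ev F z = 0.
  move=> SF z0; have [zw|zw] := ltP 0 (complex.Im z * complex.Im w); first exact: half.
  have [G SG eG] := Ssh F SF.
  have : ev G z^* = 0.
    apply: half => //; rewrite conjE/= mulNr oppr_gt0 lt_neqAle zw andbT.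
    by rewrite mulf_neq0.
  rewrite eG sharpE conj_conj => /(congr1 (@Num.conj C)).
  by rewrite conj_conj rmorph0.
have all F z : S F -> ev F z = 0.
  move=> SF; have [z0|z0] := eqVneq (complex.Im z) 0; last exact: off.
  apply/eqP; rewrite -cabs_eq0 eq_le cabs_ge0 andbT.
  apply/ler_addgt0Pl => e e0; rewrite addr0.
  have [d d0 hd] := (cont_cabsP _ _).1 (hol_cont (@ev_hol _ _ _ HdB F z)) _ e0.
  pose z' : C := complex.Re z +i* (d / 2).
  have d20 : 0 < d / 2 by rewrite divr_gt0.
  have := hd z'; rewrite (off F z') ?gt_eqF// sub0r cabsN => h.
  apply/ltW/h; apply: (le_lt_trans (cabs_le_ReIm _)).
  rewrite cReD cReN cImD cImN/= subrr normr0 add0r z0 subr0 gtr0_norm//.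
  by rewrite ltr_pdivrMr// ltr_pMr// ltr1n.
apply: F00; apply: (@dB_inj R H ev HdB); apply/funext => z.
by rewrite ev0 all.
Qed.

(** The Blaschke factor differs from [1] by [2 i Im zeta / (z - zeta)], so the
    quotient is a multiple of the difference of two elements of norm [||k||]. *)
Lemma nonreal_division k (zeta : C) : complex.Im zeta != 0 -> ev k zeta = 0 ->
  exists2 f : H, forall z, z <> zeta -> ev f z = ev k z / (z - zeta) &
    nrm f <= nrm k / `|complex.Im zeta|.
Proof.
move=> z0 kz; have [G eG nG] := blaschke z0 kz.
pose c : C := (zeta - zeta^*)^-1.
have cE : zeta - zeta^* = (2 * complex.Im zeta)%:C * 'i.
  by rewrite conjE; case: (zeta) => a b; apply: Cext => /=; ring.
have i1 : cabs ('i : C) = 1 by rewrite cabsE/= expr0n expr1n/= add0r sqrtr1.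
have cabsz : cabs (zeta - zeta^*) = 2 * `|complex.Im zeta|.
  by rewrite cE cabsM i1 mulr1 cabs_real normrM ger0_norm.
have zz0 : zeta - zeta^* != 0.
  by rewrite -cabs_eq0 cabsz mulf_neq0 ?normr_eq0// pnatr_eq0.
exists (c *: (G - k)).
  move=> z zz; rewrite evZ evB eG// /c.
  have zw0 : z - zeta != 0 by rewrite subr_eq0; apply/eqP.
  by field; rewrite zw0.
rewrite nrmZ cabsV cabsz.
have h : nrm (G - k) <= 2 * nrm k.
  by rewrite (le_trans (nrmD _ _))// nrmN nG mulr_natl mulr2n.
have n0 : 0 < `|complex.Im zeta| by rewrite normr_gt0.
rewrite invfM -mulrA mulrCA mulrC ler_pM2r ?invr_gt0//.
by rewrite ler_pdivrMl.
Qed.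

(** For nonreal [zeta] near [w] the function
    [(F - (F (zeta) / G (zeta)) G) / (z - zeta)] lies in the space, with norm
    [O (1 / |Im zeta|)], and [1 - (zeta - w) ^ 2 / rho ^ 2] has modulus
    [2 |Im zeta| / rho] on the circle [|zeta - w| = rho]. So the averages of
    their products over the circle are bounded in norm, and by the mean value
    property in [zeta] they converge pointwise to the value at [zeta = w],
    which is [F / (z - w)]. *)
Lemma real_division F G w : complex.Im w = 0 -> ev F w = 0 -> ev G w <> 0 ->
  exists Q, forall z, ev F z = (z - w) * ev Q z.
Proof.
move=> w0 Fw Gw.
pose g := cabs (ev G w).
have g0 : 0 < g by rewrite cabs_gt0; apply/eqP.
have g20 : 0 < g / 2 by rewrite divr_gt0.
have [d1 d10 h1] := (cont_cabsP _ _).1 (hol_cont (@ev_hol _ _ _ HdB G w)) _ g20.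
have [d2 d20 h2] := (cont_cabsP _ _).1 (hol_cont (@ev_hol _ _ _ HdB F w)) _ (@ltr01 R).
pose rho : R := Num.min d1 d2 / 2.
have m0 : 0 < Num.min d1 d2 by rewrite lt_min d10.
have rho0 : 0 < rho by rewrite divr_gt0.
have [rd1 rd2] : rho < d1 /\ rho < d2.
  have : rho < Num.min d1 d2 by rewrite ltr_pdivrMr// ltr_pMr// ltr1n.
  by rewrite lt_min => /andP.
have Gz z : cabs (z - w) <= rho -> g / 2 <= cabs (ev G z).
  move=> zr; have := h1 z (le_lt_trans zr rd1).
  by have := ler_dist_cabs (ev G w) (ev G z); rewrite cabsB -/g ler_norml; lra.
have Gz0 z : cabs (z - w) <= rho -> ev G z != 0.
  by move=> /Gz h; rewrite -cabs_gt0 (lt_le_trans g20).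
have Fz z : cabs (z - w) <= rho -> cabs (ev F z) <= 1.
  by move=> zr; have := h2 z (le_lt_trans zr rd2); rewrite Fw subr0 => /ltW.
pose wt (z : C) : C := 1 - (z - w) ^+ 2 / (rho ^+ 2)%:C.
have rc0 : (rho ^+ 2)%:C != 0 :> C by rewrite realC_eq0 expf_neq0// gt_eqF.
have wtE z : cabs (z - w) = rho -> cabs (wt z) = 2 * `|complex.Im z| / rho.
  move=> zr; pose b := complex.Im z; pose a := complex.Re (z - w).
  have bE : complex.Im (z - w) = b by rewrite cImD cImN w0 subr0.
  have r2 : rho ^+ 2 = a ^+ 2 + b ^+ 2 by rewrite -zr cabs_sqr bE.
  have -> : wt z = ((2 * b)%:C * (b +i* (- a))) / (rho ^+ 2)%:C.
    rewrite /wt; apply: (mulIf rc0); rewrite mulrBl !divfK// mul1r.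
    rewrite r2; have -> : z - w = a +i* b by apply: Cext.
    by rewrite expr2; apply: Cext => /=; ring.
  have nba : cabs (b +i* (- a) : C) = rho.
    by rewrite cabsE/= sqrrN addrC -r2 sqrtr_sqr gtr0_norm.
  rewrite cabs_div cabsM nba !cabs_real normrM normrX (gtr0_norm rho0) normr_nat.
  by field; rewrite gt_eqF.
pose M := 2 / rho * (nrm F + 2 / g * nrm G).
have M0 : 0 <= M.
  apply: mulr_ge0; first by rewrite divr_ge0// ltW.
  apply: addr_ge0; first exact: nrm_ge0.
  by apply: mulr_ge0; [rewrite divr_ge0// ltW|exact: nrm_ge0].
pose phi v z := wt z * ((ev F v - ev F z / ev G z * ev G v) / (v - z)).
have node : forall z : C, exists f : H, cabs (z - w) = rho ->
    (forall v, v <> z -> ev f v = phi v z) /\ nrm f <= M.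
  move=> z.
  have [zr|nzr] := pselect (cabs (z - w) = rho); last by exists 0 => /nzr.
  have zr' : cabs (z - w) <= rho by rewrite zr.
  have [z0|z0] := eqVneq (complex.Im z) 0.
    exists 0 => _; split=> [v _|]; last by rewrite nrm0.
    have -> : phi v z = 0; last by rewrite ev0.
    suff wt0 : wt z = 0 by rewrite /phi wt0 mul0r.
    by apply/eqP; rewrite -cabs_eq0 wtE// z0 normr0 mulr0 mul0r.
  pose k := F - (ev F z / ev G z) *: G.
  have kz : ev k z = 0 by rewrite /k evB evZ divfK ?subrr ?Gz0.
  have [f ef nf] := nonreal_division z0 kz.
  exists (wt z *: f) => _; split=> [v vz|].
    by rewrite evZ ef// /phi /k evB evZ.
  rewrite nrmZ wtE//.
  have n0 : 0 < `|complex.Im z| by rewrite normr_gt0.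
  have nk : nrm k <= nrm F + 2 / g * nrm G.
    rewrite /k (le_trans (nrmD _ _))// nrmN nrmZ lerD2l ler_wpM2r ?nrm_ge0//.
    rewrite cabs_div ler_pdivrMr ?cabs_gt0 ?Gz0//.
    apply: (le_trans (Fz z zr')); rewrite mulrAC ler_pdivlMr// mul1r.
    by have := Gz z zr'; lra.
  have w0' : 0 <= 2 * `|complex.Im z| / rho by rewrite divr_ge0 ?mulr_ge0// ltW.
  apply: (le_trans (ler_wpM2l w0' nf)).
  have -> : 2 * `|complex.Im z| / rho * (nrm k / `|complex.Im z|) = 2 / rho * nrm k.
    by field; rewrite !gt_eqF.
  by rewrite ler_wpM2l// divr_ge0// ltW.
have {node}[f hf] := choice node.
pose u (n : nat) : H := (n.+1%:R)^-1 *: \sum_(j < n.+1) f (circ w rho (nodes n.+1 0 j)).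
have cr t : cabs (circ w rho t - w) = rho by rewrite cabs_circ// ltW.
have sumM m k : nrm (\sum_(j < k) f (circ w rho (nodes m 0 j))) <= M * k%:R.
  elim: k => [|k ih]; first by rewrite big_ord0 nrm0 mulr0.
  rewrite big_ord_recr/= -natr1 mulrDr mulr1.
  apply: (le_trans (nrmD _ _)); apply: lerD; first exact: ih.
  by have [_] := hf _ (cr (nodes m 0 k)).
have nu n : nrm (u n) <= M.
  rewrite nrmZ cabsV.
  have -> : cabs (n.+1%:R : C) = n.+1%:R by rewrite -(rmorph_nat (real_complex R)) cabs_real ger0_norm.
  by rewrite mulrC ler_pdivrMr ?ltr0n.
have [Q hQ] : exists Q, forall v, [set v | rho < cabs (v - w)] v -> ev Q v = ev F v / (v - w).
  apply: (bounded_pointwise_limit HdB nu) => v /= vr e e0.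
  have vz z : cabs (z - w) <= rho -> v - z != 0.
    by move=> zr; rewrite subr_eq0; apply: contraTneq vr => ->; rewrite -leNgt.
  have dphi z : cabs (z - w) <= rho -> derivable (phi v) z 1.
    move=> zr; apply: (@holM _ wt (fun z => (ev F v - ev F z / ev G z * ev G v) / (v - z))).
      apply: (holB (@hol_cst _ _ _)); apply: (@holM _ (fun z => (z - w) ^+ 2) (fun=> ((rho ^+ 2)%:C)^-1)).
        by apply: holX; exact: (holB (@hol_id _ _) (@hol_cst _ _ _)).
      exact: hol_cst.
    apply: (@hol_div _ (fun z => ev F v - ev F z / ev G z * ev G v) (fun z => v - z)).
    - apply: (holB (@hol_cst _ _ _)).
      apply: (@holM _ (fun z => ev F z / ev G z) (fun=> ev G v)); last exact: hol_cst.
      by apply: (@hol_div _ (ev F) (ev G)); [exact: ev_hol|exact: ev_hol|exact: Gz0].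
    - exact: (holB (@hol_cst _ _ _) (@hol_id _ _)).
    - exact: vz.
  have [N hN] := node_average rho0 dphi e0.
  exists N => n Nn; have := hN n.+1 (leq_ltn_trans Nn (ltnSn n)).
  have -> : phi v w = ev F v / (v - w).
    by rewrite /phi /wt subrr expr0n/= mul0r subr0 mul1r Fw mul0r mul0r subr0.
  rewrite cabsB /u evZ ev_sum /rsum.
  set s1 := \sum_(_ <- _ | _) _; set s2 := \sum_(_ <- _ | _) _.
  suff -> : s1 = s2 by [].
  apply: eq_bigr => j _; have [h _] := hf _ (cr (nodes n.+1 0 j)).
  rewrite h// => vE; have := vz (circ w rho (nodes n.+1 0 j)).
  by rewrite cr lexx -vE subrr eqxx => /(_ isT).
exists Q => z.
have [zr|zr] := ltP rho (cabs (z - w)).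
  rewrite hQ// mulrC divfK// -cabs_gt0; exact: lt_trans zr.
(* (z - w) Q - F is entire and vanishes on a circle around the disc *)
pose D v := (v - w) * ev Q v - ev F v.
have r20 : 0 < 2 * rho by rewrite mulr_gt0.
have dD v : derivable D v 1.
  apply: (@holB _ (fun v => (v - w) * ev Q v) (ev F)); last exact: ev_hol.
  apply: (@holM _ (fun v => v - w) (ev Q)); last exact: ev_hol.
  exact: (holB (@hol_id _ _) (@hol_cst _ _ _)).
have := @max_principle_disc R D w (2 * rho) 0 r20 (fun v _ => dD v).
have bD v : cabs (v - w) = 2 * rho -> cabs (D v) <= 0.
  move=> vr; have vr' : rho < cabs (v - w) by rewrite vr ltr_pMl// ltr1n.
  rewrite /D hQ// mulrC divfK ?subrr ?cabs0// -cabs_gt0; exact: lt_trans vr'.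
move=> /(_ bD z); have zr2 : cabs (z - w) <= 2 * rho.
  by apply: (le_trans zr); rewrite ler_peMl ?ler1n// ltW.
move=> /(_ zr2) h; apply/esym/eqP; rewrite -subr_eq0 -cabs_eq0 eq_le cabs_ge0 andbT.
exact: h.
Qed.

End Division.

(** * Elementary properties of the majorant m^flat *)

Section Majorant.
Variable R : realType.
Local Notation C := (Cx R).
Local Notation mu := (@lebesgue_measure R).
Variable H : completeNormedModType C.
Variable ev : {linear H -> (C -> C)}.
Hypothesis HdB : is_deBranges ev.
Variables (D : set C) (m : C -> R).
Hypothesis D_sub : D `<=` @closedUHP R.
Hypothesis m_adm : admissible ev D m.
Implicit Types (F G : H) (z w : C).

Local Notation RR := (Rm ev D m).
Local Notation BB := (Bm ev D m).
Local Notation mb := (mflat ev D m).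

Lemma D_Im z : D z -> 0 <= complex.Im z.
Proof. by move=> /D_sub[/ltW//|/= ->]. Qed.

Lemma m_ge0 z : D z -> 0 <= m z.
Proof. by have [h _ _] := m_adm; exact: h. Qed.

Lemma RmP F : RR F <-> exists2 c : R, 0 < c & forall z, D z ->
  cabs (ev F z) <= c * m z /\ cabs (ev F z^*) <= c * m z.
Proof.
by split=> -[c c0 h]; exists c => // z /h; rewrite cabs_sharp.
Qed.

Lemma BmP F : BB F <-> nrm F <= 1 /\ forall z, D z ->
  cabs (ev F z) <= m z /\ cabs (ev F z^*) <= m z.
Proof.
split=> -[n1 h]; split.
- by rewrite -lecR -nrmE.
- by move=> z /h; rewrite cabs_sharp.
- by rewrite nrmE; move: n1; rewrite -lecR.
- by move=> z /h; rewrite cabs_sharp.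
Qed.

Lemma Rm0 : RR 0.
Proof.
apply/RmP; exists 1 => // z Dz; rewrite !ev0 cabs0 mul1r.
by split; exact: m_ge0.
Qed.

Lemma RmD F G : RR F -> RR G -> RR (F + G).
Proof.
move=> /RmP[c c0 hF] /RmP[d d0 hG]; apply/RmP; exists (c + d); first exact: addr_gt0.
move=> z Dz; have [f1 f2] := hF z Dz; have [g1 g2] := hG z Dz.
by rewrite !evD mulrDl; split; apply: (le_trans (ler_cabsD _ _)); exact: lerD.
Qed.

Lemma RmZ k F : RR F -> RR (k *: F).
Proof.
move=> /RmP[c c0 hF]; apply/RmP; exists ((cabs k + 1) * c).
  by rewrite mulr_gt0// ltr_wpDl// cabs_ge0.
move=> z Dz; have [f1 f2] := hF z Dz; rewrite !evZ !cabsM -!mulrA.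
have k1 : cabs k <= cabs k + 1 by rewrite lerDl.
by split; rewrite ler_pM ?cabs_ge0.
Qed.

Lemma Rm_sharp F : RR F -> exists2 G, RR G & ev G = sharp (ev F).
Proof.
move=> /RmP[c c0 hF]; have [G eG _] := @dB2 R H ev HdB F.
exists G => //; apply/RmP; exists c => // z Dz; have [f1 f2] := hF z Dz.
by rewrite eG !cabs_sharp conj_conj.
Qed.

Lemma Rm_scale F : RR F -> exists2 t : R, 0 < t & BB (t%:C *: F).
Proof.
move=> /RmP[c c0 hF].
have n0 : 0 < nrm F + c by rewrite ltr_wpDl// nrm_ge0.
exists (nrm F + c)^-1; first by rewrite invr_gt0.
have ct : cabs ((nrm F + c)^-1%:C : C) = (nrm F + c)^-1.
  by rewrite cabs_real gtr0_norm// invr_gt0.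
apply/BmP; split.
  by rewrite nrmZ ct ler_pdivrMl// mulr1 lerDl ltW.
move=> z Dz; have [f1 f2] := hF z Dz; rewrite !evZ !cabsM ct.
have h : c * m z <= (nrm F + c) * m z.
  by rewrite ler_wpM2r ?m_ge0// lerDr nrm_ge0.
by split; rewrite ler_pdivrMl//; exact: le_trans h.
Qed.

Lemma Bm0 : BB 0.
Proof.
apply/BmP; rewrite nrm0; split => // z Dz; rewrite !ev0 cabs0.
by split; exact: m_ge0.
Qed.

Lemma mflat_has_sup z : has_sup [set cabs (ev F z) | F in BB].
Proof.
have [K K0 hK] := ev_bounded HdB z.
split; first by exists (cabs (ev 0 z)); exists 0 => //; exact: Bm0.
exists K => _ [F /BmP[n1 _] <-]; apply: (le_trans (hK F)).
by rewrite -[leRHS]mulr1 ler_wpM2l.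
Qed.

Lemma mflat_ge F z : BB F -> cabs (ev F z) <= mb z.
Proof. by move=> BF; apply: sup_upper_bound; [exact: mflat_has_sup|exists F]. Qed.

Lemma mflat_le z (a : R) : (forall F, BB F -> cabs (ev F z) <= a) -> mb z <= a.
Proof.
move=> h; apply: ge_sup; first by case: (mflat_has_sup z).
by move=> _ [F BF <-]; exact: h.
Qed.

Lemma mflat_ge0 z : 0 <= mb z.
Proof. exact: le_trans (cabs_ge0 _) (mflat_ge z Bm0). Qed.

Lemma mflat_le_m z : D z -> mb z <= m z.
Proof. by move=> Dz; apply: mflat_le => F /BmP[_ /(_ z Dz)[]]. Qed.

Lemma mflat_Rm F : RR F -> exists2 c : R, 0 < c & forall z, cabs (ev F z) <= c * mb z.
Proof.
move=> /Rm_scale[t t0 Bt]; exists t^-1; first by rewrite invr_gt0.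
move=> z; have := mflat_ge z Bt.
by rewrite evZ cabsM cabs_real gtr0_norm// ler_pdivlMl.
Qed.

(** The difference quotients of point evaluation at [w] are pointwise bounded
    functionals, because the functions of the space are differentiable at [w];
    so they are uniformly bounded. *)
Lemma ev_lipschitz w : exists2 d : R, 0 < d & exists2 K : R, 0 <= K &
  forall z F, cabs (z - w) < d -> cabs (ev F z - ev F w) <= K * nrm F * cabs (z - w).
Proof.
apply: contrapT => nd.
have /choice[p hp] : forall n : nat, exists z, cabs (z - w) < (n%:R + 1)^-1 /\
    exists F, n%:R * nrm F * cabs (z - w) < cabs (ev F z - ev F w).
  move=> n; apply: contrapT => h; apply: nd.
  exists (n%:R + 1)^-1; first by rewrite invr_gt0 ltr_wpDl.
  exists n%:R => // z F zw; rewrite leNgt; apply/negP => hF.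
  by apply: h; exists z; split => //; exists F.
have [|K K0 hK] := @ev_uniform_boundedness R H ev HdB setT nat p (fun=> w)
  (fun=> 1) (fun n => (p n - w)^-1) I (fun _ _ _ _ => I) (fun _ _ _ => I) (fun _ _ => I).
  move=> F _; have /derivable_cdiffP[c hc] := @ev_hol _ _ _ HdB F w.
  have [d d0 hd] := hc 1 ltr01.
  pose N := Num.truncn d^-1.
  pose T (n : nat) := cabs ((p n - w)^-1 * (ev F (p n) - 1 * ev F w)).
  exists (\sum_(n < N.+1) T n + (cabs c + 1)) => n; rewrite -/(T n).
  have T0 k : 0 <= T k by exact: cabs_ge0.
  have [nN|Nn] := ltnP n N.+1.
    rewrite (bigD1 (Ordinal nN))//= -addrA lerDl addr_ge0//.
      by apply: sumr_ge0.
    by rewrite addr_ge0// cabs_ge0.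
  rewrite (@le_trans _ _ (cabs c + 1))//; last first.
    by rewrite lerDr; apply: sumr_ge0.
  have [pw _] := hp n.
  have pd : cabs (p n - w) < d.
    apply: (lt_le_trans pw); rewrite invf_ple ?posrE ?ltr_wpDl//.
    rewrite ltW// natr1 (lt_le_trans (truncnS_gt _))// ler_nat (leq_trans Nn)//.
  have [pw0|pw0] := eqVneq (p n - w) 0.
    by rewrite /T pw0 invr0 mul0r cabs0 addr_ge0// cabs_ge0.
  rewrite /T mul1r cabsM cabsV ler_pdivrMl ?cabs_gt0//.
  have -> : ev F (p n) - ev F w = (ev F (p n) - ev F w - c * (p n - w)) + c * (p n - w) by ring.
  apply: (le_trans (ler_cabsD _ _)); rewrite cabsM.
  have := hd (p n) pd; rewrite mul1r => h.
  by rewrite [leRHS]mulrDr mulr1 [leRHS]addrC [cabs c * _]mulrC lerD.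
pose n := (Num.truncn K).+1.
have [_ [F hF]] := hp n.
have := hK n F I; apply/negP; rewrite -ltNge mul1r cabsM cabsV.
have [pw0|pw0] := eqVneq (p n - w) 0.
  move: hF; rewrite pw0 cabs0 mulr0.
  by have /eqP := pw0; rewrite subr_eq0 => /eqP ->; rewrite subrr cabs0 ltxx.
rewrite ltr_pdivlMl ?cabs_gt0// mulrC; apply: le_lt_trans hF.
rewrite ler_wpM2r ?cabs_ge0// ler_wpM2r ?nrm_ge0// ltW//.
exact: truncnS_gt.
Qed.

Lemma mflat_continuous : continuous mb.
Proof.
move=> w; have [d d0 [K K0 hK]] := ev_lipschitz w.
have lip z : cabs (z - w) < d -> `|mb z - mb w| <= K * cabs (z - w).
  move=> zw; have E F : BB F -> cabs (ev F z - ev F w) <= K * cabs (z - w).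
    move=> /BmP[n1 _]; apply: (le_trans (hK z F zw)).
    by rewrite ler_wpM2r ?cabs_ge0// -[leRHS]mulr1 ler_wpM2l.
  rewrite ler_norml lerBlDr lerNl opprB lerBlDr; apply/andP; split.
    apply: mflat_le => F BF; have := E F BF; have := mflat_ge z BF.
    have := ler_cabsB (ev F z) (ev F z - ev F w); rewrite opprB addrCA subrr addr0.
    lra.
  apply: mflat_le => F BF; have := E F BF; have := mflat_ge w BF.
  have := ler_cabsD (ev F z - ev F w) (ev F w); rewrite subrK; lra.
move=> A /= /nbhs_ballP[e/= e0 he]; apply/nbhs_cabsP.
exists (Num.min d (e / (K + 1))).
  by rewrite lt_min d0 divr_gt0// ltr_wpDl.
move=> z; rewrite lt_min => /andP[zd ze]; apply: he; rewrite /ball/= distrC.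
apply: (le_lt_trans (lip z zd)).
apply: (@le_lt_trans _ _ ((K + 1) * cabs (z - w))).
  by rewrite ler_wpM2r ?cabs_ge0// lerDl.
by rewrite mulrC -ltr_pdivlMr// ltr_wpDl.
Qed.

(** The zero divisor is the infimum of this set; comparing the sets avoids
    arguments about infima. *)
Definition zexp (D' : set C) (M : C -> R) w : set nat := [set n |
  exists2 U, nbhs w U & (0 < ereal_inf [set (M z / cabs (z - w) ^+ n)%R%:E |
             z in [set z | [/\ U z, D' z & (cabs (z - w) ^+ n)%R <> 0%R]]])%E].

Lemma zexpP D' M w n : zexp D' M w n <-> exists2 c : R, 0 < c & exists2 d : R, 0 < d &
  forall z, D' z -> cabs (z - w) < d -> cabs (z - w) ^+ n != 0 ->
    c * cabs (z - w) ^+ n <= M z.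
Proof.
split=> [[U /nbhs_cabsP[d d0 hU]]|[c c0 [d d0 h]]].
  set S := image _ _ => S0.
  have [c c0 cS] : exists2 c : R, 0 < c & (c%:E <= ereal_inf S)%E.
    case: (ereal_inf S) S0 => [r| |//]; rewrite ?lte_fin.
      by move=> r0; exists r.
    by exists 1; rewrite ?leey.
  exists c => //; exists d => // z Dz zd zn.
  have zn0 : 0 < cabs (z - w) ^+ n by rewrite lt_def zn exprn_ge0 ?cabs_ge0.
  rewrite -ler_pdivlMr// -lee_fin; apply: (le_trans cS); apply: ereal_inf_lbound.
  by exists z => //; split; [exact: hU|by []|exact/eqP].
exists [set z | cabs (z - w) < d]; first exact: near_cabs.
apply: (@lt_le_trans _ _ c%:E); first by rewrite lte_fin.
apply: le_ereal_inf_tmp => _ [z [zd Dz /eqP zn] <-].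
have zn0 : 0 < cabs (z - w) ^+ n by rewrite lt_def zn exprn_ge0 ?cabs_ge0.
by rewrite lee_fin ler_pdivlMr// h.
Qed.

Lemma zdiv_ge0 D' M w : (0 <= zdiv D' M w)%E.
Proof. by apply: le_ereal_inf_tmp => _ [n _ <-]; rewrite lee_fin. Qed.

Lemma zdiv_eq0P D' M w : zdiv D' M w = 0%E <-> zexp D' M w 0%N.
Proof.
split=> [z0|h].
  apply: contrapT => n0; suff : (1%:E <= zdiv D' M w)%E by rewrite z0 lee_fin ler10.
  apply: le_ereal_inf_tmp => _ [[|n] hn <-]; first by case: n0.
  by rewrite lee_fin ler1n.
apply/eqP; rewrite eq_le zdiv_ge0 andbT; apply: ereal_inf_lbound.
by exists 0%N.
Qed.

Lemma m_lower_bound w : complex.Im w != 0 -> exists2 c : R, 0 < c &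
  exists2 d : R, 0 < d & forall z, D z -> cabs (z - w) < d -> c <= m z.
Proof.
move=> w0; have [_ hz _] := m_adm.
have /zdiv_eq0P/zexpP[c c0 [d d0 h]] : zdiv D m w = 0%E.
  apply/eqP; rewrite eq_le zdiv_ge0 andbT leNgt; apply/negP => /hz.
  by move=> h; rewrite h eqxx in w0.
exists c => //; exists d => // z Dz zd.
by have := h z Dz zd; rewrite expr0 mulr1 oner_eq0 => /(_ isT).
Qed.

(** The zero divisor of an admissible majorant is supported by the real line,
    so division by a zero in the upper half-plane stays in [R_m]. *)
Lemma Rm_nonzero w : 0 < complex.Im w -> exists2 F, RR F & ev F w <> 0.
Proof.
move=> w0; have wn : complex.Im w != 0 by rewrite gt_eqF.
apply: (nonreal_common_zero HdB wn Rm_sharp).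
  move=> F RF Fw; have [G eG nG] := blaschke HdB wn Fw.
  exists G => //; have /RmP[c c0 hF] := RF.
  have [b b0 [d1 d10 hb]] := m_lower_bound wn.
  have [d2 d20 hG] := (cont_cabsP _ _).1 (hol_cont (@ev_hol _ _ _ HdB G w)) _ (@ltr01 R).
  pose d := Num.min d1 d2.
  have d0 : 0 < d by rewrite lt_min d10.
  pose k := cabs (w - w^*).
  have k0 : 0 <= k := cabs_ge0 _.
  pose B := cabs (ev G w) + 1.
  have B0 : 0 <= B by rewrite addr_ge0// cabs_ge0.
  pose c' := c * (1 + k / d) + B / b.
  have kd : 0 <= k / d by rewrite divr_ge0// ltW.
  have Bb : 0 <= B / b by rewrite divr_ge0// ltW.
  have cc' : c <= c'.
    by rewrite /c' mulrDr mulr1 -addrA lerDl addr_ge0// mulr_ge0// ltW.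
  apply/RmP; exists c'; first exact: lt_le_trans cc'.
  move=> z Dz; have [f1 f2] := hF z Dz; have m0 := m_ge0 Dz; have z0 := D_Im Dz.
  split.
    have [zd|zd] := ltP (cabs (z - w)) d.
      move: zd; rewrite lt_min => /andP[zd1 zd2].
      have h1 : cabs (ev G z) <= B.
        have := hG z zd2; have := ler_cabsD (ev G z - ev G w) (ev G w).
        by rewrite subrK /B; lra.
      apply: (le_trans h1); apply: (@le_trans _ _ (B / b * m z)).
        by rewrite mulrAC ler_pdivlMr// ler_wpM2l// hb.
      by rewrite ler_wpM2r// /c' lerDr mulr_ge0 ?(ltW c0)// addr_ge0.
    have zw : 0 < cabs (z - w) by exact: lt_le_trans zd.
    have zw' : z <> w by move=> e; rewrite e subrr cabs0 ltxx in zw.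
    rewrite eG// cabsM; apply: (@le_trans _ _ ((1 + k / d) * (c * m z))).
      apply: ler_pM; rewrite ?cabs_ge0// cabs_div ler_pdivrMr//.
      have -> : z - w^* = (z - w) + (w - w^*) by ring.
      apply: (le_trans (ler_cabsD _ _)); rewrite mulrDl mul1r lerD2l -/k.
      by rewrite mulrAC ler_pdivlMr// ler_wpM2l.
    by rewrite mulrA ler_wpM2r// /c' [_ * c]mulrC lerDl.
  have zw' : z^* <> w.
    by move=> e; move: w0; rewrite -e conjE/= oppr_gt0 ltNge z0.
  have zw : 0 < cabs (z^* - w) by rewrite cabs_gt0 subr_eq0; apply/eqP.
  rewrite eG// cabsM.
  apply: (@le_trans _ _ (1 * (c * m z))); last by rewrite mul1r ler_wpM2r.
  apply: ler_pM; rewrite ?cabs_ge0// cabs_div ler_pdivrMr// mul1r.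
  rewrite -ler_sqr ?nnegrE ?cabs_ge0// -subr_ge0.
  have := dist_conj z^* w; rewrite conjE; case: z z0 {Dz f1 f2 m0 zw zw'} => x y /= y0 h.
  have -> : cabs ((x +i* (- y) : C) - w) ^+ 2 = cabs ((x +i* (- y) : C) - w^*) ^+ 2 + 4 * y * complex.Im w.
    by move: h; lra.
  by rewrite addrC addKr !mulr_ge0// ltW.
apply: contrapT => nF; have [_ _] := m_adm; apply.
apply/seteqP; split=> [F RF /=|_ /= ->]; last exact: Rm0.
by apply: contrapT => F0; apply: nF; exists F.
Qed.

Lemma mflat_gt0 w : 0 < complex.Im w -> 0 < mb w.
Proof.
move=> /Rm_nonzero[F /mflat_Rm[c c0 h] /eqP Fw].
have := h w; rewrite leNgt => hw; rewrite lt_def mflat_ge0 andbT.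
by apply: contraNN hw => /eqP ->; rewrite mulr0 cabs_gt0.
Qed.

End Majorant.

(** * Subharmonicity *)

Section Subharmonicity.
Variable R : realType.
Local Notation C := (Cx R).
Local Notation mu := (@lebesgue_measure R).
Variable H : completeNormedModType C.
Variable ev : {linear H -> (C -> C)}.
Hypothesis HdB : is_deBranges ev.
Variables (D : set C) (m : C -> R).
Hypothesis D_sub : D `<=` @closedUHP R.
Hypothesis m_adm : admissible ev D m.
Implicit Types (F G : H) (z w : C).

Local Notation RR := (Rm ev D m).
Local Notation BB := (Bm ev D m).
Local Notation mb := (mflat ev D m).

Lemma lne_mflat_circ a (r t : R) : 0 <= r ->
  (forall z, cabs (z - a) <= r -> UHP z) ->
  lne (mb (circ a r t))%:E = (ln (mb (circ a r t)))%:E.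
Proof.
move=> r0 hU; rewrite lne_EFin//; apply: (mflat_gt0 HdB D_sub m_adm).
by apply: hU; rewrite cabs_circ.
Qed.

Lemma ln_mflat_cont a (r : R) : 0 <= r -> (forall z, cabs (z - a) <= r -> UHP z) ->
  continuous (fun t => ln (mb (circ a r t))).
Proof.
move=> r0 hU t.
have c1 : {for t, continuous (fun t => mb (circ a r t))}.
  apply: (@continuous_comp _ _ _ (circ a r) mb); first exact: circ_cont.
  exact: (mflat_continuous HdB m_adm).
apply: (continuous_comp c1); apply: continuous_ln.
by apply: (mflat_gt0 HdB D_sub m_adm); apply: hU; rewrite cabs_circ.
Qed.

(** Jensen's inequality without zeros or harmonic functions: the product
    [prod_j F (a + omega ^ j z)] over the [n]-th roots of unity [omega ^ j] is
    [F(a) ^ n] at the centre, so [log |F(a)|] is at most the maximum over the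
    circle of the averages of [log |F|] at [n] equidistant nodes; these are
    dominated by averages of the continuous function [log m^flat], which
    converge uniformly to its mean. *)
Lemma mflat_submean F a (r : R) : 0 < r -> (forall z, cabs (z - a) <= r -> UHP z) ->
  BB F -> cabs (ev F a) <=
  expR ((2 * pi)^-1 * \int[mu]_(t in `[0, 2 * pi]) ln (mb (circ a r t))).
Proof.
move=> r0 hU BF.
have p0 : 0 < 2 * pi :> R by rewrite mulr_gt0// pi_gt0.
pose g (t : R) : R := ln (mb (circ a r t)).
pose gC (t : R) : C := (g t)%:C.
have cg := ln_mflat_cont (ltW r0) hU.
have cgC : continuous gC.
  by move=> t; apply: (continuous_comp (cg t)); exact: realC_cont.
have pgC s : gC (s + 2 * pi) = gC s by rewrite /gC /g circ_periodic.
pose I := \int[mu]_(t in `[0, 2 * pi]) g t.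
have main (d : R) : 0 < d -> cabs (ev F a) <= expR ((2 * pi)^-1 * (I + d)).
  move=> d0.
  have [N hN] := rsum_cvg cgC pgC d0.
  pose n := N.+1; have Nn : (N < n)%N by [].
  have n0 : 0 < n%:R :> R by rewrite ltr0n.
  have sumle t : 0 <= t -> \sum_(j < n) g (nodes n t j) <= n%:R * ((2 * pi)^-1 * (I + d)).
    move=> t0; have := hN n t Nn t0 => h.
    have := le_trans (normr_Re_le _) h.
    rewrite cReD cReN cReM/= mul0r subr0 -/I.
    have -> : complex.Re (rsum gC n t) = \sum_(j < n) g (nodes n t j).
      have resum k q : complex.Re (\sum_(j < k) gC (nodes q t j)) =
          \sum_(j < k) g (nodes q t j).
        elim: k => [|k ih]; first by rewrite !big_ord0.
        by rewrite !big_ord_recr/= cReD ih.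
      exact: resum.
    rewrite ler_norml => /andP[+ _]; rewrite lerBrDl -lerBrDr opprK.
    set S := \sum_(j < n) _ => h2.
    have {}h2 : 2 * pi / n%:R * S <= I + d by lra.
    have -> : S = n%:R * ((2 * pi)^-1 * (2 * pi / n%:R * S)).
      have gen (x p s : R) : 0 < x -> 0 < p -> s = x * (p^-1 * (p / x * s)).
        by move=> x0 q0; field; rewrite !gt_eqF.
      exact: gen.
    by rewrite ler_pM2l// ler_pM2l// invr_gt0.
  pose om (j : nat) : C := cos (j%:R * (2 * pi / n%:R)) +i* sin (j%:R * (2 * pi / n%:R)).
  pose P z := \prod_(j < n) ev F (a + om j * z).
  have dP z : derivable P z 1.
    apply: (@hol_prod R _ (index_enum 'I_n) (fun (j : 'I_n) z => ev F (a + om j * z)) z) => j.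
    apply: (@hol_comp _ (ev F) (fun z => a + om j * z)); last exact: ev_hol.
    exact: (holD (@hol_cst _ _ _) (holM (@hol_cst _ _ _) (@hol_id _ _))).
  have P0 : cabs (P 0) = cabs (ev F a) ^+ n.
    rewrite /P (eq_bigr (fun=> ev F a)); last by move=> j _; rewrite mulr0 addr0.
    by rewrite prodr_const card_ord cabsX.
  have : cabs (P 0) <= expR ((2 * pi)^-1 * (I + d)) ^+ n.
    apply: (@mean_value_bound R P 0 r _ r0 (fun z _ => dP z) (hol_cont (dP 0))) => t /andP[t0 _].
    rewrite /P cabs_prod -expRM_natl.
    apply: (@le_trans _ _ (\prod_(j < n) expR (g (nodes n t j)))).
      apply: ler_prod => j _; rewrite cabs_ge0/=.
      have -> : a + om j * circ 0 r t = circ a r (nodes n t j).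
        rewrite /circ add0r /nodes cosD sinD; congr (_ + _).
        by apply: Cext; rewrite /om /= ; ring.
      rewrite /g lnK ?posrE.
        exact: mflat_ge.
      by apply: (mflat_gt0 HdB D_sub m_adm); apply: hU; rewrite cabs_circ// ltW.
    by rewrite -expR_sum ler_expR sumle.
  by rewrite P0 ler_pXn2r// nnegrE ?cabs_ge0 ?expR_ge0.
rewrite leNgt; apply/negP => lt.
have F0 : 0 < cabs (ev F a) by exact: lt_trans (expR_gt0 _) lt.
pose l := ln (cabs (ev F a)); pose q := (2 * pi : R)^-1.
have l1 : q * I < l by rewrite -ltr_expR /l lnK.
have d0 : 0 < (l - q * I) * pi by rewrite mulr_gt0 ?subr_gt0// pi_gt0.
have := main _ d0; rewrite -/q -{1}[cabs (ev F a)]lnK// ler_expR -/l.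
have -> : q * (I + (l - q * I) * pi) = (q * I + l) / 2.
  have gen (p x y : R) : 0 < p ->
      (2 * p)^-1 * (x + (y - (2 * p)^-1 * x) * p) = ((2 * p)^-1 * x + y) / 2.
    by move=> q0; field; rewrite gt_eqF.
  exact: gen (pi_gt0 R).
by lra.
Qed.

Lemma mflat_subharmonic : subharmonic_on (@UHP R) (fun z => lne (mb z)%:E).
Proof.
split.
- by move=> z zU; rewrite lne_EFin ?ltry//; exact: (mflat_gt0 HdB D_sub m_adm).
- move=> z a zU; have mz := mflat_gt0 HdB D_sub m_adm zU.
  rewrite lne_EFin// lte_fin => lz.
  have : mb z < expR a by rewrite -[ltLHS]lnK// ltr_expR.
  move=> ma; have nb : nbhs (mb z) [set s | s < expR a].
    by apply: open_nbhs_nbhs; split => //; exact: open_lt.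
  have /nbhs_cabsP[d d0 hd] := @mflat_continuous _ _ _ HdB _ _ m_adm z _ nb.
  apply/nbhs_cabsP; exists d => // z' /hd /= mz'.
  have [z'0|z'0] := ltP 0 (mb z').
    by rewrite lte_fin -ltr_expR lnK.
  by rewrite ltNyr.
move=> a r r0 hU.
have aU : UHP a by apply: hU; rewrite subrr cabs0 ltW.
have ma := mflat_gt0 HdB D_sub m_adm aU.
rewrite lne_EFin//.
have -> : (\int[mu]_(t in `[0%R, (2 * pi)%R])
    lne (mb (a + (r%:C : C) * (cos t +i* sin t)))%:E)%E =
    (\int[mu]_(t in `[0%R, (2 * pi)%R]) (ln (mb (circ a r t)))%:E)%E.
  by apply: eq_integral => t _; rewrite -(lne_mflat_circ _ (ltW r0) hU).
have ci : {within `[0, 2 * pi], continuous (fun t => ln (mb (circ a r t)))}.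
  by apply: continuous_subspaceT; exact: (ln_mflat_cont (ltW r0) hU).
rewrite -[X in (_ <= _ * X)%E]fineK; last by apply: integrable_fin_num => //; exact: cont_integrable.
rewrite -EFinM lee_fin -ler_expR lnK//.
by apply: (mflat_le HdB m_adm) => F; exact: mflat_submean.
Qed.

End Subharmonicity.

(** * Zero divisors *)

Section ZeroDivisor.
Variable R : realType.
Local Notation C := (Cx R).
Variable H : completeNormedModType C.
Variable ev : {linear H -> (C -> C)}.
Hypothesis HdB : is_deBranges ev.
Hypothesis Hreal : forall x : R, exists F : H, ev F x%:C <> 0.
Variables (D : set C) (m : C -> R).
Hypothesis D_sub : D `<=` @closedUHP R.
Hypothesis m_adm : admissible ev D m.
Implicit Types (F G : H) (z w : C).

Local Notation RR := (Rm ev D m).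
Local Notation BB := (Bm ev D m).
Local Notation mb := (mflat ev D m).

Lemma nonvanishing w : exists F : H, ev F w <> 0.
Proof.
have [w0|w0] := eqVneq (complex.Im w) 0.
  have [F hF] := Hreal (complex.Re w); exists F.
  by have -> : w = (complex.Re w)%:C by apply: Cext.
have [] := @nonreal_common_zero R H ev HdB setT w w0.
- by move=> F _; have [G eG _] := @dB2 R H ev HdB F; exists G.
- by move=> F _ Fw; have [G eG nG] := blaschke HdB w0 Fw; exists G.
- by have [F F0] := dB_neq0 HdB; exists F.
by move=> F _ hF; exists F.
Qed.

Lemma zdivH0 w : zdivH ev w = 0%E.
Proof.
have zm F : (0 <= zmult (ev F) w)%E.
  by apply: le_ereal_inf_tmp => _ [n _ <-]; rewrite lee_fin.
apply/eqP; rewrite eq_le; apply/andP; split; last first.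
  by apply: le_ereal_inf_tmp => _ [F _ <-].
have [F Fw] := nonvanishing w.
apply: (@le_trans _ _ (zmult (ev F) w)); first by apply: ereal_inf_lbound; exists F.
by apply: ereal_inf_lbound; exists 0%N.
Qed.

Lemma zexp_mflat_sub w n : zexp (@closedUHP R) mb w n -> zexp D m w n.
Proof.
move=> /zexpP[c c0 [d d0 h]]; apply/zexpP; exists c => //; exists d => // z Dz zd zn.
by apply: (le_trans (h z (D_sub Dz) zd zn)); exact: (mflat_le_m HdB m_adm).
Qed.

Lemma cont_bound (f : C -> C) w : {for w, continuous f} -> exists2 d : R, 0 < d &
  forall z, cabs (z - w) < d -> cabs (f z) <= cabs (f w) + 1.
Proof.
move=> cf; have [d d0 hd] := (cont_cabsP _ _).1 cf _ (@ltr01 R).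
exists d => // z /hd h; have := ler_cabsD (f z - f w) (f w).
by rewrite subrK; lra.
Qed.

(** An entire function with zeros of all orders at [w] vanishes: the maximum
    principle on discs bounds its quotients by [(z - w) ^ k]. *)
Lemma infinite_order_zero (f : C -> C) w :
  (forall z, derivable f z 1) ->
  (forall k : nat, exists2 g : C -> C, forall z, derivable g z 1 &
     forall z, f z = (z - w) ^+ k * g z) -> forall z, f z = 0.
Proof.
move=> df hf z.
pose rho := 2 * (cabs (z - w) + 1).
have zw0 := cabs_ge0 (z - w).
have rho0 : 0 < rho by rewrite mulr_gt0// ltr_wpDl.
have zr : cabs (z - w) <= rho by rewrite /rho; lra.
pose K := [set z : C | cabs (z - w) <= rho].
have cfK : {within K, continuous (fun z => cabs (f z))}.
  apply: continuous_subspaceT => x.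
  by apply: continuous_comp; [exact: (hol_cont (df x))|exact: cabs_cont].
have [z1 _ max1] := compact_EVT_max (ex_intro K z zr) (@compact_disc R w rho) cfK.
pose M := cabs (f z1).
have fM x : cabs (x - w) <= rho -> cabs (f x) <= M.
  by move=> xr; apply: max1; rewrite inE.
pose q := cabs (z - w) / rho.
have q0 : 0 <= q by rewrite divr_ge0 ?cabs_ge0// ltW.
have q1 : q < 1 by rewrite ltr_pdivrMr// mul1r /rho; lra.
apply/eqP; rewrite -cabs_eq0 eq_le cabs_ge0 andbT.
apply: (cpow_lim0 q0 q1 (cabs_ge0 (f z1))) => k.
have [g dg eg] := hf k.
have bg x : cabs (x - w) = rho -> cabs (g x) <= M / rho ^+ k.
  move=> xr; rewrite ler_pdivlMr ?exprn_gt0// -xr mulrC -cabsX -cabsM -eg.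
  by apply: fM; rewrite xr.
have := @max_principle_disc R g w rho _ rho0 (fun x _ => dg x) bg z zr.
move=> h; rewrite eg cabsM cabsX /q expr_div_n [leRHS]mulrCA.
by rewrite ler_wpM2l ?exprn_ge0 ?cabs_ge0.
Qed.

Section RealPoint.
Variables (w : C) (n : nat).
Hypothesis w_real : complex.Im w = 0.
Hypothesis wn : zexp D m w n.

(** If [F = (z - w) ^ (n + 1) Q], then [F / (z - w)] is again dominated by [m]:
    near [w] because it is [O (|z - w| ^ n)], elsewhere because [F] is. *)
Lemma Rm_real_division F (Q1 Q : H) : RR F -> (forall z, ev F z = (z - w) * ev Q1 z) ->
  (forall z, ev Q1 z = (z - w) ^+ n * ev Q z) -> RR Q1.
Proof.
move=> /RmP[c c0 hF] e1 e2.
have [b b0 [d1 d10 hb]] := (zexpP _ _ _ _).1 wn.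
have [d2 d20 hQ] := cont_bound (hol_cont (@ev_hol _ _ _ HdB Q w)).
pose d := Num.min d1 d2; have d0 : 0 < d by rewrite lt_min d10.
pose B := cabs (ev Q w) + 1.
have B0 : 0 <= B by rewrite addr_ge0// cabs_ge0.
have Bb : 0 <= B / b by rewrite divr_ge0// ltW.
have cd : 0 < c / d by rewrite divr_gt0.
apply/RmP; exists (B / b + c / d); first by rewrite ltr_wpDl.
have est z x : D z -> cabs (x - w) = cabs (z - w) -> cabs (ev F x) <= c * m z ->
    cabs (ev Q1 x) <= (B / b + c / d) * m z.
  move=> Dz xz Fx; have mz := m_ge0 m_adm Dz.
  have [xd|xd] := ltP (cabs (x - w)) d.
    move: xd; rewrite lt_min => /andP[xd1 xd2].
    apply: (@le_trans _ _ (B / b * m z)); last by rewrite ler_wpM2r// lerDl ltW.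
    rewrite e2 cabsM cabsX.
    have [x0|x0] := eqVneq (cabs (x - w) ^+ n) 0.
      by rewrite x0 mul0r mulr_ge0.
    have := hb z Dz; rewrite -xz => /(_ xd1 x0) h.
    apply: (@le_trans _ _ (cabs (x - w) ^+ n * B)).
      by rewrite ler_wpM2l ?exprn_ge0 ?cabs_ge0// hQ.
    by rewrite mulrC -!mulrA ler_wpM2l// mulrC ler_pdivlMr// mulrC.
  apply: (@le_trans _ _ (c / d * m z)); last by rewrite ler_wpM2r// lerDr.
  have x0 : 0 < cabs (x - w) by exact: lt_le_trans xd.
  move: Fx; rewrite e1 cabsM => h.
  rewrite mulrAC ler_pdivlMr//; apply: le_trans h.
  by rewrite mulrC ler_wpM2r ?cabs_ge0.
move=> z Dz; have [f1 f2] := hF z Dz; split; first exact: est.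
apply: est => //; rewrite -(cabs_conj (z - w)); congr cabs.
by rewrite !conjE cReD cImD cReN cImN w_real; apply: Cext; rewrite ?cReD ?cImD ?cReN ?cImN/= ?w_real; ring.
Qed.

(** Otherwise every [F] in [R_m] could be divided by [(z - w) ^ (n + 1)] within
    the space, so that [F / (z - w)] would be in [R_m] again; repeating this,
    every [F] in [R_m] would have a zero of infinite order at [w]. *)
Lemma Rm_low_order : exists2 F, RR F & exists j : nat, exists2 Q : H, (j <= n)%N &
  ev Q w <> 0 /\ forall z, ev F z = (z - w) ^+ j * ev Q z.
Proof.
apply: contrapT => h.
have [G Gw] := nonvanishing w.
have step F j Q : RR F -> (j <= n)%N -> (forall z, ev F z = (z - w) ^+ j * ev Q z) ->
    exists Q', forall z, ev Q z = (z - w) * ev Q' z.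
  move=> RF jn eF; apply: (real_division HdB w_real _ Gw).
  apply: contrapT => Qw; apply: h; exists F => //; exists j; exists Q => //.
have div F : RR F -> exists2 Q1, RR Q1 & forall z, ev F z = (z - w) * ev Q1 z.
  move=> RF.
  have [Q1 eQ1] : exists Q', forall z, ev F z = (z - w) * ev Q' z.
    by apply: (step F 0%N F RF) => // z; rewrite expr0 mul1r.
  exists Q1 => //.
  have [Q eQ] : exists Q, forall z, ev Q1 z = (z - w) ^+ n * ev Q z.
    have : (n <= n)%N by [].
    elim: {1 3}n => [|k ih] kn; first by exists Q1 => z; rewrite expr0 mul1r.
    have [Q eQ] := ih (ltnW kn).
    have [z|Q' eQ'] := step F k.+1 Q RF kn; first by rewrite eQ1 eQ exprS mulrA.
    by exists Q' => z; rewrite eQ eQ' exprSr mulrA.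
  exact: Rm_real_division RF eQ1 eQ.
have iter F (k : nat) : RR F -> exists2 Q, RR Q & forall z, ev F z = (z - w) ^+ k * ev Q z.
  move=> RF; elim: k => [|k [Q RQ eQ]].
    by exists F => // z; rewrite expr0 mul1r.
  have [Q' RQ' eQ'] := div Q RQ.
  by exists Q' => // z; rewrite eQ eQ' exprSr mulrA.
have [_ _] := m_adm; apply; apply/seteqP; split => [F RF /=|_ /= ->]; last exact: (Rm0 m_adm).
apply: (@dB_inj R H ev HdB); apply/funext => z; rewrite ev0.
apply: (@infinite_order_zero (ev F) w) => [x|k]; first exact: ev_hol.
by have [Q _ eQ] := iter F k RF; exists (ev Q) => // x; exact: ev_hol.
Qed.

Lemma zexp_real : zexp (@closedUHP R) mb w n.
Proof.
have [F RF [j [Q jn [Qw eF]]]] := Rm_low_order.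
have [c c0 hc] := mflat_Rm HdB m_adm RF.
pose q := cabs (ev Q w).
have q0 : 0 < q by rewrite cabs_gt0; apply/eqP.
have q20 : 0 < q / 2 by rewrite divr_gt0.
have [d d0 hd] := (cont_cabsP _ _).1 (hol_cont (@ev_hol _ _ _ HdB Q w)) _ q20.
apply/zexpP; exists (q / 2 / c); first by rewrite divr_gt0.
exists (Num.min d 1); first by rewrite lt_min d0 ltr01.
move=> z _; rewrite lt_min => /andP[zd z1] _.
have Qz : q / 2 <= cabs (ev Q z).
  have := hd z zd; have := ler_cabsB (ev Q z) (ev Q z - ev Q w).
  by rewrite opprB addrCA subrr addr0 -/q; lra.
rewrite mulrAC ler_pdivrMr// [leRHS]mulrC; apply: le_trans (hc z).
rewrite eF cabsM cabsX mulrC ler_pM ?exprn_ge0 ?cabs_ge0//.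
  exact: ltW.
by rewrite ler_wiXn2l ?cabs_ge0// ltW.
Qed.

End RealPoint.

Lemma zdiv_mflat w : zdiv (@closedUHP R) mb w = maxe (zdiv D m w) (zdivH ev w).
Proof.
rewrite zdivH0 max_l ?zdiv_ge0//.
have [w0|w0] := eqVneq (complex.Im w) 0.
  suff E : zexp (@closedUHP R) mb w = zexp D m w.
    by rewrite /zdiv -[X in ereal_inf [set _ | n in X]]/(zexp (@closedUHP R) mb w) E.
  by apply/seteqP; split => n; [exact: zexp_mflat_sub|exact: zexp_real].
have -> : zdiv D m w = 0%E.
  have [_ hz _] := m_adm; apply/eqP; rewrite eq_le zdiv_ge0 andbT leNgt.
  by apply/negP => /hz h; rewrite h eqxx in w0.
apply/zdiv_eq0P/zexpP.
have [w1|w1] := ltP 0 (complex.Im w).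
  have mw := mflat_gt0 HdB D_sub m_adm w1.
  have nb : nbhs (mb w) [set s | mb w / 2 < s].
    apply: open_nbhs_nbhs; split; first exact: open_gt.
    by rewrite /= ltr_pdivrMr// ltr_pMr// ltr1n.
  have /nbhs_cabsP[d d0 hd] := @mflat_continuous _ _ _ HdB _ _ m_adm w _ nb.
  exists (mb w / 2); first by rewrite divr_gt0.
  by exists d => // z _ zd _; rewrite expr0 mulr1 ltW//; exact: hd.
exists 1 => //; exists (- complex.Im w).
  by rewrite oppr_gt0 lt_neqAle w0.
move=> z Uz zd _; exfalso.
have z0 : 0 <= complex.Im z by case: Uz => [/ltW//|/= ->].
have := le_lt_trans (normr_Im_le _) zd.
rewrite cImD cImN ger0_norm; last by rewrite subr_ge0 (le_trans w1).
lra.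
Qed.

End ZeroDivisor.

(** * Mean type *)

Section MeanType.
Variable R : realType.
Local Notation C := (Cx R).
Variable H : completeNormedModType C.
Variable ev : {linear H -> (C -> C)}.
Hypothesis HdB : is_deBranges ev.
Variables (D : set C) (m : C -> R).
Hypothesis D_sub : D `<=` @closedUHP R.
Hypothesis m_adm : admissible ev D m.
Variable E : C -> C.
Hypothesis E_HB : hermite_biehler E.
Hypothesis E_H : is_HE ev E.
Implicit Types (F G : H) (z w : C).

Local Notation RR := (Rm ev D m).
Local Notation LL := (clRm ev D m).
Local Notation BB := (Bm ev D m).
Local Notation mb := (mflat ev D m).
Local Notation iy y := (0 +i* y : C).

Lemma E_neq0 z : 0 < complex.Im z -> E z != 0.
Proof.
move=> z0; have [_ h] := E_HB; rewrite -cabs_gt0.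
by apply: le_lt_trans (h z z0); exact: cabs_ge0.
Qed.

Lemma E_hol z : derivable E z 1.
Proof. by have [h _] := E_HB; exact: h. Qed.

Lemma lee_below (x y : \bar R) : (forall t : R, (x < t%:E)%E -> (y <= t%:E)%E) -> (y <= x)%E.
Proof.
case: x => [r| |] h.
- by apply/lee_addgt0Pr => e e0; rewrite -EFinD; apply: h; rewrite lte_fin ltrDl.
- by rewrite leey.
- case: y h => [s| |] h //.
    have := h (s - 1) (ltNyr _); rewrite lee_fin leNgt => /negP[].
    by rewrite ltrBlDr ltrDl.
  by have := h 0 (ltNyr _).
Qed.

Lemma mt_le (f : C -> R) (t A : R) (y0 : R) : 0 < A ->
  (forall y, y0 <= y -> f (iy y) / cabs (E (iy y)) <= A * expR (t * y)) ->
  (mt E f <= t%:E)%E.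
Proof.
move=> A0 h; apply/lee_addgt0Pr => e e0; rewrite -EFinD.
pose y1 := Num.max (Num.max 1 y0) (ln A / e).
apply: (@le_trans _ _ (ereal_sup [set ((y^-1)%:E * lne (f (iy y) / cabs (E (iy y)))%R%:E)%E |
    y in [set y | y1 < y]])).
  apply: ereal_inf_lbound; exists [set y | y1 < y] => //.
  by exists y1; split => //; exact: num_real.
apply: ge_ereal_sup => _ [y /= y1y <-].
move: y1y; rewrite !gt_max => /andP[/andP[y11 y10] yA].
have yp : 0 < y by exact: lt_trans y11.
have hy := h y (ltW y10).
rewrite lee_pdivrMl//.
have [x0|x0] := ltP 0 (f (iy y) / cabs (E (iy y))); last first.
  by rewrite leNye.
rewrite -EFinM lee_fin -ler_expR lnK//.
apply: (le_trans hy); rewrite -[X in X * _](lnK A0) -expRD ler_expR.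
rewrite mulrDr addrC [y * t]mulrC lerD2l.
by rewrite -ler_pdivrMr// ltW.
Qed.

Lemma mt_lt (f : C -> R) (t : R) : (mt E f < t%:E)%E ->
  exists y0 : R, forall y, y0 <= y -> 0 < y -> f (iy y) / cabs (E (iy y)) <= expR (t * y).
Proof.
move=> /ereal_inf_lt[_ [V [M [_ MV]] <-] Vt].
exists (M + 1) => y My y0.
have Vy : V y by apply: MV; rewrite (lt_le_trans _ My)// ltrDl.
have := @ereal_sup_ubound _ ((fun y : R => ((y^-1)%:E * lne (f (iy y) / cabs (E (iy y)))%R%:E)%E) @` V).
move=> /(_ _ (ex_intro2 _ _ y Vy erefl)) => h.
have := le_lt_trans h Vt.
have [x0|x0 _] := ltP 0 (f (iy y) / cabs (E (iy y))); last first.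
  by apply: (le_trans x0); exact: expR_ge0.
rewrite lne_EFin// -EFinM lte_fin ltr_pdivrMl// => h2.
by rewrite -[leLHS]lnK// ler_expR [t * y]mulrC ltW.
Qed.

Lemma clRm0 : LL 0.
Proof. by apply: subset_closure; exact: (Rm0 m_adm). Qed.

Lemma clRmD F G : LL F -> LL G -> LL (F + G).
Proof.
move=> /closure_nrmP hF /closure_nrmP hG; apply/closure_nrmP => e e0.
have e20 : 0 < e / 2 by rewrite divr_gt0.
have [F' RF hF'] := hF _ e20; have [G' RG hG'] := hG _ e20.
exists (F' + G'); first exact: RmD.
have -> : F' + G' - (F + G) = (F' - F) + (G' - G) by rewrite opprD addrACA.
by rewrite [e]splitr (le_lt_trans (nrmD _ _))// ltrD.
Qed.

Lemma clRmZ k F : LL F -> LL (k *: F).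
Proof.
move=> /closure_nrmP hF; apply/closure_nrmP => e e0.
have k0 : 0 < cabs k + 1 by rewrite ltr_wpDl// cabs_ge0.
have [F' RF hF'] := hF _ (divr_gt0 e0 k0).
exists (k *: F'); first exact: RmZ.
rewrite -scalerBr nrmZ; apply: (@le_lt_trans _ _ ((cabs k + 1) * nrm (F' - F))).
  by rewrite ler_wpM2r ?nrm_ge0// lerDl.
by rewrite mulrC -ltr_pdivlMr.
Qed.

Lemma clRm_closed : closure LL `<=` LL.
Proof.
have e : LL = closure LL by apply/closure_id; exact: closed_closure.
by move=> F; rewrite -e.
Qed.

(** The functionals [F -> F (i y) / (E (i y) exp (t y))], [y >= 1], are
    pointwise bounded on the closure of [R_m] as soon as [t] exceeds its mean
    type, hence uniformly bounded. *)
Lemma mt_mflat_le : (mt E mb <= mt_sub ev E LL)%E.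
Proof.
apply: lee_below => t ht.
pose c (y : R) : C := if 1 <= y then (E (iy y) * cexp (- 'i * t%:C * iy y))^-1 else 0.
have aexp (y : R) : cabs (cexp (- 'i * t%:C * iy y)) = expR (t * y).
  by rewrite cabs_cexp; congr expR; rewrite !cReM !cImM/=; ring.
have [|K K0 hK] := @ev_uniform_boundedness R H ev HdB LL R (fun y => iy y) (fun=> 0)
  (fun=> 0) c clRm0 clRmD clRmZ clRm_closed.
  move=> F LF.
  have mtF : (mt E (fun z => cabs (ev F z)) < t%:E)%E.
    by apply: le_lt_trans ht; apply: ereal_sup_ubound; exists F.
  have [y0 hy0] := mt_lt mtF.
  pose f (y : R) := cabs (ev F (iy y) / (E (iy y) * cexp (- 'i * t%:C * iy y))).
  pose b := Num.max 1 y0.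
  have b1 : 1 <= b by rewrite le_max lexx.
  have cf : {within `[1, b], continuous f}.
    apply: continuous_in_subspaceT => y; rewrite inE/= in_itv/= => /andP[y1 _].
    have yp : 0 < y by exact: lt_le_trans y1.
    have ciy : {for y, continuous (fun y => iy y)}.
      by apply: cvg_complex; [exact: cvg_cst|exact: cvg_id].
    pose g z := ev F z / (E z * cexp (- 'i * t%:C * z)).
    apply: (@continuous_comp _ _ _ (fun y => iy y) (fun z => cabs (g z)) y ciy).
    apply: continuous_comp; last exact: cabs_cont.
    apply: hol_cont; apply: (@hol_div _ (ev F) (fun z => E z * cexp (- 'i * t%:C * z))).
    - exact: ev_hol.
    - apply: (@holM _ E (fun z => cexp (- 'i * t%:C * z))); first exact: E_hol.
      apply: (@hol_comp _ (@cexp R) (fun z => - 'i * t%:C * z)); last exact: cexp_hol.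
      exact: (holM (@hol_cst _ _ _) (@hol_id _ _)).
    - rewrite mulf_neq0 ?E_neq0// -cabs_gt0 cabs_cexp; exact: expR_gt0.
  have b0 : `[1, b]%classic (1 : R) by rewrite /= in_itv/= lexx b1.
  have [y1 _ max1] := compact_EVT_max (ex_intro _ 1 b0) (@segment_compact R 1 b) cf.
  exists (Num.max 1 (f y1)) => y; rewrite /c mul0r subr0.
  case: ifPn => [y1'|_]; last by rewrite mul0r cabs0 le_max ler01.
  rewrite mulrC -/(f y) le_max; have [yb|/ltW yb] := leP y b.
    by apply/orP; right; apply: max1; rewrite inE/= in_itv/= y1'.
  have yp : 0 < y by exact: lt_le_trans y1'.
  have Ey : 0 < cabs (E (iy y)) by rewrite cabs_gt0 E_neq0.
  apply/orP; left; rewrite /f invfM mulrA cabsM cabs_div cabsV aexp.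
  rewrite ler_pdivrMr ?expR_gt0// mul1r; apply: hy0 => //.
  by apply: le_trans yb; rewrite le_max lexx orbT.
apply: (@mt_le mb t (K + 1) 1); first by rewrite ltr_wpDl.
move=> y y1; have yp : 0 < y by exact: lt_le_trans y1.
have Ey : 0 < cabs (E (iy y)) by rewrite cabs_gt0 E_neq0.
rewrite ler_pdivrMr//; apply: (mflat_le HdB m_adm) => F BF.
have RF : RR F.
  have [_ h] := BF; exists 1 => // z Dz; rewrite mul1r; exact: h.
have LF : LL F by exact: subset_closure.
have nF : nrm F <= 1 by case/BmP : BF.
have := hK y F LF; rewrite /c y1 mul0r subr0 cabsM cabsV cabsM aexp => h.
rewrite ler_pdivrMl ?mulr_gt0 ?expR_gt0// in h.
apply: (le_trans h).
have -> : (K + 1) * expR (t * y) * cabs (E (iy y)) =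
  cabs (E (iy y)) * expR (t * y) * (K + 1) by ring.
rewrite ler_wpM2l ?mulr_ge0 ?expR_ge0 ?cabs_ge0//.
by apply: (@le_trans _ _ (K * 1)); [rewrite ler_wpM2l|rewrite mulr1 lerDl].
Qed.

(** For a single [F] the quotient [F / E] is bounded because it lies in the
    Hardy space; uniform boundedness turns this into a bound in terms of the
    norm of [F]. *)
Lemma quotient_bound : exists2 K : R, 0 <= K & forall F z, 1 <= complex.Im z ->
  cabs (ev F z / E z) <= K * nrm F.
Proof.
pose c z : C := if 1 <= complex.Im z then (E z)^-1 else 0.
have [|K K0 hK] := @ev_uniform_boundedness R H ev HdB setT C (fun z => z) (fun=> 0)
  (fun=> 0) c I (fun _ _ _ _ => I) (fun _ _ _ => I) (fun _ _ => I).
  move=> F _; have [rev _] := E_H.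
  have [_ hh _] : HE E (ev F) by rewrite -rev; exists F.
  have [B hB] := hardy2_bounded hh; exists (Num.max 0 B) => z.
  rewrite /c mul0r subr0 le_max; case: ifPn => [z1|_]; last by rewrite mul0r cabs0 lexx.
  by apply/orP; right; rewrite mulrC; exact: hB.
exists K => // F z z1; have := hK z F I.
by rewrite /c z1 mul0r subr0 mulrC.
Qed.

(** A growth estimate on the imaginary axis that holds up to a constant
    depending on [G] improves, by the Phragmen-Lindelof principle, to one
    with the constant [K nrm G], and so passes to limits in the norm. *)
Lemma mt_clRm_le : (mt_sub ev E LL <= mt E mb)%E.
Proof.
apply: ge_ereal_sup => _ [F LF <-]; apply: lee_below => t ht.
have [y0 hy0] := mt_lt ht.
have [K K0 hK] := quotient_bound.
have est G y : RR G -> 1 <= y -> cabs (ev G (iy y) / E (iy y)) <= K * nrm G * expR (t * (y - 1)).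
  move=> RG y1.
  have [c c0 hc] := mflat_Rm HdB m_adm RG.
  pose Phi z := ev G (z + 'i) / E (z + 'i) * cexp ('i * t%:C * z).
  have KG : 0 <= K * nrm G by rewrite mulr_ge0// nrm_ge0.
  have Imi z : complex.Im (z + 'i) = complex.Im z + 1 by rewrite cImD.
  have Im1 z : 0 <= complex.Im z -> 1 <= complex.Im (z + 'i) by rewrite Imi lerDr.
  have aexp z : cabs (cexp ('i * t%:C * z)) = expR (- (t * complex.Im z)).
    by rewrite cabs_cexp; congr expR; rewrite !cReM !cImM/=; ring.
  have Phib z : 0 <= complex.Im z -> cabs (Phi z) <= K * nrm G * expR (- (t * complex.Im z)).
    move=> z0; rewrite /Phi cabsM aexp ler_wpM2r ?expR_ge0//.
    by apply: hK; exact: Im1.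
  pose Y := Num.max y0 1.
  pose B' := Num.max (c * expR t) (K * nrm G * expR (`|t| * Y)).
  have := @PL_halfplane R Phi (K * nrm G) (K * nrm G) B' `|t|.
  have H1 z : 0 <= complex.Im z -> derivable Phi z 1.
    move=> z0.
    have dz : derivable (fun z => z + 'i) z 1 by exact: (holD (@hol_id _ _) (@hol_cst _ _ _)).
    apply: (@holM _ (fun z => ev G (z + 'i) / E (z + 'i)) (fun z => cexp ('i * t%:C * z))).
      apply: (@hol_div _ (fun z => ev G (z + 'i)) (fun z => E (z + 'i))).
      - by apply: (@hol_comp _ (ev G) (fun z => z + 'i) z dz); exact: ev_hol.
      - by apply: (@hol_comp _ E (fun z => z + 'i) z dz); exact: E_hol.
      - by apply: E_neq0; rewrite Imi ltr_wpDl.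
    apply: (@hol_comp _ (@cexp R) (fun z => 'i * t%:C * z)); last exact: cexp_hol.
    exact: (holM (@hol_cst _ _ _) (@hol_id _ _)).
  have H2 z : 0 <= complex.Im z -> cabs (Phi z) <= K * nrm G * expR (`|t| * cabs z).
    move=> z0; apply: (le_trans (Phib z z0)); rewrite ler_wpM2l// ler_expR.
    apply: (le_trans (ler_norm _)); rewrite normrN normrM ler_wpM2l//.
    exact: normr_Im_le.
  have H3 z : complex.Im z = 0 -> cabs (Phi z) <= K * nrm G.
    by move=> z0; have := Phib z; rewrite z0 lexx mulr0 oppr0 expR0 mulr1; apply.
  have H4 z : 0 <= complex.Im z -> complex.Re z = 0 -> cabs (Phi z) <= B'.
    move=> z0 z1; rewrite le_max.
    have zi : z + 'i = iy (complex.Im z + 1).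
      by apply: Cext; rewrite ?cReD ?cImD/= ?z1 ?addr0.
    have [zY|zY] := leP Y (complex.Im z + 1).
      apply/orP; left; rewrite /Phi zi cabsM aexp cabs_div.
      have p1 : 0 < complex.Im z + 1 by rewrite ltr_wpDl.
      have Ey : 0 < cabs (E (iy (complex.Im z + 1))) by rewrite cabs_gt0 E_neq0.
      have y0Y : y0 <= complex.Im z + 1 by apply: le_trans zY; rewrite le_max lexx.
      rewrite expRN ler_pdivrMr ?expR_gt0// -mulrA -expRD.
      have -> : t + t * complex.Im z = t * (complex.Im z + 1) by ring.
      apply: (@le_trans _ _ (c * (mb (iy (complex.Im z + 1)) / cabs (E (iy (complex.Im z + 1)))))).
        by rewrite mulrA ler_pM2r ?invr_gt0.
      by rewrite ler_pM2l// hy0.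
    apply/orP; right; apply: (le_trans (Phib z z0)); rewrite ler_wpM2l// ler_expR.
    apply: (le_trans (ler_norm _)); rewrite normrN normrM ler_wpM2l//.
    by rewrite ger0_norm//; lra.
  move=> /(_ H1 (normr_ge0 _) KG H2 H3 H4 (iy (y - 1))).
  rewrite /= subr_ge0 => /(_ y1); rewrite /Phi cabsM aexp/=.
  have -> : iy (y - 1) + 'i = iy y by apply: Cext => /=; ring.
  by rewrite expRN ler_pdivrMr ?expR_gt0.
have estF y : 1 <= y -> cabs (ev F (iy y) / E (iy y)) <= K * nrm F * expR (t * (y - 1)).
  move=> y1; have yp : 0 < y by exact: lt_le_trans y1.
  apply/ler_addgt0Pl => e e0.
  have S0 : 0 < K * expR (t * (y - 1)) + K + 1.
    by rewrite ltr_wpDl// addr_ge0// mulr_ge0// expR_ge0.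
  have /closure_nrmP/(_ _ (divr_gt0 e0 S0))[G RG GF] := LF.
  have -> : ev F (iy y) / E (iy y) = ev G (iy y) / E (iy y) - ev (G - F) (iy y) / E (iy y).
    by rewrite evB; ring.
  apply: (le_trans (ler_cabsB _ _)); apply: (le_trans (lerD (est G y RG y1) (hK (G - F) (iy y) y1))).
  have nG : nrm G <= nrm F + nrm (G - F).
    by have := nrmD F (G - F); rewrite addrC subrK addrC.
  set X := expR _ in S0 GF *; have X0 : 0 <= X by exact: expR_ge0.
  have h1 : K * nrm G * X <= K * (nrm F + nrm (G - F)) * X.
    by rewrite ler_wpM2r// ler_wpM2l.
  apply: (le_trans (lerD h1 (lexx _))).
  have -> : K * (nrm F + nrm (G - F)) * X + K * nrm (G - F) =
    nrm (G - F) * (K * X + K) + K * nrm F * X by ring.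
  rewrite lerD2r; apply: (@le_trans _ _ (nrm (G - F) * (K * X + K + 1))).
    by rewrite ler_wpM2l ?nrm_ge0// lerDl.
  by rewrite -ler_pdivlMr// ltW.
apply: (@mt_le _ t (K * nrm F * expR (- t) + 1) 1).
  by rewrite ltr_wpDl// !mulr_ge0 ?nrm_ge0 ?expR_ge0.
move=> y y1; rewrite -cabs_div; apply: (le_trans (estF y y1)).
have -> : t * (y - 1) = - t + t * y by ring.
rewrite expRD mulrA ler_wpM2r ?expR_ge0// lerDl//.
Qed.

End MeanType.

Theorem proposition4p6 (R : realType) (H : completeNormedModType (Cx R))
  (ev : {linear H -> (Cx R -> Cx R)})
  (HdB : is_deBranges ev)
  (Hreal : forall x : R, exists F : H, ev F x%:C <> 0)
  (D : set (Cx R)) (D_sub : D `<=` @closedUHP R) (D_unb : ~ bounded_set D)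
  (m : Cx R -> R) (m_adm : admissible ev D m) :
  [/\ {within @closedUHP R, continuous (mflat ev D m)},
      subharmonic_on (@UHP R) (fun z => lne (mflat ev D m z)%:E),
      forall w : Cx R,
        zdiv (@closedUHP R) (mflat ev D m) w = maxe (zdiv D m w) (zdivH ev w)
    & forall E : Cx R -> Cx R, hermite_biehler E -> is_HE ev E ->
        mt E (mflat ev D m) = mt_sub ev E (clRm ev D m) ].
Proof.
split.
- by apply: continuous_subspaceT; exact: mflat_continuous.
- exact: mflat_subharmonic.
- exact: zdiv_mflat.
- move=> E E_HB E_H; apply/eqP; rewrite eq_le; apply/andP; split.
    exact: mt_mflat_le.
  exact: mt_clRm_le.
Qed.
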